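(* Let $p>0$, let $(\lambda_n)_{n\ge1}$ be the increasing sequence of positive roots of $\tan(\pi y)=-y/p$, and let $\mathrm{Re}(s)>\frac12$, $x>0$. Then $$\frac{2^{1-2s}x^{s-\frac{1}{2}}\pi^{-s}}{\Gamma(s)}\sum_{m=1}^{\infty}\int_{0}^{\infty}\int_{0}^{1}y^{2s-1}e^{-xy}(1-u^{2})^{s-1}\cos\!\left(myu+2m\arctan\!\left(\frac{yu}{2\pi p}\right)\right)du\,dy$$ $$=\sum_{n=1}^{\infty}\frac{p^{2}+\lambda_{n}^{2}}{p(p+\frac{1}{\pi})+\lambda_{n}^{2}}\,\lambda_{n}^{s-\frac{1}{2}}K_{s-\frac{1}{2}}(2\pi\lambda_{n}x)+\frac{(\pi x)^{\frac{1}{2}-s}}{4}\cdot\frac{\Gamma(s-\frac{1}{2})}{1+\frac{1}{\pi p}}-\frac{\pi^{-s}x^{-s-\frac{1}{2}}\Gamma(s)}{4}.$$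
   Context: $K_\nu$ is the modified Bessel function of the second kind. *)

(* Defs.v *)
From mathcomp Require Export all_boot all_order all_algebra.
From mathcomp Require Export all_classical all_reals all_analysis.
From mathcomp Require Export complex.

Set Implicit Arguments.
Unset Strict Implicit.
Unset Printing Implicit Defensive.

Import Order.TTheory GRing.Theory Num.Theory numFieldNormedType.Exports.
Local Open Scope classical_set_scope.
Local Open Scope ring_scope.
Local Open Scope complex_scope.

(* Lebesgue integrals over subsets of the real line of complex-valued
   functions, taken on the real and imaginary parts. *)
Definition cintegrable (R : realType) (D : set R) (f : R -> R[i]) : Prop :=
  (@lebesgue_measure R).-integrable D (fun t => (complex.Re (f t))%:E) /\
  (@lebesgue_measure R).-integrable D (fun t => (complex.Im (f t))%:E).

Definition cintegral (R : realType) (D : set R) (f : R -> R[i]) : R[i] :=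
  (\int[@lebesgue_measure R]_(t in D) complex.Re (f t))
  +i* (\int[@lebesgue_measure R]_(t in D) complex.Im (f t)).

(* The complex numbers get their topology from the norm; the regular module
   R[i]^o is the type that carries it. The first term has index 1. *)
Definition is_cseries (R : realType) (a : nat -> R[i]) (l : R[i]) : Prop :=
  (fun N => \sum_(1 <= n < N.+1) a n : R[i]^o) @ \oo --> (l : R[i]^o).

Definition cexp (R : realType) (z : R[i]) : R[i] :=
  (expR (complex.Re z))%:C * (cos (complex.Im z) +i* sin (complex.Im z)).

(* Principal value of a ^ z; meaningful for a > 0 only. *)
Definition cpow (R : realType) (a : R) (z : R[i]) : R[i] :=
  cexp (z * (ln a)%:C).

(* Euler's integral; meaningful for Re z > 0 only. *)
Definition cGamma (R : realType) (z : R[i]) : R[i] :=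
  cintegral `]0, +oo[ (fun t => cpow t (z - 1) * (expR (- t))%:C).

Definition ccosh (R : realType) (z : R[i]) : R[i] := (cexp z + cexp (- z)) / 2.

(* K_nu(x) = int_0^oo e^(- x cosh t) cosh(nu t) dt, which holds for every
   complex order nu and every x > 0; meaningful for x > 0 only. *)
Definition besselK (R : realType) (nu : R[i]) (x : R) : R[i] :=
  cintegral `]0, +oo[ (fun t =>
    (expR (- x * ((expR t + expR (- t)) / 2)))%:C * ccosh (nu * t%:C)).

(* lam 1 < lam 2 < ... enumerates the positive roots; lam 0 is irrelevant.
   At a pole of the tangent the library has tan = 0, which differs from
   - y / p for y > 0, so that no pole counts as a root. *)
Definition increasing_positive_roots (R : realType) (p : R) (lam : nat -> R) :
    Prop :=
  (forall m n : nat, (1 <= m)%N -> (m < n)%N -> lam m < lam n) /\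
  (forall y : R, (0 < y /\ tan (pi * y) = - y / p) <->
                 (exists n : nat, (1 <= n)%N /\ y = lam n)).

Definition integrand (R : realType) (p : R) (s : R[i]) (x : R) (m : nat)
    (y u : R) : R[i] :=
  cpow y (2 * s - 1) * (expR (- x * y))%:C * cpow (1 - u ^+ 2) (s - 1) *
  (cos (m%:R * y * u + 2 * m%:R * atan (y * u / (2 * pi * p))))%:C.

(* Main.v *)
(** Write [q = 2 pi p] and [phase a = a + 2 atan (a / q)]; then [a = 2 pi lam n]
    is the solution of [phase a = 2 pi n]. Putting [a = y u] and expanding
    [exp (- x y)] as a mixture of Gaussians in [y], with mixing parameter
    [tau = exp (- t)], turns the [m]-th double integral into a constant times
    [int_R omega t * osc t m dt], where
    [osc t m = int_0^oo cos (m phase a) exp (- tau a^2) da].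
    For fixed [t] the sum over [m] is Poisson summation in the variable
    [phase a]: an integration by parts produces the partial sums of
    [sum_m sin (m th) / m], which converge boundedly to the sawtooth, and the
    sawtooth is affine between the nodes [2 pi lam n]. The partial sums over [m]
    are bounded uniformly in [t], so dominated convergence applies. Integrating
    the limit against [omega], the Gaussian at the node [2 pi lam n] becomes the
    n-th Bessel term, the boundary term at [a = 0] the term in
    [Gamma (s - 1/2)], and [int_0^oo exp (- tau a^2) da] the term in [Gamma s]. *)
Require Import Defs.
From mathcomp Require Import ring lra measurable_realfun.
Import Order.TTheory GRing.Theory Num.Theory numFieldNormedType.Exports.
Local Open Scope classical_set_scope.
Local Open Scope ring_scope.
Local Open Scope complex_scope.

Set Implicit Arguments.
Unset Strict Implicit.
Unset Printing Implicit Defensive.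

(** The order [s] enters only through the weight [omega], so Poisson summation is done on real
    functions for fixed [tau]. The double integrals form a series for which only partial sums can be
    estimated, and every interchange acts on partial sums. Uniformity in [tau] comes from [profile],
    the product of a Gaussian and of [slowness], the reciprocal of the derivative of [phase]. On the
    half-line both factors are monotone with values in [0, 1], so [profile] has variation at most 2,
    while the sine sums are at most 4 in absolute value. On the Bessel side the bound comes from the
    Poisson identity itself: the terms are nonnegative, so partial sums stay below their limit
    [S t], which the identity controls. The rational factor of the n-th Bessel term is [slowness] at
    the node, a Jacobian. Both series are expressed through one integral [J], eliminated in the
    final algebra. Cancelling [Gamma s] requires that it does not vanish, which follows from the
    functional equation and a concentration estimate. *)

Section substitution.
Variable R : realType.
Implicit Types F f G H : R -> R.
Notation mu := (@lebesgue_measure R).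

(** * Change of variables on unbounded domains *)

Lemma is_derive_continuous F (x v : R) : is_derive x 1 F v -> {for x, continuous F}.
Proof.
by move=> h; apply/differentiable_continuous/derivable1_diffP; exact: (@ex_derive _ _ _ _ _ _ _ h).
Qed.

(** Monotone convergence on both sides. It carries substitution rules from compact intervals to the
    whole line. *)
Lemma ge0_integral_exhaust (A B : (set R)^nat) G H :
  nondecreasing_seq A -> nondecreasing_seq B ->
  (forall n, measurable (A n)) -> (forall n, measurable (B n)) ->
  (forall n, measurable_fun (A n) G) -> (forall n, measurable_fun (B n) H) ->
  (forall n x, A n x -> 0 <= G x) -> (forall n x, B n x -> 0 <= H x) ->
  (forall n, \int[mu]_(x in A n) (G x)%:E = \int[mu]_(x in B n) (H x)%:E)%E ->
  (\int[mu]_(x in \bigcup_n A n) (G x)%:E =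
   \int[mu]_(x in \bigcup_n B n) (H x)%:E)%E.
Proof.
move=> ndA ndB mA mB mG mH G0 H0 GH.
have cvgE (C : (set R)^nat) (K : R -> R) : nondecreasing_seq C ->
    (forall n, measurable (C n)) -> (forall n, measurable_fun (C n) K) ->
    (forall n x, C n x -> 0 <= K x) ->
    ((\int[mu]_(x in C n) (K x)%:E)%E @[n --> \oo] -->
     (\int[mu]_(x in \bigcup_n C n) (K x)%:E)%E).
  move=> ndC mC mK K0; apply: ge0_nondecreasing_set_cvg_integral => //.
  by move=> n; apply/measurable_EFinP; exact: mK.
have cA := cvgE A G ndA mA mG G0; have cB := cvgE B H ndB mB mH H0.
move: cA; under eq_fun do rewrite GH.
move=> cA; exact: (cvg_unique _ cA cB).
Qed.

Lemma bigcup_itvNnn : \bigcup_n `[(- n%:R : R), n%:R]%classic = [set: R].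
Proof.
apply/seteqP; split=> // x _; exists (Num.truncn `|x|).+1 => //=.
rewrite in_itv/= -ler_norml; exact/ltW/truncnS_gt.
Qed.

Lemma nondecreasing_itv (a b : R^nat) : nonincreasing_seq a ->
  nondecreasing_seq b -> nondecreasing_seq (fun n => `[a n, b n]%classic).
Proof.
move=> da ib m n mn; apply/subsetPset => x /=; rewrite !in_itv/=.
by move=> /andP[h1 h2]; rewrite (le_trans (da _ _ mn) h1) (le_trans h2 (ib _ _ mn)).
Qed.

Lemma nondecreasing_itvNnn : nondecreasing_seq (fun n => `[(- n%:R : R), n%:R]%classic).
Proof.
by apply: nondecreasing_itv => m n mn; rewrite ?lerN2 ler_nat.
Qed.

Section increasing.
Variables F f : R -> R.
Hypothesis dF : forall x : R, is_derive x 1 F (f x).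
Hypothesis cf : continuous f.
Hypothesis f_gt0 : forall x, 0 < f x.

Let cF : continuous F.
Proof. by move=> x; exact: is_derive_continuous (dF x). Qed.

Let F'E : (F^`())%classic = f.
Proof. by apply/funext => x; rewrite derive1E; exact: (@derive_val _ _ _ _ _ _ _ (dF x)). Qed.

Lemma derive_gt0_homo : {homo F : x y / x < y}.
Proof.
move=> x y xy.
apply: (@gtr0_derive1_lt_cc R F x y) => //; rewrite ?in_itv/= ?lexx ?ltW//.
- by move=> z _; rewrite F'E.
- exact: continuous_subspaceT.
Qed.

Lemma range_bigcup : range F = \bigcup_n `[F (- n%:R), F n%:R]%classic.
Proof.
apply/seteqP; split=> [_ [x _ <-]|y [n _ /=]].
  have : [set: R] x by [].
  rewrite -bigcup_itvNnn => -[n _ /=]; rewrite in_itv/= => /andP[h1 h2].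
  exists n => //=; rewrite in_itv/=; apply/andP; split.
  - by move: h1; rewrite le_eqVlt => /predU1P[->//|/derive_gt0_homo/ltW].
  - by move: h2; rewrite le_eqVlt => /predU1P[->//|/derive_gt0_homo/ltW].
rewrite in_itv/= => /andP[h1 h2].
have nn : - n%:R <= n%:R :> R by rewrite (@le_trans _ _ 0)// oppr_le0.
have [|c _ <-] := @IVT R F (- n%:R) n%:R y nn (continuous_subspaceT cF).
  by rewrite ge_min h1 le_max h2 orbT.
by exists c.
Qed.

(** The rule on [[-n, n]] followed by exhaustion. Using [range F] as domain lets one statement cover
    the line, half-lines and bounded open intervals. Continuity of [G] is asked only on the range
    because the integrands to come may be singular at its endpoints. *)
Lemma ge0_integral_subst G : (forall x, {for F x, continuous G}) ->
  (forall x, 0 <= G (F x)) ->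
  (\int[mu]_(y in range F) (G y)%:E = \int[mu]_x (G (F x) * f x)%:E)%E.
Proof.
move=> cG G0; rewrite range_bigcup -bigcup_itvNnn.
have ndF m n : (m <= n)%N -> F m%:R <= F n%:R.
  by rewrite -(ler_nat R) le_eqVlt => /predU1P[->//|/derive_gt0_homo/ltW].
have nincF m n : (m <= n)%N -> F (- n%:R) <= F (- m%:R).
  rewrite -(ler_nat R) le_eqVlt => /predU1P[->//|h].
  by apply/ltW/derive_gt0_homo; rewrite ltrN2.
have cGF : continuous (fun x => G (F x) * f x).
  by move=> x; apply: cvgM; [exact: (continuous_comp (@cF x) (cG x))|exact: cf].
have inrange n y : y \in `[F (- n%:R), F n%:R] -> range F y.
  by rewrite range_bigcup => h; exists n.
apply: ge0_integral_exhaust.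
- exact: nondecreasing_itv.
- exact: nondecreasing_itvNnn.
- by move=> n; exact: measurable_itv.
- by move=> n; exact: measurable_itv.
- move=> n; apply: subspace_continuous_measurable_fun => //.
  apply: continuous_in_subspaceT => y; rewrite inE/= => /inrange[x _ <-].
  exact: cG.
- by move=> n; apply: measurable_funTS; exact: continuous_measurable_fun.
- by move=> n y /inrange[x _ <-].
- by move=> n x _; rewrite mulr_ge0// ltW.
- move=> n.
  rewrite (@integration_by_substitution_increasing R F G); last 7 first.
  + by rewrite (@le_trans _ _ 0)// oppr_le0.
  + by move=> x y _ _; exact: derive_gt0_homo.
  + by move=> x _; rewrite F'E; exact: cf.
  + rewrite F'E; apply/cvg_ex; exists (f (- n%:R)).
    exact/cvg_at_right_filter/cf.
  + rewrite F'E; apply/cvg_ex; exists (f n%:R).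
    exact/cvg_at_left_filter/cf.
  + split.
    * by move=> x _; exact: (@ex_derive _ _ _ _ _ _ _ (dF x)).
    * exact/cvg_at_right_filter/cF.
    * exact/cvg_at_left_filter/cF.
  + apply: continuous_in_subspaceT => y; rewrite inE/= => /inrange[x _ <-].
    exact: cG.
  by apply: eq_integral => x _; rewrite /= F'E.
Qed.

(** The nonnegative rule applied to the positive and the negative part. Both sides are the same
    difference of extended reals, whether or not [G] is integrable. *)
Lemma integral_subst G : (forall x, {for F x, continuous G}) ->
  (\int[mu]_(y in range F) (G y)%:E = \int[mu]_x (G (F x) * f x)%:E)%E.
Proof.
move=> cG; rewrite integralE [RHS]integralE; congr (_ - _)%E.
- transitivity (\int[mu]_(y in range F) (Num.max (G y) 0)%:E)%E.
    by apply: eq_integral => x _; rewrite funeposE EFin_max.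
  rewrite ge0_integral_subst.
  + apply: eq_integral => x _; rewrite funeposE -EFin_max; congr EFin.
    by rewrite maxr_pMl ?mul0r// ltW.
  + by move=> x; apply: continuous_max; [exact: cG|exact: cvg_cst].
  + by move=> x; rewrite le_max lexx orbT.
- transitivity (\int[mu]_(y in range F) (Num.max (- G y) 0)%:E)%E.
    by apply: eq_integral => x _; rewrite funenegE EFin_max EFinN.
  rewrite ge0_integral_subst.
  + apply: eq_integral => x _; rewrite funenegE -EFinN -EFin_max; congr EFin.
    by rewrite maxr_pMl ?mul0r ?mulNr// ltW.
  + by move=> x; apply: continuous_max; [apply: cvgN; exact: cG|exact: cvg_cst].
  + by move=> x; rewrite le_max lexx orbT.
Qed.

Lemma integrable_subst G : (forall x, {for F x, continuous G}) ->
  mu.-integrable (range F) (EFin \o G) <->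
  mu.-integrable setT (EFin \o (fun x => G (F x) * f x)).
Proof.
move=> cG.
have cGF : continuous (fun x => G (F x) * f x).
  by move=> x; apply: cvgM; [exact: (continuous_comp (@cF x) (cG x))|exact: cf].
have mG : measurable_fun (range F) (EFin \o G).
  apply/measurable_EFinP; rewrite range_bigcup.
  apply/measurable_fun_bigcup => [n|n]; first exact: measurable_itv.
  apply: subspace_continuous_measurable_fun => //.
  apply: continuous_in_subspaceT => y; rewrite inE/= => h.
  have [x _ <-] : range F y by rewrite range_bigcup; exists n.
  exact: cG.
have mGF : measurable_fun setT (EFin \o (fun x => G (F x) * f x)).
  by apply/measurable_EFinP; exact: continuous_measurable_fun.
have E : (\int[mu]_(y in range F) `|(EFin \o G) y| =
    \int[mu]_x `|(G (F x) * f x)%:E|)%E.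
  rewrite [LHS](_ : _ = \int[mu]_(y in range F) (`|G y|)%:E)%E//.
  rewrite ge0_integral_subst//; last first.
    by move=> x; apply: cvg_norm; exact: cG.
  by apply: eq_integral => x _ /=; rewrite normrM (gtr0_norm (f_gt0 x)).
by split=> /integrableP[_ h]; apply/integrableP; split=> //; rewrite ?E// -E.
Qed.

End increasing.

(** Reflection is decreasing, hence not an instance of the preceding rule; the same exhaustion by
    [[-n, n]] works. *)
Lemma integral_oppT G : continuous G ->
  (\int[mu]_x (G x)%:E = \int[mu]_x (G (- x))%:E)%E.
Proof.
have H (K : R -> R) : continuous K -> (forall x, 0 <= K x) ->
    (\int[mu]_x (K x)%:E = \int[mu]_x (K (- x))%:E)%E.
  move=> cK K0; rewrite -bigcup_itvNnn.
  have cKN : continuous (fun x => K (- x)).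
    by move=> x; apply: (@continuous_comp _ _ _ -%R K); [exact: opp_continuous|exact: cK].
  apply: ge0_integral_exhaust => //; try exact: nondecreasing_itvNnn.
  - by move=> n; apply: measurable_funTS; exact: continuous_measurable_fun.
  - by move=> n; apply: measurable_funTS; exact: continuous_measurable_fun.
  - move=> n; have := @integration_by_substitution_oppr R K (- n%:R) n%:R.
    rewrite opprK; apply; first by rewrite (@le_trans _ _ 0)// oppr_le0.
    exact: continuous_subspaceT.
move=> cG; rewrite integralE [RHS]integralE; congr (_ - _)%E.
- transitivity (\int[mu]_y (Num.max (G y) 0)%:E)%E.
    by apply: eq_integral => x _; rewrite funeposE EFin_max.
  rewrite H.
  + by apply: eq_integral => x _; rewrite funeposE -EFin_max.
  + by move=> x; apply: continuous_max; [exact: cG|exact: cvg_cst].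
  + by move=> x; rewrite le_max lexx orbT.
- transitivity (\int[mu]_y (Num.max (- G y) 0)%:E)%E.
    by apply: eq_integral => x _; rewrite funenegE EFin_max EFinN.
  rewrite H.
  + by apply: eq_integral => x _; rewrite funenegE -EFinN -EFin_max.
  + move=> x; apply: (@continuous_max _ _ (fun x => - G x) (cst 0)); last exact: cvg_cst.
    exact: continuousN (cG x).
  + by move=> x; rewrite le_max lexx orbT.
Qed.
End substitution.

(** * Real and imaginary parts, complex exponential and powers *)

Section complex_parts.
Variable R : realType.
Implicit Types (z w : R[i]) (r : R).

Lemma Re_mulc z w : complex.Re (z * w) =
  complex.Re z * complex.Re w - complex.Im z * complex.Im w.
Proof. by case: z => a b; case: w. Qed.

Lemma Im_mulc z w : complex.Im (z * w) =
  complex.Re z * complex.Im w + complex.Im z * complex.Re w.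
Proof. by case: z => a b; case: w. Qed.

Lemma Re_realc r z : complex.Re (r%:C * z) = r * complex.Re z.
Proof. by rewrite Re_mulc/= mul0r subr0. Qed.

Lemma Im_realc r z : complex.Im (r%:C * z) = r * complex.Im z.
Proof. by rewrite Im_mulc/= mul0r addr0. Qed.

Lemma Re_addc z w : complex.Re (z + w) = complex.Re z + complex.Re w.
Proof. by case: z => a b; case: w. Qed.

Lemma Im_addc z w : complex.Im (z + w) = complex.Im z + complex.Im w.
Proof. by case: z => a b; case: w. Qed.

Lemma Re_sum (I : Type) (s : seq I) (F : I -> R[i]) :
  complex.Re (\sum_(i <- s) F i) = \sum_(i <- s) complex.Re (F i).
Proof. by elim/big_rec2: _ => [|i y z _ <-]; rewrite ?Re_addc. Qed.

Lemma Im_sum (I : Type) (s : seq I) (F : I -> R[i]) :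
  complex.Im (\sum_(i <- s) F i) = \sum_(i <- s) complex.Im (F i).
Proof. by elim/big_rec2: _ => [|i y z _ <-]; rewrite ?Im_addc. Qed.

Lemma Re_cexp z : complex.Re (cexp z) = expR (complex.Re z) * cos (complex.Im z).
Proof. by rewrite /cexp Re_realc. Qed.

Lemma Im_cexp z : complex.Im (cexp z) = expR (complex.Re z) * sin (complex.Im z).
Proof. by rewrite /cexp Im_realc. Qed.

Lemma cexpD z w : cexp (z + w) = cexp z * cexp w.
Proof.
rewrite /cexp !(Re_addc, Im_addc) expRD cosD sinD.
by apply/eqP; rewrite eq_complex/=; apply/andP; split; apply/eqP; ring.
Qed.

Lemma cexp0 : cexp (0 : R[i]) = 1.
Proof. by rewrite /cexp/= expR0 cos0 sin0 mul1r. Qed.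

Lemma cexpN z : cexp (- z) = (cexp z)^-1.
Proof.
have h : cexp (- z) * cexp z = 1 by rewrite -cexpD addNr cexp0.
have z0 : cexp z != 0.
  by apply/eqP => z0; move/eqP: h; rewrite z0 mulr0 eq_sym oner_eq0.
by rewrite -[RHS]mul1r -h mulfK.
Qed.

Lemma cexp_real r : cexp (r%:C) = (expR r)%:C.
Proof. by rewrite /cexp/= cos0 sin0 mulr1. Qed.

Lemma norm_Re_cexp r z : `|complex.Re (r%:C * cexp z)| <= `|r| * expR (complex.Re z).
Proof.
rewrite Re_realc Re_cexp !normrM (ger0_norm (expR_ge0 _)) ler_wpM2l//.
by rewrite -[leRHS]mulr1 ler_wpM2l ?expR_ge0// cos_max.
Qed.

Lemma norm_Im_cexp r z : `|complex.Im (r%:C * cexp z)| <= `|r| * expR (complex.Re z).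
Proof.
rewrite Im_realc Im_cexp !normrM (ger0_norm (expR_ge0 _)) ler_wpM2l//.
by rewrite -[leRHS]mulr1 ler_wpM2l ?expR_ge0// sin_max.
Qed.

Lemma cpowM (a b : R) z : 0 < a -> 0 < b -> cpow (a * b) z = cpow a z * cpow b z.
Proof. by move=> a0 b0; rewrite /cpow lnM// raddfD/= mulrDr cexpD. Qed.

Lemma cpowD (a : R) z w : cpow a (z + w) = cpow a z * cpow a w.
Proof. by rewrite /cpow mulrDl cexpD. Qed.

Lemma cpowN (a : R) z : cpow a (- z) = (cpow a z)^-1.
Proof. by rewrite /cpow mulNr cexpN. Qed.

Lemma cpow_neq0 (a : R) z : cpow a z != 0.
Proof.
apply/eqP => h; have : cpow a (z - z) = 1 by rewrite /cpow subrr mul0r cexp0.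
by rewrite cpowD h mul0r => /eqP; rewrite eq_sym oner_eq0.
Qed.

Lemma cpow_expR (t : R) z : cpow (expR t) z = cexp (z * t%:C).
Proof. by rewrite /cpow expRK. Qed.

Lemma cpow_real (a r : R) : cpow a r%:C = (expR (r * ln a))%:C.
Proof. by rewrite /cpow -rmorphM/= cexp_real. Qed.

Lemma halfC : (1 / 2 : R[i]) = (1 / 2 : R)%:C.
Proof. by rewrite rmorphM/= fmorphV/= rmorph1 rmorph_nat. Qed.

Lemma Re_sub_half z : complex.Re (z - 1 / 2) = complex.Re z - 1 / 2.
Proof. by rewrite halfC -raddfN Re_addc. Qed.

Lemma cpow_half (a : R) : 0 < a -> cpow a (1 / 2) = (Num.sqrt a)%:C.
Proof. by move=> a0; rewrite halfC cpow_real -powR12_sqrt ?ltW// /powR gt_eqF// mul1r. Qed.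

Lemma cpow1 (a : R) : 0 < a -> cpow a 1 = a%:C.
Proof. by move=> a0; rewrite /cpow mul1r cexp_real lnK. Qed.
End complex_parts.

(** * Measurability and continuity of complex-valued functions *)

Section complex_regularity.
Variable R : realType.

(** Integrals are taken on real and imaginary parts, so regularity is asked of the parts as well. *)
Definition cmeasurable d (T : measurableType d) (D : set T) (f : T -> R[i]) :=
  measurable_fun D (fun t => complex.Re (f t)) /\
  measurable_fun D (fun t => complex.Im (f t)).

Definition ccontinuous_at (f : R -> R[i]) (x : R) :=
  {for x, continuous (fun t => complex.Re (f t))} /\
  {for x, continuous (fun t => complex.Im (f t))}.

Lemma measurable_cos : measurable_fun [set: R] (@cos R).
Proof. by apply: continuous_measurable_fun; exact: continuous_cos. Qed.

Lemma measurable_sin : measurable_fun [set: R] (@sin R).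
Proof. by apply: continuous_measurable_fun; exact: continuous_sin. Qed.

Lemma cmeasurableM d (T : measurableType d) (D : set T) (f g : T -> R[i]) :
  cmeasurable D f -> cmeasurable D g -> cmeasurable D (fun t => f t * g t).
Proof.
move=> [f1 f2] [g1 g2]; split.
  under eq_fun do rewrite Re_mulc.
  by apply: measurable_funB; exact: measurable_funM.
under eq_fun do rewrite Im_mulc.
by apply: measurable_funD; exact: measurable_funM.
Qed.

Lemma cmeasurable_real d (T : measurableType d) (D : set T) (f : T -> R) :
  measurable_fun D f -> cmeasurable D (fun t => (f t)%:C).
Proof. by move=> mf; split=> //=; exact: measurable_cst. Qed.

Lemma cmeasurable_cexp d (T : measurableType d) (D : set T) z (f : T -> R) :
  measurable_fun D f -> cmeasurable D (fun t => cexp (z * (f t)%:C)).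
Proof.
move=> mf; split.
  under eq_fun do rewrite Re_cexp Re_mulc Im_mulc/= !mulr0 subr0 add0r.
  apply: measurable_funM; apply: measurableT_comp => //;
    by [exact: measurable_expR|exact: measurable_cos|
        apply: measurable_funM => //; exact: measurable_cst].
under eq_fun do rewrite Im_cexp Re_mulc Im_mulc/= !mulr0 subr0 add0r.
apply: measurable_funM; apply: measurableT_comp => //;
  by [exact: measurable_expR|exact: measurable_sin|
      apply: measurable_funM => //; exact: measurable_cst].
Qed.

Lemma ccontinuousM (f g : R -> R[i]) (x : R) : ccontinuous_at f x ->
  ccontinuous_at g x -> ccontinuous_at (fun t => f t * g t) x.
Proof.
move=> [f1 f2] [g1 g2]; split.
  rewrite (_ : (fun t => _) = (fun t => complex.Re (f t) * complex.Re (g t) -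
    complex.Im (f t) * complex.Im (g t))); last by apply/funext => t; exact: Re_mulc.
  by apply: (@continuousB _ R^o); exact: continuousM.
rewrite (_ : (fun t => _) = (fun t => complex.Re (f t) * complex.Im (g t) +
  complex.Im (f t) * complex.Re (g t))); last by apply/funext => t; exact: Im_mulc.
by apply: (@continuousD _ R^o); exact: continuousM.
Qed.

Lemma ccontinuousD (f g : R -> R[i]) (x : R) : ccontinuous_at f x ->
  ccontinuous_at g x -> ccontinuous_at (fun t => f t + g t) x.
Proof.
move=> [f1 f2] [g1 g2]; split.
  rewrite (_ : (fun t => complex.Re (f t + g t)) = fun t => complex.Re (f t) + complex.Re (g t)).
    exact: continuousD.
  by apply/funext => t; rewrite Re_addc.
rewrite (_ : (fun t => complex.Im (f t + g t)) = fun t => complex.Im (f t) + complex.Im (g t)).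
  exact: continuousD.
by apply/funext => t; rewrite Im_addc.
Qed.

Lemma ccontinuous_real (f : R -> R) x : {for x, continuous f} ->
  ccontinuous_at (fun t => (f t)%:C) x.
Proof. by move=> mf; split=> //=; exact: cvg_cst. Qed.

Lemma ccontinuous_cexp (z : R[i]) (f : R -> R) (x : R) : {for x, continuous f} ->
  ccontinuous_at (fun t => cexp (z * (f t)%:C)) x.
Proof.
move=> mf; have mfZ c : {for x, continuous (fun t => c * f t)}.
  by apply: continuousM => //; exact: cvg_cst.
have cE : {for x, continuous (fun t => expR (complex.Re z * f t))}.
  by apply: (@continuous_comp _ _ _ _ expR) => //; exact: continuous_expR.
split.
  rewrite (_ : (fun t => _) =
    (fun t => expR (complex.Re z * f t) * cos (complex.Im z * f t))); last first.
    by apply/funext => t; rewrite Re_cexp Re_mulc Im_mulc/= !mulr0 subr0 add0r.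
  apply: continuousM => //.
  by apply: (@continuous_comp _ _ _ _ cos) => //; exact: continuous_cos.
rewrite (_ : (fun t => _) =
  (fun t => expR (complex.Re z * f t) * sin (complex.Im z * f t))); last first.
  by apply/funext => t; rewrite Im_cexp Re_mulc Im_mulc/= !mulr0 subr0 add0r.
apply: continuousM => //.
by apply: (@continuous_comp _ _ _ _ sin) => //; exact: continuous_sin.
Qed.

Lemma ccontinuous_cmeasurable (f : R -> R[i]) :
  (forall x, ccontinuous_at f x) -> cmeasurable setT f.
Proof.
by move=> cf; split; apply: continuous_measurable_fun => x; case: (cf x).
Qed.
End complex_regularity.

(** * Linearity of integrability for real functions *)

Section integrable_real.
Context d (T : measurableType d) (R : realType) (m : {measure set T -> \bar R}).
Variable D : set T.
Hypothesis mD : measurable D.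
Implicit Types g h : T -> R.

Lemma integrable_EFinZ (r : R) g : m.-integrable D (fun t => (g t)%:E) ->
  m.-integrable D (fun t => (r * g t)%:E).
Proof.
move=> ig; have := integrableZl mD r ig.
by apply: eq_integrable => // t _; rewrite EFinM.
Qed.

Lemma integrable_EFinD g h : m.-integrable D (fun t => (g t)%:E) ->
  m.-integrable D (fun t => (h t)%:E) -> m.-integrable D (fun t => (g t + h t)%:E).
Proof. by move=> ig ih; exact: (integrableD mD ig ih). Qed.

Lemma integrable_EFinB g h : m.-integrable D (fun t => (g t)%:E) ->
  m.-integrable D (fun t => (h t)%:E) -> m.-integrable D (fun t => (g t - h t)%:E).
Proof. by move=> ig ih; exact: (integrableB mD ig ih). Qed.

Lemma integrable_EFin_sum (I : Type) (s : seq I) (f : I -> T -> R) :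
  (forall i, m.-integrable D (fun t => (f i t)%:E)) ->
  m.-integrable D (fun t => (\sum_(i <- s) f i t)%:E).
Proof.
move=> fi; elim: s => [|i s ih].
  by under eq_fun do rewrite big_nil; exact: integrable0.
by under eq_fun do rewrite big_cons; exact: integrable_EFinD.
Qed.

Lemma Rintegral_sum (I : Type) (s : seq I) (f : I -> T -> R) :
  (forall i, m.-integrable D (fun t => (f i t)%:E)) ->
  \int[m]_(t in D) (\sum_(i <- s) f i t) = \sum_(i <- s) \int[m]_(t in D) f i t.
Proof.
move=> fi; elim: s => [|i s ih].
  under eq_fun do rewrite big_nil.
  by rewrite big_nil /Rintegral integral0.
under eq_fun do rewrite big_cons.
rewrite RintegralD//; first by rewrite ih big_cons.
  exact: fi.
exact: integrable_EFin_sum.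
Qed.

Lemma integrable_EFin_indic g : m.-integrable D (fun t => (g t)%:E) <->
  m.-integrable setT (fun t => (\1_D t * g t)%:E).
Proof.
rewrite (integrable_mkcond _ mD).
suff -> : (fun t => (\1_D t * g t)%:E) = (fun t => (g t)%:E) \_ D by [].
by apply/funext => t; rewrite patchE indicE; case: ifP => _; rewrite ?mul1r ?mul0r.
Qed.
End integrable_real.

(** * Fubini's theorem for real-valued integrals *)

Section fubini_real.
Local Open Scope ereal_scope.
Context d1 d2 (T1 : measurableType d1) (T2 : measurableType d2) (R : realType).
Variable m1 : {sigma_finite_measure set T1 -> \bar R}.
Variable m2 : {sigma_finite_measure set T2 -> \bar R}.

(** An integrable extended-valued function is finite almost everywhere, so [fine] changes it only on
    a null set. *)
Lemma integrable_fine d (T : measurableType d) (m : {measure set T -> \bar R})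
    (h : T -> \bar R) : m.-integrable setT h ->
  m.-integrable setT (fun x => (fine (h x))%:E) /\ \int[m]_x (fine (h x))%:E = \int[m]_x h x.
Proof.
move=> hi; have mh := measurable_int _ hi.
have mfh : measurable_fun setT (fun x => (fine (h x))%:E).
  by apply/measurable_EFinP; apply: measurableT_comp => //; exact: measurable_fine.
have E : ae_eq m setT (fun x => (fine (h x))%:E) h.
  have := integrable_ae measurableT hi; apply: filterS => x /(_ I) hx _.
  by rewrite fineK.
split; last exact: ae_eq_integral.
by apply: le_integrable hi => // x _; case: (h x) => //=; rewrite normr0 leey.
Qed.

Lemma Rfubini (f : T1 * T2 -> R) :
  (m1 \x m2).-integrable setT (fun z => (f z)%:E) ->
  [/\ m1.-integrable setT (fun x => (\int[m2]_y f (x, y))%R%:E),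
      m2.-integrable setT (fun y => (\int[m1]_x f (x, y))%R%:E) &
      (\int[m1]_x (\int[m2]_y f (x, y)) = \int[m2]_y (\int[m1]_x f (x, y)))%R].
Proof.
move=> fi; have mf := measurable_int _ fi.
have [i1 e1] := integrable_fine (integrable_fubini_F fi).
(* These section integrals are dominated by those of the absolute value of [f], whose iterated
   integral is finite in this order too. *)
have iG : m2.-integrable setT (fun y => \int[m1]_x (f (x, y))%:E).
  apply/integrableP; split; first exact: measurable_fubini_G fi.
  have /(integrable21ltyP _ _ mf) := fi.
  apply: le_lt_trans; apply: ge0_le_integral => //.
  - by apply: measurableT_comp => //; exact: measurable_fubini_G fi.
  - have := @measurable_fun_fubini_tonelli_G _ _ _ _ R m1 (abse \o (fun z => (f z)%:E)).
    by apply => //=; exact: measurableT_comp.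
  - move=> y _; apply: le_abse_integral => //.
    by apply: (measurableT_comp mf); exact: pair2_measurable.
have [i2 e2] := integrable_fine iG.
split => //; rewrite {1}/Rintegral e1 [RHS]/Rintegral e2; congr fine.
exact: Fubini.
Qed.
End fubini_real.

(** * Complex integrals: linearity, dominated convergence, substitution, Fubini *)

Section complex_integral.
Variable R : realType.
Notation mu := (@lebesgue_measure R).
Implicit Types (D : set R) (f : R -> R[i]).

Lemma eq_cintegral D f g : {in D, f =1 g} -> cintegral D f = cintegral D g.
Proof.
by move=> fg; rewrite /cintegral; congr Complex; apply: eq_Rintegral => t Dt;
  rewrite fg.
Qed.

Lemma eq_cintegrable D f g : measurable D -> {in D, f =1 g} ->
  cintegrable D f -> cintegrable D g.
Proof.
move=> mD fg [f1 f2]; split.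
  by apply: eq_integrable f1 => // t Dt; rewrite fg.
by apply: eq_integrable f2 => // t Dt; rewrite fg.
Qed.

Lemma cintegrableZ D (c : R[i]) f : measurable D -> cintegrable D f ->
  cintegrable D (fun t => c * f t).
Proof.
move=> mD [f1 f2]; split.
  under eq_fun do rewrite Re_mulc.
  by apply: integrable_EFinB => //; exact: integrable_EFinZ.
under eq_fun do rewrite Im_mulc.
by apply: integrable_EFinD => //; exact: integrable_EFinZ.
Qed.

Lemma cintegralZ D (c : R[i]) f : measurable D -> cintegrable D f ->
  cintegral D (fun t => c * f t) = c * cintegral D f.
Proof.
move=> mD [f1 f2]; apply/eqP; rewrite eq_complex Re_mulc Im_mulc/=.
apply/andP; split; apply/eqP.
  rewrite -!RintegralZl// -RintegralB//; try exact: integrable_EFinZ.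
  by apply: eq_Rintegral => t _; rewrite Re_mulc.
rewrite -!RintegralZl// -RintegralD//; try exact: integrable_EFinZ.
by apply: eq_Rintegral => t _; rewrite Im_mulc.
Qed.

Lemma cintegrableD D f g : measurable D -> cintegrable D f ->
  cintegrable D g -> cintegrable D (fun t => f t + g t).
Proof.
move=> mD [f1 f2] [g1 g2]; split.
  by under eq_fun do rewrite Re_addc; exact: integrable_EFinD.
by under eq_fun do rewrite Im_addc; exact: integrable_EFinD.
Qed.

Lemma cintegralD D f g : measurable D -> cintegrable D f -> cintegrable D g ->
  cintegral D (fun t => f t + g t) = cintegral D f + cintegral D g.
Proof.
move=> mD [f1 f2] [g1 g2]; apply/eqP; rewrite eq_complex Re_addc Im_addc/=.
apply/andP; split; apply/eqP; rewrite -RintegralD//.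
  by apply: eq_Rintegral => t _; rewrite Re_addc.
by apply: eq_Rintegral => t _; rewrite Im_addc.
Qed.

Lemma cintegrable0 D : measurable D -> cintegrable D (fun=> 0).
Proof. by move=> mD; split => /=; exact: integrable0. Qed.

Lemma cintegral0 D : cintegral D (fun=> 0) = 0.
Proof. by rewrite /cintegral/= /Rintegral integral0. Qed.

Lemma cintegrable_sum D (I : Type) (s : seq I) (f : I -> R -> R[i]) :
  measurable D -> (forall i, cintegrable D (f i)) ->
  cintegrable D (fun t => \sum_(i <- s) f i t).
Proof.
move=> mD fi; elim: s => [|i s ih].
  by under eq_fun do rewrite big_nil; exact: cintegrable0.
by under eq_fun do rewrite big_cons; exact: cintegrableD.
Qed.

Lemma cintegral_sum D (I : Type) (s : seq I) (f : I -> R -> R[i]) :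
  measurable D -> (forall i, cintegrable D (f i)) ->
  cintegral D (fun t => \sum_(i <- s) f i t) = \sum_(i <- s) cintegral D (f i).
Proof.
move=> mD fi; elim: s => [|i s ih].
  by under eq_fun do rewrite big_nil; rewrite big_nil; exact: cintegral0.
under eq_fun do rewrite big_cons.
by rewrite cintegralD// ?ih ?big_cons//; exact: cintegrable_sum.
Qed.

Lemma le_cintegrable D f (g : R -> R) : measurable D -> cmeasurable D f ->
  (forall t, D t -> `|complex.Re (f t)| <= g t) ->
  (forall t, D t -> `|complex.Im (f t)| <= g t) ->
  mu.-integrable D (EFin \o g) -> cintegrable D f.
Proof.
move=> mD [m1 m2] h1 h2 ig; split.
  apply: le_integrable ig => //; first exact/measurable_EFinP.
  by move=> t Dt /=; rewrite lee_fin (le_trans (h1 t Dt))// ler_norm.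
apply: le_integrable ig => //; first exact/measurable_EFinP.
by move=> t Dt /=; rewrite lee_fin (le_trans (h2 t Dt))// ler_norm.
Qed.

Lemma cintegrable_cmeasurable D f : cintegrable D f -> cmeasurable D f.
Proof.
move=> [/measurable_int/measurable_EFinP f1 /measurable_int/measurable_EFinP f2].
by split.
Qed.

Lemma Rdominated_cvg D (f_ : nat -> R -> R) (f g : R -> R) : measurable D ->
  (forall n, measurable_fun D (f_ n)) ->
  (forall t, D t -> f_ n t @[n --> \oo] --> f t) ->
  (forall n t, D t -> `|f_ n t| <= g t) ->
  mu.-integrable D (EFin \o g) ->
  mu.-integrable D (EFin \o f) /\
  (\int[mu]_(t in D) f_ n t @[n --> \oo] --> \int[mu]_(t in D) f t).
Proof.
move=> mD mf ff fg ig.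
have [|||||i1 _ i2] := @dominated_convergence _ _ _ mu D mD
  (fun n t => (f_ n t)%:E) (EFin \o f) (EFin \o g).
- by move=> n; apply/measurable_EFinP; exact: mf.
- by apply/measurable_EFinP; exact: measurable_fun_cvg ff.
- by apply: aeW => t Dt; apply: cvg_EFin; [exact: nearW|exact: ff].
- by [].
- by apply: aeW => t n Dt /=; rewrite lee_fin; exact: fg.
split => //; rewrite /Rintegral.
by apply/fine_cvg; rewrite fineK//; exact: integrable_fin_num.
Qed.

Lemma cdominated_cvg D (f_ : nat -> R -> R[i]) f (g : R -> R) : measurable D ->
  (forall n, cmeasurable D (f_ n)) ->
  (forall t, D t -> complex.Re (f_ n t) @[n --> \oo] --> complex.Re (f t)) ->
  (forall t, D t -> complex.Im (f_ n t) @[n --> \oo] --> complex.Im (f t)) ->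
  (forall n t, D t -> `|complex.Re (f_ n t)| <= g t) ->
  (forall n t, D t -> `|complex.Im (f_ n t)| <= g t) ->
  mu.-integrable D (EFin \o g) ->
  [/\ cintegrable D f,
    complex.Re (cintegral D (f_ n)) @[n --> \oo] --> complex.Re (cintegral D f) &
    complex.Im (cintegral D (f_ n)) @[n --> \oo] --> complex.Im (cintegral D f)].
Proof.
move=> mD mf f1 f2 g1 g2 ig.
have [i1 c1] := Rdominated_cvg mD (fun n => (mf n).1) f1 g1 ig.
have [i2 c2] := Rdominated_cvg mD (fun n => (mf n).2) f2 g2 ig.
by split.
Qed.

Lemma cintegral_mkcond D f : cintegral D f = cintegral setT (fun t => (\1_D t)%:C * f t).
Proof.
rewrite /cintegral; congr Complex; rewrite [LHS]Rintegral_mkcond;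
  apply: eq_Rintegral => t _.
  by rewrite Re_realc patchE indicE; case: ifP => _; rewrite ?mul1r ?mul0r.
by rewrite Im_realc patchE indicE; case: ifP => _; rewrite ?mul1r ?mul0r.
Qed.

Lemma cintegrable_mkcond D f : measurable D ->
  cintegrable D f <-> cintegrable setT (fun t => (\1_D t)%:C * f t).
Proof.
move=> mD; rewrite /cintegrable.
have [r1 r2] : (fun t => (complex.Re ((\1_D t)%:C * f t))%:E) =
    (fun t => (\1_D t * complex.Re (f t))%:E) /\
  (fun t => (complex.Im ((\1_D t)%:C * f t))%:E) =
    (fun t => (\1_D t * complex.Im (f t))%:E).
  by split; apply/funext => t; rewrite ?Re_realc ?Im_realc.
rewrite r1 r2; split=> -[h1 h2]; split.
- by apply/(integrable_EFin_indic mu mD).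
- by apply/(integrable_EFin_indic mu mD).
- by apply/(integrable_EFin_indic mu mD).
- by apply/(integrable_EFin_indic mu mD).
Qed.

Section subst.
Variables F g : R -> R.
Hypothesis dF : forall x : R, is_derive x 1 F (g x).
Hypothesis cg : continuous g.
Hypothesis g_gt0 : forall x, 0 < g x.

Lemma cintegral_subst f : (forall x, ccontinuous_at f (F x)) ->
  cintegral (range F) f = cintegral setT (fun x => (g x)%:C * f (F x)).
Proof.
move=> cf; rewrite /cintegral; congr Complex; rewrite /Rintegral.
  rewrite (integral_subst dF)//; last by move=> x; case: (cf x).
  by congr fine; apply: eq_integral => x _; rewrite Re_realc mulrC.
rewrite (integral_subst dF)//; last by move=> x; case: (cf x).
by congr fine; apply: eq_integral => x _; rewrite Im_realc mulrC.
Qed.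

Lemma cintegrable_subst f : (forall x, ccontinuous_at f (F x)) ->
  cintegrable (range F) f <-> cintegrable setT (fun x => (g x)%:C * f (F x)).
Proof.
move=> cf; rewrite /cintegrable.
have -> : (fun t => (complex.Re ((g t)%:C * f (F t)))%:E) =
    EFin \o (fun t => complex.Re (f (F t)) * g t).
  by apply/funext => t /=; rewrite Re_realc mulrC.
have -> : (fun t => (complex.Im ((g t)%:C * f (F t)))%:E) =
    EFin \o (fun t => complex.Im (f (F t)) * g t).
  by apply/funext => t /=; rewrite Im_realc mulrC.
rewrite -(integrable_subst dF cg g_gt0 (fun x => (cf x).1)).
by rewrite -(integrable_subst dF cg g_gt0 (fun x => (cf x).2)).
Qed.
End subst.

Lemma cintegral_oppT f : (forall x, ccontinuous_at f x) ->
  cintegral setT f = cintegral setT (fun x => f (- x)).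
Proof.
move=> cf; rewrite /cintegral; congr Complex; rewrite /Rintegral.
  by rewrite integral_oppT// => x; case: (cf x).
by rewrite integral_oppT// => x; case: (cf x).
Qed.

(** By Tonelli, one finite iterated integral of the real majorant [g] makes both parts of [f]
    integrable on the product. *)
Lemma cfubini (f : R * R -> R[i]) (g : R * R -> R) :
  cmeasurable setT f -> measurable_fun setT g ->
  (forall z, `|complex.Re (f z)| <= g z) ->
  (forall z, `|complex.Im (f z)| <= g z) ->
  (\int[mu]_x \int[mu]_y (g (x, y))%:E < +oo)%E ->
  [/\ cintegrable setT (fun x => cintegral setT (fun y => f (x, y))),
      cintegrable setT (fun y => cintegral setT (fun x => f (x, y))) &
      cintegral setT (fun x => cintegral setT (fun y => f (x, y))) =
      cintegral setT (fun y => cintegral setT (fun x => f (x, y)))].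
Proof.
move=> [m1 m2] mg h1 h2 gi.
have g0 z : 0 <= g z by exact: le_trans (h1 z).
have ig : (mu \x mu)%E.-integrable setT (fun z => (g z)%:E).
  apply/integrable12ltyP; first exact/measurable_EFinP.
  apply: le_lt_trans gi; rewrite le_eqVlt; apply/orP; left; apply/eqP.
  apply: eq_integral => x _; apply: eq_integral => y _.
  by rewrite gee0_abs// lee_fin.
have if1 : (mu \x mu)%E.-integrable setT (fun z => (complex.Re (f z))%:E).
  apply: le_integrable ig => //; first exact/measurable_EFinP.
  by move=> z _ /=; rewrite lee_fin (ger0_norm (g0 z)).
have if2 : (mu \x mu)%E.-integrable setT (fun z => (complex.Im (f z))%:E).
  apply: le_integrable ig => //; first exact/measurable_EFinP.
  by move=> z _ /=; rewrite lee_fin (ger0_norm (g0 z)).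
have [a1 a2 a3] := Rfubini if1; have [b1 b2 b3] := Rfubini if2.
by split; [split|split|rewrite {1}/cintegral/= a3 b3].
Qed.
End complex_integral.

(** * Rules for computing derivatives *)

Section derivation_rules.
Variable R : realType.
Implicit Types (f g : R -> R) (x a b c : R).

(* A plain constant, hidden from the type class resolution of [is_derive], which
   would otherwise pick the values of derivatives itself. *)
Definition has_der f x a := is_derive x 1 f a.

Lemma derD f g x a b : has_der f x a -> has_der g x b ->
  has_der (fun t => f t + g t) x (a + b).
Proof. by move=> hf hg; exact: is_deriveD. Qed.

Lemma derN f x a : has_der f x a -> has_der (fun t => - f t) x (- a).
Proof. by move=> hf; exact: is_deriveN. Qed.

Lemma derB f g x a b : has_der f x a -> has_der g x b ->
  has_der (fun t => f t - g t) x (a - b).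
Proof. by move=> hf hg; exact: is_deriveB. Qed.

Lemma derM f g x a b : has_der f x a -> has_der g x b ->
  has_der (fun t => f t * g t) x (a * g x + f x * b).
Proof.
move=> hf hg; have h := is_deriveM hf hg.
by apply: (is_derive_eq h); rewrite addrC; congr (_ + _); rewrite mulrC.
Qed.

Lemma derC c x : has_der (fun=> c) x 0.
Proof. exact: is_derive_cst. Qed.

Lemma derI x : has_der (fun t : R => t) x 1.
Proof. exact: is_derive_id. Qed.

Lemma derV f x a : f x != 0 -> has_der f x a ->
  has_der (fun t => (f t)^-1) x (- (f x ^- 2) * a).
Proof. by move=> fx0 hf; exact: (is_deriveV fx0 hf). Qed.

Lemma derX f n x a : has_der f x a ->
  has_der (fun t => f t ^+ n.+1) x (n.+1%:R * f x ^+ n * a).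
Proof.
move=> hf; elim: n => [|n ih]; first by under eq_fun do rewrite expr1; rewrite expr0 mulr1 mul1r.
under eq_fun do rewrite exprS.
apply: (is_derive_eq (derM hf ih)).
by rewrite -[n.+2%:R]natr1 [f x ^+ n.+1]exprS; ring.
Qed.

Lemma der_expR f x a : has_der f x a ->
  has_der (fun t => expR (f t)) x (expR (f x) * a).
Proof. by move=> hf; exact: (is_derive1_comp (is_derive_expR (f x)) hf). Qed.

Lemma der_cos f x a : has_der f x a ->
  has_der (fun t => cos (f t)) x (- sin (f x) * a).
Proof. by move=> hf; exact: (is_derive1_comp (is_derive_cos (f x)) hf). Qed.

Lemma der_sin f x a : has_der f x a ->
  has_der (fun t => sin (f t)) x (cos (f x) * a).
Proof. by move=> hf; exact: (is_derive1_comp (is_derive_sin (f x)) hf). Qed.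

Lemma der_atan f x a : has_der f x a ->
  has_der (fun t => atan (f t)) x ((1 + f x ^+ 2)^-1 * a).
Proof. by move=> hf; exact: (is_derive1_comp (is_derive1_atan (f x)) hf). Qed.

Lemma der_eq f x a b : has_der f x a -> a = b -> has_der f x b.
Proof. by move=> h <-. Qed.

Lemma has_der_continuous f x a : has_der f x a -> {for x, continuous f}.
Proof. exact: is_derive_continuous. Qed.
End derivation_rules.

(** [eassumption] comes first so that derivatives of abstract functions in the context are picked
    up. Subtraction is handled by [derD] and [derN]. [derV] is left out because its nonvanishing
    condition has to be supplied by hand. *)
Ltac der := repeat first [ eassumption | apply: derC | apply: derI | apply: derD | apply: derN
  | apply: derM | apply: derX | apply: der_expR | apply: der_cos | apply: der_sin
  | apply: der_atan ].

(** * Elementary inequalities and improper real integrals *)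

Section real_integrals.
Variable R : realType.
Notation mu := (@lebesgue_measure R).

Lemma sin_le_norm (w : R) : `|sin w| <= `|w|.
Proof.
have H (v : R) : 0 <= v -> `|sin v| <= v.
  rewrite le_eqVlt => /predU1P[<-|v0]; first by rewrite sin0 normr0.
  have [c _] := MVT v0 (fun x _ => is_derive_sin x)
    (continuous_subspaceT (@continuous_sin R)).
  rewrite sin0 !subr0 => ->; rewrite normrM (gtr0_norm v0).
  by rewrite -[leRHS]mul1r ler_wpM2r ?(ltW v0) ?cos_max.
have [w0|w0] := leP 0 w; first by rewrite (ger0_norm w0) H.
by rewrite (ltr0_norm w0) -normrN -sinN H// oppr_ge0 ltW.
Qed.

Lemma cos_ge_quadratic (y : R) : 1 - y ^+ 2 <= cos y.
Proof.
have -> : cos y = 1 - 2 * sin (y / 2) ^+ 2.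
  rewrite -[in LHS](@divfK _ 2 _ y)// mulr_natr cos_mulr2n cos2sin2 mulr2n; ring.
have : sin (y / 2) ^+ 2 <= (y / 2) ^+ 2.
  by rewrite -ler_sqrt ?sqr_ge0// !sqrtr_sqr sin_le_norm.
by rewrite expr_div_n; nra.
Qed.

(** With [w = y / 2] the right side is [4 * (expR w - expR (- w)) ^+ 2], and
    [w <= expR w - expR (- w)] for [w >= 0] follows from [1 + w <= expR w]. A square is traded for
    exponentials, whose integrals against the Gamma density are known. *)
Lemma sqr_le_cosh (y : R) : y ^+ 2 <= 4 * (expR y + expR (- y) - 2).
Proof.
have H (w : R) : 0 <= w -> w ^+ 2 <= (expR w - expR (- w)) ^+ 2.
  move=> w0; have w1 : 0 < 1 + w by rewrite ltr_pwDl.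
  have h1 := expR_ge1Dx w.
  have h2 : expR (- w) <= (1 + w)^-1 by rewrite expRN lef_pV2 ?posrE ?expR_gt0.
  have h3 : w <= (1 + w) - (1 + w)^-1.
    have : (1 + w) * (1 + w)^-1 = 1 by rewrite divff// gt_eqF.
    have : (1 + w)^-1 <= 1 by rewrite invf_le1// lerDl.
    lra.
  rewrite ler_sqr ?nnegrE//; first by lra.
  by lra.
have E : expR y + expR (- y) - 2 = (expR (y / 2) - expR (- (y / 2))) ^+ 2.
  have -> : expR y = expR (y / 2) ^+ 2 by rewrite expr2 -expRD -splitr.
  have -> : expR (- y) = expR (- (y / 2)) ^+ 2.
    by rewrite expr2 -expRD -opprD -splitr.
  have e : expR (y / 2) * expR (- (y / 2)) = 1 by rewrite -expRD subrr expR0.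
  by rewrite sqrrB e; ring.
have : (y / 2) ^+ 2 <= (expR (y / 2) - expR (- (y / 2))) ^+ 2.
  have [y0|y0] := leP 0 (y / 2); first exact: H.
  rewrite -[in leLHS]sqrrN -[leRHS]sqrrN opprB.
  by have := H (- (y / 2)); rewrite opprK; apply; rewrite oppr_ge0 ltW.
by rewrite E expr_div_n; lra.
Qed.

Lemma integrable_expN_norm (b : R) : 0 < b ->
  mu.-integrable setT (fun t => (expR (- b * `|t|))%:E).
Proof.
move=> b0.
have cE : continuous (fun t : R => expR (- b * `|t|)).
  move=> t; have h : {for t, continuous (fun t : R => - b * `|t|)}.
    by apply: continuousM; [exact: cvg_cst|exact: norm_continuous].
  exact: (continuous_comp h (@continuous_expR R _)).
apply/integrableP; split.
  by apply/measurable_EFinP; exact: continuous_measurable_fun.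
under eq_integral do rewrite gee0_abs ?lee_fin ?expR_ge0//.
rewrite ge0_symfun_integralT//; last by move=> x /=; rewrite normrN.
rewrite -set_itvcy.
have -> : (\int[mu]_(x in `[0%R, +oo[) (expR (- b * `|x|))%:E =
    \int[mu]_(x in `[0%R, +oo[) (expR (- b * x))%:E)%E.
  apply: eq_integral => x; rewrite inE/= in_itv/= andbT => x0.
  by rewrite ger0_norm.
have dE (x : R) : is_derive x 1 (fun t : R => - b^-1 * expR (- b * t)) (expR (- b * x)).
  apply: (@der_eq _ _ _ _ _ (derM (derC (- b^-1) x)
    (der_expR (derM (derC (- b) x) (derI x))))).
  by rewrite !mul0r !add0r mulr1 mulrCA mulrNN mulVf ?mulr1// gt_eqF.
rewrite (@ge0_continuous_FTC2y R _ (fun t => - b^-1 * expR (- b * t)) 0 0).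
- by rewrite ltry.
- by move=> x _; exact: expR_ge0.
- apply: continuous_subspaceT => x.
  exact: (has_der_continuous (der_expR (derM (derC (- b) x) (derI x)))).
- rewrite -[X in _ --> X](mulr0 (- b^-1)); apply: cvgM; first exact: cvg_cst.
  under eq_fun do rewrite mulNr.
  apply: (@cvg_comp _ _ _ (fun x => b * x) (fun x => expR (- x)) _ (pinfty_nbhs R)).
    by apply: gt0_cvgMry => //; exact: cvg_id.
  exact: cvgr_expR.
- by move=> x _; exact: (@ex_derive _ _ _ _ _ _ _ (dE x)).
- by apply: cvg_at_right_filter; exact: is_derive_continuous (dE 0).
- by move=> x _; rewrite derive1E; exact: (@derive_val _ _ _ _ _ _ _ (dE x)).
Qed.

Lemma integrable_expN_bound (f : R -> R) (C b : R) : 0 < b -> continuous f ->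
  (forall t, `|f t| <= C * expR (- b * `|t|)) ->
  mu.-integrable setT (fun t => (f t)%:E).
Proof.
move=> b0 cf h; have := integrable_EFinZ measurableT C (integrable_expN_norm b0).
apply: le_integrable => //.
  by apply/measurable_EFinP; exact: continuous_measurable_fun.
by move=> t _ /=; rewrite lee_fin (le_trans (h t))// ler_norm.
Qed.

(** Dominated convergence for [f] times the indicators of the growing sets. *)
Lemma cvg_Rintegral_exhaust (A : (set R)^nat) (f : R -> R) :
  nondecreasing_seq A -> (forall n, measurable (A n)) ->
  mu.-integrable (\bigcup_n A n) (fun t => (f t)%:E) ->
  \int[mu]_(t in A n) f t @[n --> \oo] --> \int[mu]_(t in \bigcup_n A n) f t.
Proof.
move=> ndA mA fi; set D := \bigcup_n A n.
have mD : measurable D by exact: bigcup_measurable.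
have mf : measurable_fun D f by apply/measurable_EFinP; exact: measurable_int fi.
have AD n : A n `<=` D by move=> t At; exists n.
have E n : \int[mu]_(t in A n) f t = \int[mu]_(t in D) (\1_(A n) t * f t).
  rewrite -{1}(setIidr (AD n)) Rintegral_mkcondr; apply: eq_Rintegral => t _.
  by rewrite patchE indicE; case: ifP => _; rewrite ?mul1r ?mul0r.
under eq_fun do rewrite E.
have [||||_ //] := @Rdominated_cvg R D (fun n t => \1_(A n) t * f t) f
  (fun t => `|f t|) mD.
- by move=> n; apply: measurable_funM => //; exact: measurable_indic.
- move=> t [N _ AN]; apply: cvg_near_cst; near=> n.
  rewrite indicE mem_set ?mul1r//.
  have Nn : (N <= n)%N by near: n; exact: nbhs_infty_ge.
  by have /subsetPset := ndA _ _ Nn; exact.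
- move=> n t _; rewrite normrM indicE ger0_norm//.
  by case: (_ \in _); rewrite ?mul1r ?mul0r.
- exact: (integrable_norm fi).
Unshelve. all: by end_near. Qed.

Lemma Rintegral_derive (F f : R -> R) (a b : R) : a <= b ->
  (forall x : R, is_derive x 1 F (f x)) -> continuous f ->
  \int[mu]_(t in `[a, b]) f t = F b - F a.
Proof.
rewrite le_eqVlt => /predU1P[<- _ _|ab dF cf].
  by rewrite set_itv1 Rintegral_set1 subrr.
have cF : continuous F by move=> x; exact: is_derive_continuous (dF x).
rewrite /Rintegral (@continuous_FTC2 R f F a b)//.
- exact: continuous_subspaceT.
- split.
  + by move=> x _; exact: (@ex_derive _ _ _ _ _ _ _ (dF x)).
  + exact/cvg_at_right_filter/cF.
  + exact/cvg_at_left_filter/cF.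
- by move=> x _; rewrite derive1E; exact: (@derive_val _ _ _ _ _ _ _ (dF x)).
Qed.

Lemma RintegralT_derive (F f : R -> R) (l l' : R) :
  (forall x : R, is_derive x 1 F (f x)) -> continuous f ->
  mu.-integrable setT (fun t => (f t)%:E) ->
  F n%:R @[n --> \oo] --> l -> F (- n%:R) @[n --> \oo] --> l' ->
  \int[mu]_t f t = l - l'.
Proof.
move=> dF cf fi Fl Fl'.
have h : \int[mu]_(t in `[(- n%:R), n%:R]) f t @[n --> \oo] --> \int[mu]_t f t.
  rewrite -bigcup_itvNnn; apply: cvg_Rintegral_exhaust.
  - exact: nondecreasing_itvNnn.
  - by move=> n; exact: measurable_itv.
  - by rewrite bigcup_itvNnn.
have h' : \int[mu]_(t in `[(- n%:R), n%:R]) f t @[n --> \oo] --> l - l'.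
  under eq_fun => n.
    rewrite (@Rintegral_derive F f)//; last by rewrite (@le_trans _ _ 0)// oppr_le0.
    over.
  exact: cvgB.
exact: (cvg_unique _ h h').
Qed.
End real_integrals.

(** * The Gamma integral on the line, its functional equation and its nonvanishing *)

Section gamma.
Variable R : realType.
Notation mu := (@lebesgue_measure R).
Implicit Types (z : R[i]) (b t : R).

Lemma cintegral_shift (f : R -> R[i]) (c : R) : (forall x, ccontinuous_at f x) ->
  cintegral setT f = cintegral setT (fun x => f (x + c)).
Proof.
move=> cf.
have dF (x : R) : is_derive x 1 (fun t : R => t + c) 1.
  by apply: (der_eq (derD (derI x) (derC c x))); rewrite addr0.
have -> : [set: R] = range (fun t : R => t + c).
  by apply/esym/seteqP; split=> // y _; exists (y - c) => //; rewrite subrK.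
rewrite (cintegral_subst dF)//; last by move=> x; exact: cvg_cst.
have -> : range (fun t : R => t + c) = setT.
  by apply/seteqP; split=> // y _; exists (y - c) => //; rewrite subrK.
by apply: eq_cintegral => x _; rewrite mul1r.
Qed.

Lemma range_expR : range (@expR R) = `]0, +oo[%classic.
Proof.
apply/seteqP; split=> [_ [t _ <-]|y] /=; rewrite in_itv/= andbT ?expR_gt0//.
by move=> y0; exists (ln y) => //; rewrite lnK.
Qed.

Lemma cintegral_expR (f : R -> R[i]) : (forall x, 0 < x -> ccontinuous_at f x) ->
  cintegral `]0, +oo[ f = cintegral setT (fun t => (expR t)%:C * f (expR t)).
Proof.
move=> cf; rewrite -range_expR (cintegral_subst (@is_derive_expR R))//.
- exact: continuous_expR.
- by move=> x; exact: expR_gt0.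
- by move=> x; apply: cf; exact: expR_gt0.
Qed.

(** The integrand of [int_0^oo exp (- b u) u^(z - 1) du] after [u = exp t]. On the whole line,
    scaling in [b] becomes a translation in [t]. *)
Definition gamma_kernel z b t : R[i] := (expR (- b * expR t))%:C * cexp (z * t%:C).

Lemma ccontinuous_gamma_kernel z b t : ccontinuous_at (gamma_kernel z b) t.
Proof.
apply: ccontinuousM.
  by apply: ccontinuous_real; apply: has_der_continuous; der.
by apply: ccontinuous_cexp; exact: cvg_id.
Qed.

Lemma gamma_kernel_bound (a b : R) : 0 < a -> 0 < b ->
  exists C : R, forall t, expR (- b * expR t) * expR (a * t) <=
    C * expR (- Num.min a 1 * `|t|).
Proof.
(* At [t0] the function [b exp t] has slope [a + 1]. Its tangent there gives
   [a t - b exp t <= - t + (a + 1) (t0 - 1)], which settles [t >= 0]. For [t < 0] the double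
   exponential is at most 1 and [exp (a t)] decays. *)
move=> a0 b0; pose t0 := ln ((a + 1) / b).
have q0 : 0 < (a + 1) / b by rewrite divr_gt0// addr_gt0.
exists (1 + expR ((a + 1) * (t0 - 1))) => t; rewrite mulrDl mul1r -expRD.
have [t_ge0|t_lt0] := leP 0 t.
  apply: (@le_trans _ _ (expR ((a + 1) * (t0 - 1)) * expR (- Num.min a 1 * `|t|))); last first.
    by rewrite lerDr ?mulr_ge0 ?expR_ge0.
  rewrite -expRD ler_expR ger0_norm//.
  have h1 : (a + 1) * (1 + (t - t0)) <= b * expR t.
    have -> : b * expR t = (a + 1) * expR (t - t0).
      rewrite expRD expRN lnK ?posrE// invf_div.
      by field; rewrite gt_eqF// addr_gt0.
    by rewrite ler_wpM2l ?addr_ge0 ?(ltW a0)// expR_ge1Dx.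
  have h2 : Num.min a 1 * t <= t.
    by rewrite -[leRHS]mul1r ler_wpM2r// ge_min lexx orbT.
  by rewrite mulrDr mulr1 mulrBr in h1; lra.
apply: (@le_trans _ _ (expR (- Num.min a 1 * `|t|))); last by rewrite lerDl mulr_ge0 ?expR_ge0.
rewrite ler_expR ltr0_norm// mulrNN.
have h1 : Num.min a 1 * (- t) <= a * (- t).
  by rewrite ler_wpM2r ?oppr_ge0 ?(ltW t_lt0)// ge_min lexx.
have h2 : 0 <= b * expR t by rewrite mulr_ge0 ?expR_ge0// ltW.
by rewrite !mulrN in h1; lra.
Qed.

Lemma Re_gamma_kernel z b t : complex.Re (gamma_kernel z b t) =
  expR (- b * expR t) * (expR (complex.Re z * t) * cos (complex.Im z * t)).
Proof. by rewrite Re_realc Re_cexp Re_mulc Im_mulc/= !mulr0 subr0 add0r. Qed.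

Lemma Im_gamma_kernel z b t : complex.Im (gamma_kernel z b t) =
  expR (- b * expR t) * (expR (complex.Re z * t) * sin (complex.Im z * t)).
Proof. by rewrite Im_realc Im_cexp Re_mulc Im_mulc/= !mulr0 subr0 add0r. Qed.

Lemma norm_gamma_kernel z b t :
  `|complex.Re (gamma_kernel z b t)| <= expR (- b * expR t) * expR (complex.Re z * t) /\
  `|complex.Im (gamma_kernel z b t)| <= expR (- b * expR t) * expR (complex.Re z * t).
Proof.
rewrite Re_gamma_kernel Im_gamma_kernel !normrM !(ger0_norm (expR_ge0 _)).
by split; rewrite ler_wpM2l ?expR_ge0// -[leRHS]mulr1 ler_wpM2l ?expR_ge0//;
  [exact: cos_max|exact: sin_max].
Qed.

Lemma integrable_gamma_kernel (a b : R) : 0 < a -> 0 < b ->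
  mu.-integrable setT (fun t => (expR (- b * expR t) * expR (a * t))%:E).
Proof.
move=> a0 b0; have [C hC] := gamma_kernel_bound a0 b0.
apply: (@integrable_expN_bound R _ C (Num.min a 1)).
- by rewrite lt_min a0 ltr01.
- by move=> t; apply: has_der_continuous; der.
- by move=> t; rewrite ger0_norm ?mulr_ge0 ?expR_ge0.
Qed.

Lemma cintegrable_gamma_kernel z b : 0 < complex.Re z -> 0 < b ->
  cintegrable setT (gamma_kernel z b).
Proof.
move=> z0 b0; apply: (le_cintegrable _ _ _ _ (integrable_gamma_kernel z0 b0)) => //.
- exact: (ccontinuous_cmeasurable (@ccontinuous_gamma_kernel z b)).
- by move=> t _; case: (norm_gamma_kernel z b t).
- by move=> t _; case: (norm_gamma_kernel z b t).
Qed.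

Lemma ccontinuous_cpow z (x : R) : 0 < x -> ccontinuous_at (fun t => cpow t z) x.
Proof. by move=> x0; apply: ccontinuous_cexp; exact: continuous_ln. Qed.

Lemma cGammaE z : cGamma z = cintegral setT (gamma_kernel z 1).
Proof.
rewrite /cGamma cintegral_expR.
  apply: eq_cintegral => t _; rewrite cpow_expR /gamma_kernel mulN1r.
  rewrite -cexp_real mulrA -cexpD mulrC; congr (_ * cexp _).
  by rewrite mulrBl mul1r addrC subrK.
move=> x x0; apply: ccontinuousM; first exact: ccontinuous_cpow.
by apply: ccontinuous_real; apply: has_der_continuous; der.
Qed.

Lemma cGamma_scale z b : 0 < complex.Re z -> 0 < b ->
  cintegral setT (gamma_kernel z b) = cpow b (- z) * cGamma z.
Proof.
move=> z0 b0; apply: (mulfI (cpow_neq0 b z)).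
rewrite mulrA -cpowD subrr {2}/cpow mul0r cexp0 mul1r cGammaE.
rewrite [RHS](cintegral_shift (ln b)); last first.
  by move=> x; exact: ccontinuous_gamma_kernel.
rewrite -cintegralZ//; last exact: cintegrable_gamma_kernel.
apply: eq_cintegral => t _; rewrite /gamma_kernel expRD lnK// raddfD/=.
rewrite mulrDr cexpD -/(cpow b z) (_ : -1 * (expR t * b) = - b * expR t); last by ring.
by ring.
Qed.

Lemma cvg_expN_bound (f : R -> R) (C b : R) : 0 < b ->
  (forall t, `|f t| <= C * expR (- b * `|t|)) ->
  f n%:R @[n --> \oo] --> 0 /\ f (- n%:R) @[n --> \oo] --> 0.
Proof.
move=> b0 h.
have E : C * expR (- b * n%:R) @[n --> \oo] --> 0.
  rewrite -[X in _ --> X](mulr0 C); apply: cvgM; first exact: cvg_cst.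
  under eq_fun do rewrite mulNr.
  have bx : expR (- (b * x)) @[x --> +oo] --> (0 : R).
    apply: (@cvg_comp _ _ _ (fun x => b * x) (fun x => expR (- x)) _ (pinfty_nbhs R)).
      by apply: gt0_cvgMry => //; exact: cvg_id.
    exact: cvgr_expR.
  exact: (cvg_comp _ _ (@cvgr_idn R) bx).
have EN : - (C * expR (- b * n%:R)) @[n --> \oo] --> 0.
  by rewrite -oppr0; exact: cvgN.
split; apply: (squeeze_cvgr _ EN E); near=> n; rewrite -ler_norml.
  by rewrite (le_trans (h _))// ger0_norm.
by rewrite (le_trans (h _))// normrN ger0_norm.
Unshelve. all: by end_near. Qed.

(** Integration by parts: [gamma_kernel z 1] has derivative [z * gamma_kernel z 1 - gamma_kernel (z
    + 1) 1] and tends to 0 at both ends. *)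
Lemma cGammaS z : 0 < complex.Re z -> cGamma (z + 1) = z * cGamma z.
Proof.
move=> z0; have z1 : 0 < complex.Re (z + 1) by rewrite Re_addc/= addr_gt0.
have i0 := cintegrable_gamma_kernel z0 (@ltr01 R).
have i1 := cintegrable_gamma_kernel z1 (@ltr01 R).
have iz := cintegrableZ z measurableT i0.
have [C hC] := gamma_kernel_bound z0 (@ltr01 R).
have m0 : 0 < Num.min (complex.Re z) 1 by rewrite lt_min z0 ltr01.
have dR (t : R) : is_derive t 1 (fun t => complex.Re (gamma_kernel z 1 t))
    (complex.Re (z * gamma_kernel z 1 t) - complex.Re (gamma_kernel (z + 1) 1 t)).
  under eq_fun do rewrite Re_gamma_kernel.
  rewrite Re_mulc !Re_gamma_kernel Im_gamma_kernel Re_addc Im_addc/= addr0.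
  rewrite mulrDl mul1r expRD.
  by apply: der_eq; [der|rewrite /=; ring].
have dI (t : R) : is_derive t 1 (fun t => complex.Im (gamma_kernel z 1 t))
    (complex.Im (z * gamma_kernel z 1 t) - complex.Im (gamma_kernel (z + 1) 1 t)).
  under eq_fun do rewrite Im_gamma_kernel.
  rewrite Im_mulc !Im_gamma_kernel Re_gamma_kernel Re_addc Im_addc/= addr0.
  rewrite mulrDl mul1r expRD.
  by apply: der_eq; [der|rewrite /=; ring].
have cR : continuous (fun t =>
    complex.Re (z * gamma_kernel z 1 t) - complex.Re (gamma_kernel (z + 1) 1 t)).
  rewrite (_ : (fun t => _) = (fun t =>
    complex.Re z * (expR (- 1 * expR t) * (expR (complex.Re z * t) * cos (complex.Im z * t))) -
    complex.Im z * (expR (- 1 * expR t) * (expR (complex.Re z * t) * sin (complex.Im z * t))) -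
    expR (- 1 * expR t) * (expR ((complex.Re z + 1) * t) * cos (complex.Im z * t)))).
    by move=> t; apply: has_der_continuous; der.
  by apply/funext => t; rewrite Re_mulc !Re_gamma_kernel Im_gamma_kernel Re_addc Im_addc/= addr0.
have cI : continuous (fun t =>
    complex.Im (z * gamma_kernel z 1 t) - complex.Im (gamma_kernel (z + 1) 1 t)).
  rewrite (_ : (fun t => _) = (fun t =>
    complex.Re z * (expR (- 1 * expR t) * (expR (complex.Re z * t) * sin (complex.Im z * t))) +
    complex.Im z * (expR (- 1 * expR t) * (expR (complex.Re z * t) * cos (complex.Im z * t))) -
    expR (- 1 * expR t) * (expR ((complex.Re z + 1) * t) * sin (complex.Im z * t)))).
    by move=> t; apply: has_der_continuous; der.
  by apply/funext => t; rewrite Im_mulc !Im_gamma_kernel Re_gamma_kernel Re_addc Im_addc/= addr0.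
have [r1 r2] := cvg_expN_bound m0
  (fun t => le_trans (norm_gamma_kernel z 1 t).1 (hC t)).
have [j1 j2] := cvg_expN_bound m0
  (fun t => le_trans (norm_gamma_kernel z 1 t).2 (hC t)).
have eR := RintegralT_derive dR cR (integrable_EFinB measurableT iz.1 i1.1) r1 r2.
have eI := RintegralT_derive dI cI (integrable_EFinB measurableT iz.2 i1.2) j1 j2.
rewrite !cGammaE -cintegralZ//; apply/eqP; rewrite eq_complex/=.
apply/andP; split; rewrite eq_sym -subr_eq0; apply/eqP.
  by rewrite -RintegralB// ?eR ?subrr//; [exact: iz.1|exact: i1.1].
by rewrite -RintegralB// ?eI ?subrr//; [exact: iz.2|exact: i1.2].
Qed.

Definition rgamma (a : R) := \int[mu]_t (expR (- 1 * expR t) * expR (a * t)).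

Lemma cGamma_real (a : R) : cGamma a%:C = (rgamma a)%:C.
Proof.
rewrite cGammaE /cintegral; congr Complex.
  by apply: eq_Rintegral => t _; rewrite Re_gamma_kernel/= mul0r cos0 mulr1.
transitivity (\int[mu]_(t in [set: R]) (0 : R)).
  by apply: eq_Rintegral => t _; rewrite Im_gamma_kernel/= mul0r sin0 !mulr0.
by rewrite /Rintegral integral0.
Qed.

Lemma rgammaS (a : R) : 0 < a -> rgamma (a + 1) = a * rgamma a.
Proof.
move=> a0; have /(_ a0) := @cGammaS a%:C; rewrite -[1]/(1%:C) -rmorphD/=.
by rewrite !cGamma_real -rmorphM => -[].
Qed.

Lemma rgamma_gt0 (a : R) : 0 < a -> 0 < rgamma a.
Proof.
move=> a0; have ia := integrable_gamma_kernel a0 (@ltr01 R).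
have E : (0 < \int[mu]_t (expR (- 1 * expR t) * expR (a * t))%:E)%E.
  apply: (@lt_le_trans _ _ (\int[mu]_(t in `[0%R, 1%R]) (expR (- 1 * expR 1))%:E)%E).
    rewrite integral_cst//= lebesgue_measure_itv/= lte_fin ltr01.
    by rewrite oppr0 addr0 mule1 lte_fin expR_gt0.
  apply: (@le_trans _ _ (\int[mu]_(t in `[0%R, 1%R])
      (expR (- 1 * expR t) * expR (a * t))%:E)%E).
    apply: ge0_le_integral => //.
    - apply: (measurable_funS measurableT) => //; exact: measurable_int ia.
    - move=> t; rewrite /= in_itv/= => /andP[t0 t1]; rewrite lee_fin.
      rewrite -[leLHS]mulr1 ler_pM ?expR_ge0//.
        by rewrite ler_expR !mulN1r lerN2 ler_expR.
      by rewrite -[leLHS]expR0 ler_expR mulr_ge0// ltW.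
  by apply: ge0_subset_integral => //; exact: measurable_int ia.
rewrite /rgamma /Rintegral fine_gt0// E/=.
exact: integrable_lty ia.
Qed.

(* Under the probability density proportional to [exp (a t - exp t)], whose
   normalisation is [rgamma a], the variable [t] concentrates at [ln a] as [a]
   grows, so that the characteristic function of [t] stays away from zero. *)
Lemma cGamma_neq0_large z : 1 < complex.Re z ->
  4 * complex.Im z ^+ 2 < complex.Re z - 1 -> cGamma z != 0.
Proof.
set a := complex.Re z; set v := complex.Im z => a1 va; apply/eqP => Gz.
have a0 : 0 < a by lra.
have am0 : 0 < a - 1 by lra.
have iz := cintegrable_gamma_kernel a0 (@ltr01 R).
pose k b t := expR (- 1 * expR t) * expR (b * t).
have ik b : 0 < b -> mu.-integrable setT (fun t => (k b t)%:E).
  by move=> b0; exact: integrable_gamma_kernel.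
(* [U] is the real part of the kernel rotated by the phase [v ln a], that is
   [k a t * cos (v * (t - ln a))]. [L] bounds it from below after the cosine is replaced by a
   quadratic and the quadratic by exponentials of [t - ln a], which turn [k a] into multiples of
   [k (a + 1)] and [k (a - 1)]. The functional equation then evaluates the integral of [L], positive
   exactly when [4 v^2 < a - 1]. *)
pose L t := (1 + 8 * v ^+ 2) * k a t - 4 * v ^+ 2 * (a^-1 * k (a + 1) t + a * k (a - 1) t).
pose U t := cos (v * ln a) * complex.Re (gamma_kernel z 1 t) +
  sin (v * ln a) * complex.Im (gamma_kernel z 1 t).
have ia1 : mu.-integrable setT (fun t => (a^-1 * k (a + 1) t)%:E).
  by apply: integrable_EFinZ => //; apply: ik; lra.
have ia2 : mu.-integrable setT (fun t => (a * k (a - 1) t)%:E).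
  by apply: integrable_EFinZ => //; apply: ik.
have ia3 : mu.-integrable setT (fun t => (a^-1 * k (a + 1) t + a * k (a - 1) t)%:E).
  exact: integrable_EFinD.
have ia4 : mu.-integrable setT
    (fun t => (4 * v ^+ 2 * (a^-1 * k (a + 1) t + a * k (a - 1) t))%:E).
  exact: integrable_EFinZ.
have ia5 : mu.-integrable setT (fun t => ((1 + 8 * v ^+ 2) * k a t)%:E).
  by apply: integrable_EFinZ => //; exact: ik.
have iL : mu.-integrable setT (fun t => (L t)%:E) by exact: integrable_EFinB.
have iU1 : mu.-integrable setT
    (fun t => (cos (v * ln a) * complex.Re (gamma_kernel z 1 t))%:E).
  by apply: integrable_EFinZ => //; exact: iz.1.
have iU2 : mu.-integrable setT
    (fun t => (sin (v * ln a) * complex.Im (gamma_kernel z 1 t))%:E).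
  by apply: integrable_EFinZ => //; exact: iz.2.
have iU : mu.-integrable setT (fun t => (U t)%:E) by exact: integrable_EFinD.
have EU : \int[mu]_t U t = 0.
  move: Gz; rewrite cGammaE /cintegral => -[e1 e2].
  rewrite RintegralD//= !RintegralZl//; [|exact: iz.2|exact: iz.1].
  by rewrite e1 e2 !mulr0 addr0.
have EL : \int[mu]_t L t = rgamma a * (1 - 4 * v ^+ 2 / (a - 1)).
  rewrite RintegralB// RintegralZl//; last exact: ik.
  rewrite RintegralZl// RintegralD// !RintegralZl//; try by apply: ik; lra.
  rewrite -!/(rgamma _) rgammaS//.
  have := rgammaS am0; rewrite subrK => ->.
  by field; rewrite !gt_eqF.
have /(le_Rintegral measurableT iL iU) : forall t, [set: R] t -> L t <= U t.
  move=> t _; rewrite /U Re_gamma_kernel Im_gamma_kernel -/a -/v.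
  have -> : cos (v * ln a) * (expR (-1 * expR t) * (expR (a * t) * cos (v * t))) +
      sin (v * ln a) * (expR (-1 * expR t) * (expR (a * t) * sin (v * t))) =
      k a t * cos (v * (t - ln a)).
    by rewrite mulrBr cosB /k; ring.
  have k1 : a^-1 * k (a + 1) t = k a t * expR (t - ln a).
    by rewrite /k mulrDl mul1r !expRD expRN lnK//; ring.
  have k2 : a * k (a - 1) t = k a t * expR (- (t - ln a)).
    by rewrite /k mulrBl mul1r opprB !expRD lnK//; ring.
  rewrite /L k1 k2.
  have k0 : 0 <= k a t by rewrite mulr_ge0 ?expR_ge0.
  have h1 := cos_ge_quadratic (v * (t - ln a)).
  have h2 := sqr_le_cosh (t - ln a).
  set E1 := expR (t - ln a) in h2 *; set E2 := expR _ in h2 *.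
  apply: (@le_trans _ _ (k a t * (1 + 8 * v ^+ 2 - 4 * v ^+ 2 * (E1 + E2)))).
    by rewrite le_eqVlt; apply/orP; left; apply/eqP; ring.
  rewrite ler_wpM2l// (le_trans _ h1)// exprMn.
  have := ler_wpM2l (sqr_ge0 v) h2.
  by lra.
rewrite EU EL; apply/negP; rewrite -ltNge mulr_gt0 ?rgamma_gt0//.
by rewrite subr_gt0 ltr_pdivrMr// mul1r.
Qed.

(** Adding a large integer raises the real part and keeps the imaginary part, so the previous lemma
    applies far to the right. The functional equation brings the nonvanishing back one unit at a
    time. *)
Lemma cGamma_neq0 z : 0 < complex.Re z -> cGamma z != 0.
Proof.
move=> z0.
pose n := (Num.truncn (4 * complex.Im z ^+ 2 + 1)).+1.
have n_gt : 4 * complex.Im z ^+ 2 + 1 < n%:R by exact: truncnS_gt.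
have nC m : (m%:R : R[i]) = (m%:R : R)%:C by rewrite rmorph_nat.
have : cGamma (z + n%:R) != 0.
  apply: cGamma_neq0_large; rewrite ?Re_addc ?Im_addc nC/= ?addr0.
    by have := sqr_ge0 (complex.Im z); lra.
  by lra.
elim: n {n_gt} => [|m ih]; first by rewrite addr0.
rewrite -natr1 addrA cGammaS ?mulf_eq0 ?negb_or; first by case/andP => _ /ih.
by rewrite Re_addc nC/= ltr_wpDr.
Qed.
End gamma.

(** * Bounded convergence of the sine series to the sawtooth *)

Section sine_sums.
Variable R : realType.
Implicit Types (N n m : nat) (t w : R).

Definition sinsum N t : R := \sum_(1 <= m < N.+1) sin (m%:R * t) / m%:R.
Definition cossum N t : R := \sum_(1 <= m < N.+1) cos (m%:R * t).

Lemma der_sinsum N t : has_der (sinsum N) t (cossum N t).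
Proof.
elim: N => [|N ih].
  rewrite /cossum big_geq// (_ : sinsum 0 = fun=> 0); first exact: derC.
  by apply/funext => x; rewrite /sinsum big_geq.
rewrite (_ : sinsum N.+1 = fun x => sinsum N x + sin (N.+1%:R * x) / N.+1%:R); last first.
  by apply/funext => x; rewrite /sinsum big_nat_recr.
apply: der_eq; first by der.
have -> : cossum N.+1 t = cossum N t + cos (N.+1%:R * t) by rewrite /cossum big_nat_recr.
by rewrite /= mul0r add0r mulr1 mulr0 addr0 mulfK// pnatr_eq0.
Qed.

(** The Dirichlet kernel with its denominator multiplied out. *)
Lemma cossumE N t : 2 * sin (t / 2) * (1 / 2 + cossum N t) = sin ((N%:R + 1 / 2) * t).
Proof.
elim: N => [|N ih].
  rewrite /cossum big_geq// addr0 add0r (_ : 1 / 2 * t = t / 2); last by field.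
  by field.
rewrite /cossum big_nat_recr//= addrA mulrDr ih.
have -> : (N%:R + 1 / 2) * t = N.+1%:R * t - t / 2 by rewrite -natr1; field.
have -> : (N.+1%:R + 1 / 2) * t = N.+1%:R * t + t / 2 by field.
by rewrite sinB sinD; ring.
Qed.

Lemma sin_natpi n : sin (n%:R * pi) = 0 :> R.
Proof.
elim: n => [|n ih]; first by rewrite mul0r sin0.
by rewrite -natr1 mulrDl mul1r sinDpi ih oppr0.
Qed.

Lemma norm_sin_natM n w : `|sin (n%:R * w)| <= n%:R * `|sin w|.
Proof.
elim: n => [|n ih]; first by rewrite mul0r sin0 normr0 mul0r.
rewrite -natr1 mulrDl mul1r sinD mulrDl mul1r.
rewrite (le_trans (ler_normD _ _))// !normrM lerD//.
  by rewrite -[leRHS]mulr1 ler_pM// cos_max.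
by rewrite -[leRHS]mul1r ler_wpM2r// cos_max.
Qed.

Lemma sinsum_pi N : sinsum N pi = 0.
Proof. by rewrite /sinsum big1// => m _; rewrite sin_natpi mul0r. Qed.

Lemma sinsum0 N : sinsum N 0 = 0.
Proof. by rewrite /sinsum big1// => m _; rewrite mulr0 sin0 mul0r. Qed.

Lemma sinsumN N t : sinsum N (- t) = - sinsum N t.
Proof. by rewrite /sinsum -sumrN; apply: eq_bigr => m _; rewrite mulrN sinN mulNr. Qed.

Lemma sinsumD2pi N n t : sinsum N (t + 2 * pi * n%:R) = sinsum N t.
Proof.
apply: eq_bigr => m _; congr (_ / _).
have -> : m%:R * (t + 2 * pi * n%:R) = m%:R * t + (pi *+ 2) *+ (m * n) :> R.
  by rewrite -[pi *+ 2 *+ _]mulr_natl natrM -[pi *+ 2]mulr_natl; ring.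
by rewrite (periodicn (@sinD2pi R)).
Qed.

Lemma sin_half_gt0 t : 0 < t -> t <= pi -> 0 < sin (t / 2).
Proof.
move=> t0 tpi; apply: sin_gt0_pi; rewrite divr_gt0//=.
by have := @pi_gt0 R; lra.
Qed.

(** Integration by parts of the Dirichlet kernel on [[t, pi]], in differential form. Adding the
    boundary term [cos ((N + 1/2) x) / (M sin (x / 2))] to the error gives [g], whose derivative no
    longer contains the large sine term and satisfies [|g'| <= - i']. Since [g pi = 0] and
    [i pi >= 0], both [i + g] and [i - g] are nonincreasing and end nonnegative, so [|g t| <= i t].
    Removing the boundary term costs one more [i t]. *)
Lemma sinsum_dist N t : 0 < t -> t <= pi ->
  `|sinsum N t - (pi - t) / 2| <= 2 / ((2 * N%:R + 1) * sin (t / 2)).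
Proof.
move=> t0 tpi; set M := 2 * N%:R + 1 : R.
have M0 : 0 < M by rewrite ltr_wpDl// mulr_ge0.
have s0 x : t <= x -> x <= pi -> 0 < sin (x / 2).
  by move=> tx; apply: sin_half_gt0; exact: lt_le_trans tx.
pose g x := sinsum N x - (pi - x) / 2 + cos ((N%:R + 1 / 2) * x) * (M * sin (x / 2))^-1.
pose g' x := - (cos ((N%:R + 1 / 2) * x) * cos (x / 2) / (2 * M * sin (x / 2) ^+ 2)).
have dg x : t <= x -> x <= pi -> has_der g x (g' x).
  move=> tx xpi; have sx := s0 x tx xpi.
  have Msx : M * sin (x / 2) != 0 by rewrite mulf_neq0 ?gt_eqF.
  apply: der_eq.
    apply: derD; first by apply: derD; [exact: der_sinsum|der].
    by apply: derM; [der|apply: derV; [exact: Msx|der]].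
  rewrite /g'.
  have -> : cossum N x = sin ((N%:R + 1 / 2) * x) / (2 * sin (x / 2)) - 1 / 2.
    by rewrite -cossumE; field; rewrite gt_eqF.
  by rewrite /M in M0 Msx *; field; rewrite !gt_eqF.
pose i x := (M * sin (x / 2))^-1.
pose i' x := - (cos (x / 2) / (2 * M * sin (x / 2) ^+ 2)).
have di x : t <= x -> x <= pi -> has_der i x (i' x).
  move=> tx xpi; have sx := s0 x tx xpi.
  have Msx : M * sin (x / 2) != 0 by rewrite mulf_neq0 ?gt_eqF.
  apply: der_eq; first by apply: derV; [exact: Msx|der].
  by rewrite /i'; field; rewrite !gt_eqF.
have gpi : g pi = 0.
  rewrite /g sinsum_pi subrr mul0r subr0 add0r mulrDl mul1r mulrC [2^-1 * _]mulrC.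
  by rewrite cosDpihalf sin_natpi oppr0 mulr0.
have ipi : 0 <= i pi.
  by rewrite /i invr_ge0 mulr_ge0 ?(ltW M0)// sin_pihalf.
(* The signs [e = 1] and [e = - 1] yield the two halves of [|g t| <= i t]. *)
have mono (e : R) : `|e| = 1 -> 0 <= i t + e * g t.
  move=> e1; have e1' : -1 <= e <= 1 by rewrite -ler_norml e1.
  have dh x : t <= x -> x <= pi -> has_der (fun y => i y + e * g y) x (i' x + e * g' x).
    move=> tx xpi; apply: der_eq.
      by apply: derD; [exact: di|apply: derM; [exact: derC|exact: dg]].
    by rewrite mul0r add0r.
  have := @ler0_derive1_le_cc R (fun y => i y + e * g y) t pi.
  have H1 x : x \in `]t, pi[ -> derivable (fun y => i y + e * g y) x 1.
    rewrite in_itv/= => /andP[/ltW tx /ltW xpi].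
    exact: (@ex_derive _ _ _ _ _ _ _ (dh x tx xpi)).
  have H2 x : x \in `]t, pi[ -> (fun y => i y + e * g y)^`()%classic x <= 0.
    rewrite in_itv/= => /andP[/ltW tx /ltW xpi].
    rewrite derive1E (@derive_val _ _ _ _ _ _ _ (dh x tx xpi)) /i' /g'.
    have sx := s0 x tx xpi.
    set c := cos (_ * x); set d := (2 * M * sin (x / 2) ^+ 2)^-1.
    have d0 : 0 <= d by rewrite invr_ge0 mulr_ge0 ?sqr_ge0// mulr_ge0// ltW.
    have cx : 0 <= cos (x / 2).
      by apply: cos_ge0_pihalf; have := @pi_gt0 R; lra.
    have ec : 0 <= 1 + e * c.
      suff : `|e * c| <= 1 by rewrite ler_norml => /andP[]; lra.
      by rewrite normrM e1 mul1r cos_max.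
    have -> : - (cos (x / 2) * d) + e * - (c * cos (x / 2) * d) =
      - (cos (x / 2) * d * (1 + e * c)) by ring.
    by rewrite oppr_le0 !mulr_ge0.
  have H3 : {within `[t, pi], continuous (fun y => i y + e * g y)}.
    apply: continuous_in_subspaceT => x; rewrite inE/= in_itv/= => /andP[tx xpi].
    exact: has_der_continuous (dh x tx xpi).
  move=> /(_ H1 H2 H3 pi t); rewrite !in_itv/= !lexx tpi => /(_ erefl erefl erefl).
  by rewrite gpi mulr0 addr0 => /(le_trans ipi).
have gt_le : `|g t| <= i t.
  have := mono 1; have := mono (- 1); rewrite normrN normr1 => /(_ erefl) h1 /(_ erefl) h2.
  by rewrite ler_norml; lra.
have -> : sinsum N t - (pi - t) / 2 = g t - cos ((N%:R + 1 / 2) * t) * i t.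
  by rewrite /g addrK.
have i0 : 0 <= i t by exact: le_trans gt_le.
have -> : 2 / (M * sin (t / 2)) = i t + i t by rewrite /i; ring.
rewrite (le_trans (ler_normB _ _))// normrM (ger0_norm i0) lerD//.
by rewrite -[leRHS]mul1r ler_wpM2r// cos_max.
Qed.

(** If [M sin (t / 2) >= 1], the distance to the sawtooth is at most 2 and the sawtooth is below
    [pi / 2 < 2]. Otherwise each term is at most [2 sin (t / 2)], so the [N] terms together stay
    below [M sin (t / 2) < 1]. *)
Lemma sinsum_bounded_pi N t : 0 <= t -> t <= pi -> `|sinsum N t| <= 4.
Proof.
rewrite le_eqVlt => /predU1P[<- _|t0 tpi]; first by rewrite sinsum0 normr0.
have s0 := sin_half_gt0 t0 tpi; set M := 2 * N%:R + 1 : R.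
have M0 : 0 < M by rewrite ltr_wpDl// mulr_ge0.
have [h|h] := leP 1 (M * sin (t / 2)).
  have := sinsum_dist N t0 tpi; rewrite -/M => d.
  have d2 : 2 / (M * sin (t / 2)) <= 2 by rewrite ler_pdivrMr ?mulr_gt0//; lra.
  have := @pihalf_lt2 R; move: (le_trans d d2); rewrite !ler_norml.
  by move=> /andP[]; lra.
apply: (@le_trans _ _ (\sum_(1 <= m < N.+1) 2 * sin (t / 2))).
  rewrite (le_trans (ler_norm_sum _ _ _))//; apply: ler_sum_nat => m /andP[m0 _].
  rewrite normrM normfV (ger0_norm (ler0n _ m)) ler_pdivrMr ?ltr0n//.
  have -> : m%:R * t = (2 * m)%:R * (t / 2) by rewrite natrM; field.
  rewrite (le_trans (norm_sin_natM _ _))// (gtr0_norm s0) natrM.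
  by rewrite le_eqVlt; apply/orP; left; apply/eqP; ring.
rewrite sumr_const_nat subSS subn0 -[_ *+ N]mulr_natl.
suff : N%:R * (2 * sin (t / 2)) <= M * sin (t / 2) by lra.
by rewrite mulrA ler_wpM2r ?(ltW s0)// /M; lra.
Qed.

Lemma sinsum_reflect N t : sinsum N t = - sinsum N (2 * pi - t).
Proof.
by rewrite -sinsumN opprB -[in RHS](sinsumD2pi N 1) mulr1 subrK.
Qed.

Lemma sinsum_bounded N t : 0 <= t -> `|sinsum N t| <= 4.
Proof.
move=> t0; have pi0 := @pi_gt0 R; pose n := Num.truncn (t / (2 * pi)).
have /andP[n1 n2] : n%:R <= t / (2 * pi) < n.+1%:R.
  by apply: truncn_itv; rewrite divr_ge0// mulr_ge0// ltW.
rewrite ler_pdivlMr ?mulr_gt0// in n1; rewrite ltr_pdivrMr ?mulr_gt0// -natr1 in n2.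
rewrite -(subrK (2 * pi * n%:R) t) sinsumD2pi; set u := t - _.
have u0 : 0 <= u by rewrite /u; lra.
have [upi|upi] := leP u pi; first exact: sinsum_bounded_pi.
by rewrite sinsum_reflect normrN sinsum_bounded_pi//; rewrite /u in upi *; lra.
Qed.

Lemma cvg_sinsum_pi t : 0 < t -> t <= pi ->
  sinsum N t @[N --> \oo] --> (pi - t) / 2.
Proof.
move=> t0 tpi; have s0 := sin_half_gt0 t0 tpi.
have h : 2 / ((2 * N%:R + 1) * sin (t / 2)) @[N --> \oo] --> (0 : R).
  have hN : (2 / sin (t / 2)) * (N.+1%:R)^-1 @[N --> \oo] --> (0 : R).
    rewrite -[X in _ --> X](mulr0 (2 / sin (t / 2))).
    by apply: cvgM; [exact: cvg_cst|exact: cvg_harmonic].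
  apply: (squeeze_cvgr _ (cvg_cst 0) hN); near=> N; apply/andP; split.
    by rewrite divr_ge0// mulr_ge0 ?(ltW s0)// addr_ge0 ?mulr_ge0.
  rewrite invfM [(_ + 1)^-1 * _]mulrC mulrA ler_wpM2l//.
    by rewrite divr_ge0// ltW.
  rewrite lef_pV2 ?posrE ?ltr0n// -?natr1 ?ltr_wpDl ?mulr_ge0//.
  by have := ler0n R N; lra.
apply/cvgrPdist_le => e e0; near=> N.
rewrite distrC (le_trans (sinsum_dist N t0 tpi))//.
have h2 : `|0 - 2 / ((2 * N%:R + 1) * sin (t / 2))| <= e.
  by near: N; move/cvgrPdist_le: h; exact.
by rewrite (le_trans _ h2)// sub0r normrN ler_norm.
Unshelve. all: by end_near. Qed.

Lemma cvg_sinsum n t : 2 * pi * n%:R < t -> t < 2 * pi * n.+1%:R ->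
  sinsum N t @[N --> \oo] --> (pi + 2 * pi * n%:R - t) / 2.
Proof.
move=> h1 h2; have pi0 := @pi_gt0 R.
rewrite -natr1 in h2; set u := t - 2 * pi * n%:R.
have -> : (pi + 2 * pi * n%:R - t) / 2 = (pi - u) / 2 by rewrite /u; field.
have E N : sinsum N t = sinsum N u by rewrite -(sinsumD2pi N n u) /u subrK.
under eq_fun do rewrite E.
have u0 : 0 < u by rewrite /u; lra.
have [upi|upi] := leP u pi; first exact: cvg_sinsum_pi.
have -> : (pi - u) / 2 = - ((pi - (2 * pi - u)) / 2) by field.
under eq_fun do rewrite sinsum_reflect.
by apply: cvgN; apply: cvg_sinsum_pi; rewrite /u in upi *; lra.
Qed.

(** At multiples of [2 pi] every partial sum vanishes; elsewhere the sawtooth formula applies. *)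
Lemma is_cvg_sinsum t : 0 <= t -> cvg (sinsum N t @[N --> \oo]).
Proof.
move=> t0; have pi0 := @pi_gt0 R; pose n := Num.truncn (t / (2 * pi)).
have /andP[n1 n2] : n%:R <= t / (2 * pi) < n.+1%:R.
  by apply: truncn_itv; rewrite divr_ge0// mulr_ge0// ltW.
rewrite ler_pdivlMr ?mulr_gt0// mulrC in n1; rewrite ltr_pdivrMr ?mulr_gt0// mulrC in n2.
move: n1; rewrite le_eqVlt => /predU1P[<-|n1].
  apply/cvg_ex; exists 0; under eq_fun do rewrite -[X in sinsum _ X]add0r sinsumD2pi sinsum0.
  exact: cvg_cst.
by apply/cvg_ex; eexists; exact: (cvg_sinsum n1 n2).
Qed.
End sine_sums.

(** * The phase function, its Jacobian and the Gaussian profile *)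

Section phase.
Variables (R : realType) (q : R).
Hypothesis q0 : 0 < q.
Notation mu := (@lebesgue_measure R).
Notation D := (`[0, +oo[%classic : set R).

Definition phase (a : R) : R := a + 2 * atan (a / q).
(** The reciprocal of the derivative of [phase]. It increases on the half-line from [q / (q + 2)]
    towards 1. *)
Definition slowness (a : R) : R := (q ^+ 2 + a ^+ 2) / (q ^+ 2 + 2 * q + a ^+ 2).
Definition slowness' (a : R) : R := 4 * q * a / (q ^+ 2 + 2 * q + a ^+ 2) ^+ 2.

Let den_gt0 (a : R) : 0 < q ^+ 2 + 2 * q + a ^+ 2.
Proof. by rewrite ltr_wpDr ?sqr_ge0// addr_gt0 ?mulr_gt0 ?exprn_gt0. Qed.

Let num_gt0 (a : R) : 0 < q ^+ 2 + a ^+ 2.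
Proof. by rewrite ltr_wpDr ?sqr_ge0// exprn_gt0. Qed.

Lemma der_phase a : has_der phase a (slowness a)^-1.
Proof.
rewrite /phase; apply: der_eq; first by der.
rewrite /slowness invf_div; field.
by rewrite !gt_eqF ?num_gt0 ?q0// addrC num_gt0.
Qed.

Lemma slowness_gt0 a : 0 < slowness a.
Proof. by rewrite divr_gt0 ?num_gt0 ?den_gt0. Qed.

Lemma slowness_le1 a : slowness a <= 1.
Proof. by rewrite ler_pdivrMr ?den_gt0// mul1r; have := q0; lra. Qed.

Lemma der_slowness a : has_der slowness a (slowness' a).
Proof.
rewrite /slowness; apply: der_eq.
  by apply: derM; [der|apply: derV; [exact: lt0r_neq0 (den_gt0 a)|der]].
by rewrite /slowness'; field; rewrite gt_eqF ?den_gt0.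
Qed.

Lemma slowness'_ge0 a : 0 <= a -> 0 <= slowness' a.
Proof. by move=> a0; rewrite divr_ge0 ?sqr_ge0// !mulr_ge0// ltW. Qed.

Lemma continuous_phase : continuous phase.
Proof. by move=> a; exact: has_der_continuous (der_phase a). Qed.

Lemma phase_homo : {homo phase : a b / a < b}.
Proof.
by move=> a b ab; rewrite ltrD// ltr_pM2l// lt_atan// ltr_pM2r// invr_gt0.
Qed.

Lemma phase0 : phase 0 = 0.
Proof. by rewrite /phase mul0r atan0 mulr0 addr0. Qed.

Lemma phase_ge0 a : 0 <= a -> 0 <= phase a.
Proof.
by rewrite le_eqVlt => /predU1P[<-|/phase_homo/ltW]; rewrite phase0.
Qed.

Lemma phase_le a : phase a <= a + pi.
Proof. by rewrite lerD2l; have := @atan_ltpi2 R (a / q); lra. Qed.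

Section one_scale.
Variable tau : R.
Hypothesis tau0 : 0 < tau.

(** The function that is differentiated in the integration by parts: [cos (m phase) da] is
    [slowness] times the differential of [sin (m phase) / m], so the Gaussian acquires the factor
    [slowness]. *)
Definition profile (a : R) : R := expR (- tau * a ^+ 2) * slowness a.
Definition profile' (a : R) : R :=
  expR (- tau * a ^+ 2) * (slowness' a - 2 * tau * a * slowness a).

Lemma der_profile a : has_der profile a (profile' a).
Proof.
rewrite /profile; have ds := der_slowness a.
apply: der_eq; first by apply: derM; [der|exact: ds].
by rewrite /profile'; move: (slowness a) (slowness' a) => r r'; ring.
Qed.

Lemma ex_der_slowness' a : exists v, has_der slowness' a v.
Proof.
eexists; rewrite /slowness'; apply: derM; first by der.
by apply: derV; [rewrite sqrf_eq0 gt_eqF ?den_gt0|der].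
Qed.

Lemma continuous_profile' : continuous profile'.
Proof.
move=> a; have [v dv] := ex_der_slowness' a; have ds := der_slowness a.
apply: has_der_continuous; rewrite /profile'; apply: derM; first by der.
by apply: derB; [exact: dv|apply: derM; [der|exact: ds]].
Qed.

(** Completing the square in [|a| - 1 / (2 tau)]. *)
Lemma gauss_bound a : expR (- tau * a ^+ 2) <= expR ((4 * tau)^-1) * expR (- 1 * `|a|).
Proof.
rewrite -expRD ler_expR -[a ^+ 2]real_normK ?num_real//; set b := `|a|.
rewrite -subr_ge0.
have -> : (4 * tau)^-1 + -1 * b - - tau * b ^+ 2 = tau * (b - (2 * tau)^-1) ^+ 2.
  by field; rewrite gt_eqF.
by rewrite mulr_ge0 ?sqr_ge0 ?ltW.
Qed.

Lemma integrable_gauss : mu.-integrable setT (fun a => (expR (- tau * a ^+ 2))%:E).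
Proof.
apply: (@integrable_expN_bound R _ (expR ((4 * tau)^-1)) 1) => //.
  by move=> a; apply: has_der_continuous; der.
by move=> a; rewrite ger0_norm ?expR_ge0// gauss_bound.
Qed.

Lemma Rintegral_gauss : \int[mu]_(a in D) expR (- tau * a ^+ 2) =
  Num.sqrt pi / (2 * Num.sqrt tau).
Proof.
have st0 : 0 < Num.sqrt tau by rewrite sqrtr_gt0.
have dF (x : R) : is_derive x 1 (fun t => Num.sqrt tau * t) (Num.sqrt tau).
  by apply: (der_eq (derM (derC (Num.sqrt tau) x) (derI x))); rewrite mul0r add0r mulr1.
have rT : range (fun t : R => Num.sqrt tau * t) = setT.
  apply/seteqP; split=> // y _; exists (y / Num.sqrt tau) => //.
  by rewrite mulrC divfK// gt_eqF.
have ce : continuous (fun a : R => expR (- tau * a ^+ 2)).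
  by move=> a; apply: has_der_continuous; der.
have h1 : (\int[mu]_a (expR (- tau * a ^+ 2))%:E * (Num.sqrt tau)%:E = (Num.sqrt pi)%:E)%E.
  rewrite -(@integralZr _ _ _ _ _ _ _ integrable_gauss)// -integralT_gauss -[in RHS]rT.
  rewrite (integral_subst dF).
  - by apply: eq_integral => x _; rewrite /gauss_fun exprMn sqr_sqrtr ?(ltW tau0)// mulNr.
  - by move=> x; exact: cvg_cst.
  - by [].
  - by move=> x; exact: continuous_gauss_fun.
move: h1; rewrite ge0_symfun_integralT//; last by move=> x /=; rewrite sqrrN.
rewrite -set_itvcy.
have iD : mu.-integrable `[0%R, +oo[ (fun a => (expR (- tau * a ^+ 2))%:E).
  exact: integrableS integrable_gauss.
rewrite -(fineK (integrable_fin_num _ iD))// -!EFinM => -[].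
rewrite /Rintegral => <-; field; rewrite gt_eqF//.
Qed.

Lemma cvg_gauss_profile (b : R^nat) : b n @[n --> \oo] --> +oo ->
  expR (- tau * b n ^+ 2) @[n --> \oo] --> 0.
Proof.
move=> by_; have h : expR (- b n) @[n --> \oo] --> 0.
  exact: (cvg_comp _ _ by_ (@cvgr_expR R)).
have h' : expR ((4 * tau)^-1) * expR (- b n) @[n --> \oo] --> 0.
  rewrite -[X in _ --> X](mulr0 (expR ((4 * tau)^-1))).
  by apply: cvgM; [exact: cvg_cst|].
apply: (squeeze_cvgr _ (cvg_cst 0) h'); near=> n; rewrite expR_ge0/=.
rewrite (le_trans (gauss_bound _))// ler_wpM2l ?expR_ge0// ler_expR mulN1r lerN2.
exact: ler_norm.
Unshelve. all: by end_near. Qed.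

Definition majorant (a : R) : R := 2 * tau * a * expR (- tau * a ^+ 2) + slowness' a.

Lemma norm_profile' a : 0 <= a -> `|profile' a| <= majorant a.
Proof.
move=> a0; rewrite /profile' mulrBr (le_trans (ler_normB _ _))// addrC lerD//.
  have -> : expR (- tau * a ^+ 2) * (2 * tau * a * slowness a) =
    2 * tau * a * expR (- tau * a ^+ 2) * slowness a by ring.
  have p0 : 0 <= 2 * tau * a * expR (- tau * a ^+ 2).
    by rewrite !mulr_ge0 ?expR_ge0// ltW.
  rewrite normrM (ger0_norm p0) (gtr0_norm (slowness_gt0 a)).
  by rewrite -[leRHS]mulr1 ler_wpM2l// slowness_le1.
rewrite normrM (ger0_norm (expR_ge0 _)) (ger0_norm (slowness'_ge0 a0)).
rewrite -[leRHS]mul1r ler_wpM2r ?slowness'_ge0// -[leRHS]expR0 ler_expR.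
by rewrite mulNr oppr_le0 mulr_ge0 ?sqr_ge0 ?ltW.
Qed.

(** [majorant] is the derivative of [slowness a - exp (- tau a^2)], which rises on the half-line
    from [slowness q 0 - 1] to 1. The total rise is at most 2 whatever [tau] is, and this makes all
    later bounds uniform. *)
Lemma integral_majorant : mu.-integrable D (fun a => (majorant a)%:E) /\
  \int[mu]_(a in D) majorant a <= 2.
Proof.
pose F a := - expR (- tau * a ^+ 2) + slowness a.
have dF (a : R) : has_der F a (majorant a).
  have ds := der_slowness a.
  apply: der_eq; first by apply: derD; [apply: derN; der|exact: ds].
  by rewrite /majorant; move: (slowness' a) => r'; ring.
have F1 : F x @[x --> +oo] --> (1 : R).
  have c1 : expR ((4 * tau)^-1) * expR (- x) @[x --> +oo] --> (0 : R).
    rewrite -[X in _ --> X](mulr0 (expR ((4 * tau)^-1))).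
    by apply: cvgM; [exact: cvg_cst|exact: cvgr_expR].
  have c2 : - expR (- tau * x ^+ 2) @[x --> +oo] --> (0 : R).
    rewrite -oppr0; apply: cvgN.
    apply: (squeeze_cvgr _ (cvg_cst 0) c1); near=> x; rewrite expR_ge0/=.
    rewrite (le_trans (gauss_bound _))// ler_wpM2l ?expR_ge0// ler_expR mulN1r lerN2.
    exact: ler_norm.
  have c3 : slowness x @[x --> +oo] --> (1 : R).
    (* The complement to 1 of [slowness x] is [2 q / (q^2 + 2 q + x^2)], whose denominator exceeds
       [x] once [x >= 1]. *)
    have c4 : 1 - 2 * q * x^-1 @[x --> +oo] --> (1 : R).
      rewrite -[X in _ --> X]subr0; apply: cvgB; first exact: cvg_cst.
      rewrite -[X in _ --> X](mulr0 (2 * q)); apply: cvgM; first exact: cvg_cst.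
      by apply/gtr0_cvgV0; [exact: nbhs_pinfty_gt|exact: cvg_id].
    apply: (@squeeze_cvgr _ _ _ R (fun x => 1 - 2 * q * x^-1) (fun=> 1) slowness
      _ _ c4 (@cvg_cst _ _ _ _ _)); near=> x; rewrite slowness_le1 andbT.
    have x1 : 1 <= x by near: x; exact: nbhs_pinfty_ge.
    have x0 : 0 < x by lra.
    rewrite -subr_ge0.
    have -> : slowness x - (1 - 2 * q / x) =
        2 * q * (q ^+ 2 + 2 * q + x ^+ 2 - x) / (x * (q ^+ 2 + 2 * q + x ^+ 2)).
      by rewrite /slowness; field; rewrite !gt_eqF ?den_gt0.
    rewrite divr_ge0//; last by rewrite mulr_ge0 ?(ltW x0)// ltW// den_gt0.
    rewrite mulr_ge0//; first by rewrite mulr_ge0// ltW.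
    have := sqr_ge0 q; have : x <= x ^+ 2 by rewrite expr2 ler_peMr// ltW.
    by have := q0; lra.
  by rewrite -[X in _ --> X]add0r; apply: cvgD.
have maj0 a : 0 <= a -> 0 <= majorant a.
  by move=> a0; rewrite addr_ge0 ?slowness'_ge0// !mulr_ge0 ?expR_ge0// ltW.
have cm : continuous majorant.
  move=> a; have [v dv] := ex_der_slowness' a; apply: has_der_continuous.
  by rewrite /majorant; apply: derD; [der|exact: dv].
have E : (\int[mu]_(a in D) (majorant a)%:E = 1%:E - (F 0)%:E)%E.
  apply: (@ge0_continuous_FTC2y R majorant F 0 1 maj0 _ F1).
  - exact: continuous_subspaceT.
  - by move=> x _; exact: (@ex_derive _ _ _ _ _ _ _ (dF x)).
  - by apply: cvg_at_right_filter; exact: has_der_continuous (dF 0).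
  - by move=> x _; rewrite derive1E; exact: (@derive_val _ _ _ _ _ _ _ (dF x)).
split.
  apply/integrableP; split.
    by apply/measurable_EFinP; apply: measurable_funTS; exact: continuous_measurable_fun.
  rewrite (_ : (\int[mu]_(x in _) _)%E = (\int[mu]_(a in D) (majorant a)%:E)%E).
    by rewrite E ltry.
  apply: eq_integral => x; rewrite inE/= in_itv/= andbT => x0.
  by rewrite /= ger0_norm// maj0.
rewrite /Rintegral E/= /F expr0n/= mulr0 expR0.
by have := slowness_gt0 0; lra.
Unshelve. all: by end_near. Qed.
End one_scale.
End phase.

(** * Poisson summation at a fixed Gaussian scale *)

Section poisson.
Variables (R : realType) (q : R).
Hypothesis q0 : 0 < q.
Notation mu := (@lebesgue_measure R).
Notation D := (`[0, +oo[%classic : set R).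
Variable nu : nat -> R.
Hypothesis nu0 : nu 0 = 0.
Hypothesis phase_nu : forall n, phase q (nu n) = 2 * pi * n%:R.

(** Kept as a limit, so that dominated convergence applies to it at once; its affine form is used
    only in the open intervals between nodes. *)
Let saw (t : R) : R := lim (sinsum N t @[N --> \oo]).

Lemma nu_lt n : nu n < nu n.+1.
Proof.
have := phase_nu n; have := phase_nu n.+1; rewrite -[n.+1%:R]natr1 => h1 h2.
rewrite ltNge le_eqVlt; apply/negP => /orP[/eqP e|/(phase_homo q0)].
  by rewrite e h2 in h1; have := @pi_gt0 R; lra.
by rewrite h1 h2; have := @pi_gt0 R; lra.
Qed.

Lemma nu_ge0 n : 0 <= nu n.
Proof. by elim: n => [|n ih]; rewrite ?nu0// (le_trans ih)// ltW// nu_lt. Qed.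

Lemma nu_homo : nondecreasing_seq nu.
Proof. by apply/nondecreasing_seqP => n; rewrite ltW// nu_lt. Qed.

(** [phase] exceeds the identity by at most [pi], so the nodes grow at least like their phases
    [2 pi n], up to a constant. *)
Lemma cvg_nu : nu n @[n --> \oo] --> +oo.
Proof.
have h n : n%:R <= nu n + pi.
  apply: (le_trans _ (phase_le q (nu n))); rewrite phase_nu.
  rewrite -[leLHS]mul1r ler_wpM2r//; have := @pi_ge2 R; lra.
apply/cvgryPge => A; near=> n; have := h n.
have : A + pi <= n%:R by near: n; exact: nbhs_infty_ger.
by lra.
Unshelve. all: by end_near. Qed.

Section one_scale.
Variable tau : R.
Hypothesis tau0 : 0 < tau.
Let k := profile q tau.
Let k' := profile' q tau.
Let gauss a : R := expR (- tau * a ^+ 2).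

Let mD : measurable D. Proof. exact: measurable_itv. Qed.

Let cgauss : continuous gauss.
Proof. by move=> a; apply: has_der_continuous; rewrite /gauss; der. Qed.

Let igauss : mu.-integrable D (fun a => (gauss a)%:E).
Proof. exact: integrableS (integrable_gauss tau0). Qed.

Let cS N : continuous (fun a => sinsum N (phase q a)).
Proof.
move=> a; apply: (@continuous_comp _ _ _ (phase q) (sinsum N)).
  exact: continuous_phase.
exact: has_der_continuous (der_sinsum N (phase q a)).
Qed.

Let cC m : continuous (fun a => cos (m%:R * phase q a)).
Proof.
move=> a; have d := der_phase q0 a; apply: has_der_continuous.
by apply: der_cos; apply: derM; [exact: derC|exact: d].
Qed.

Let iC m : mu.-integrable D (fun a => (cos (m%:R * phase q a) * gauss a)%:E).
Proof.
apply: le_integrable igauss => //.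
  apply/measurable_EFinP; apply: measurable_funTS; apply: continuous_measurable_fun.
  by move=> a; apply: continuousM; [exact: cC|exact: cgauss].
move=> a _ /=; rewrite lee_fin normrM -[leRHS]mul1r ler_wpM2r// cos_max//.
Qed.

Let iM4 : mu.-integrable D (fun a => (4 * majorant q tau a)%:E).
Proof. by apply: integrable_EFinZ => //; exact: (integral_majorant q0 tau0).1. Qed.

Let iS N : mu.-integrable D (fun a => (k' a * sinsum N (phase q a))%:E).
Proof.
apply: le_integrable iM4 => //.
  apply/measurable_EFinP; apply: measurable_funTS; apply: continuous_measurable_fun.
  by move=> a; apply: continuousM; [exact: continuous_profile'|exact: cS].
move=> a; rewrite /= in_itv/= andbT => a0; rewrite lee_fin.
have h1 := norm_profile' q0 tau0 a0; have h2 := sinsum_bounded N (phase_ge0 q0 a0).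
rewrite normrM mulrC; apply: (le_trans (ler_pM _ _ h2 h1)) => //.
by rewrite ler_norm.
Qed.

Definition osc m : R := \int[mu]_(a in D) (cos (m%:R * phase q a) * gauss a).

Lemma bigcup_itv0n : \bigcup_n `[(0 : R), n%:R]%classic = D.
Proof.
apply/seteqP; split=> [x [n _] /=|x /=]; rewrite !in_itv/= ?andbT.
  by move=> /andP[].
move=> x0; exists (Num.truncn x).+1 => //=.
by rewrite in_itv/= x0 ltW// truncnS_gt.
Qed.

(** Integration by parts: the boundary term at 0 vanishes with [sinsum N 0], the one at infinity
    with the Gaussian, since the sine sums are bounded. *)
Lemma osc_sum N : \sum_(1 <= m < N.+1) osc m =
  - \int[mu]_(a in D) (k' a * sinsum N (phase q a)).
Proof.
have ccos : continuous (fun a => cossum N (phase q a)).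
  rewrite /cossum; elim: N => [|N ih].
    rewrite (_ : (fun a => _) = fun=> 0); first by move=> a; exact: cvg_cst.
    by apply/funext => b; rewrite big_geq.
  rewrite (_ : (fun a => _) = fun a => \sum_(1 <= m < N.+1) cos (m%:R * phase q a)
    + cos (N.+1%:R * phase q a)).
    by move=> a; apply: cvgD; [exact: ih|exact: cC].
  by apply/funext => b; rewrite big_nat_recr.
(* The factor [1 / slowness] produced by the chain rule cancels the [slowness] inside [k], which
   leaves the bare Gaussian in front of [cossum]. *)
pose F a := k a * sinsum N (phase q a).
pose f a := k' a * sinsum N (phase q a) + gauss a * cossum N (phase q a).
have dF (a : R) : is_derive a 1 F (f a).
  have d1 := der_profile q0 tau a; have d2 := der_phase q0 a.
  have d3 : has_der (fun a => sinsum N (phase q a)) a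
      (cossum N (phase q a) * (slowness q a)^-1).
    exact: (is_derive1_comp (der_sinsum N (phase q a)) d2).
  apply: (der_eq (derM d1 d3)); rewrite /f; congr (_ + _).
  have : slowness q a != 0 by rewrite gt_eqF// slowness_gt0.
  rewrite /profile -/(gauss a); move: (slowness q a) => r r0.
  by field.
have cf : continuous f.
  move=> a; rewrite /f; apply: cvgD.
    by apply: cvgM; [exact: continuous_profile'|exact: cS].
  apply: cvgM; first exact: cgauss.
  exact: ccos.
have GE (a : R) : gauss a * cossum N (phase q a) =
    \sum_(1 <= m < N.+1) (cos (m%:R * phase q a) * gauss a).
  by rewrite /cossum mulr_sumr; apply: eq_bigr => m _; rewrite mulrC.
have iG : mu.-integrable D (fun a => (gauss a * cossum N (phase q a))%:E).
  rewrite (_ : (fun a => _) = (fun a =>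
    (\sum_(1 <= m < N.+1) (cos (m%:R * phase q a) * gauss a))%:E)).
    exact: integrable_EFin_sum.
  by apply/funext => a; rewrite GE.
have If : mu.-integrable D (fun a => (f a)%:E) by exact: integrable_EFinD.
have E0 : \int[mu]_(a in D) f a = 0.
  have h : \int[mu]_(a in `[0, n%:R]) f a @[n --> \oo] --> \int[mu]_(a in D) f a.
    rewrite -bigcup_itv0n; apply: cvg_Rintegral_exhaust.
    - apply: (@nondecreasing_itv R (fun=> 0) (fun n => n%:R)) => // m n mn.
      by rewrite ler_nat.
    - by move=> n; exact: measurable_itv.
    - by rewrite bigcup_itv0n.
  have h' : \int[mu]_(a in `[0, n%:R]) f a @[n --> \oo] --> 0.
    have E n : \int[mu]_(a in `[0, n%:R]) f a = F n%:R.
      by rewrite (Rintegral_derive _ dF cf)// {2}/F phase0 sinsum0 mulr0 subr0.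
    under eq_fun do rewrite E.
    have e4 : 4 * gauss n%:R @[n --> \oo] --> (0 : R).
      rewrite -[X in _ --> X](mulr0 4); apply: cvgM; first exact: cvg_cst.
      exact: (cvg_gauss_profile tau0 (@cvgr_idn R)).
    have eN : - (4 * gauss n%:R) @[n --> \oo] --> (0 : R) by rewrite -oppr0; exact: cvgN.
    apply: (squeeze_cvgr _ eN e4); near=> n; rewrite -ler_norml /F normrM mulrC.
    rewrite ler_pM// ?sinsum_bounded ?phase_ge0//.
    rewrite /k /profile normrM ger0_norm ?expR_ge0// -[leRHS]mulr1 ler_wpM2l ?expR_ge0//.
    by rewrite gtr0_norm ?slowness_gt0// slowness_le1.
  exact: (cvg_unique _ h h').
have EG : \int[mu]_(a in D) (gauss a * cossum N (phase q a)) =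
    \sum_(1 <= m < N.+1) osc m.
  rewrite -Rintegral_sum//.
  by apply: eq_Rintegral => a _; rewrite GE.
move: E0; rewrite /f RintegralD//; [|exact: iS].
by rewrite EG => /eqP; rewrite addrC addr_eq0 => /eqP.
Unshelve. all: by end_near. Qed.

(** The constant is 4 for the sine sums times 2 for the integral of [majorant]; it does not depend
    on [tau]. *)
Lemma norm_osc_sum N : `|\sum_(1 <= m < N.+1) osc m| <= 8.
Proof.
have [iM leM] := integral_majorant q0 tau0.
rewrite osc_sum normrN.
apply: (le_trans (le_normr_Rintegral _ (iS N))) => //.
apply: (@le_trans _ _ (\int[mu]_(a in D) (4 * majorant q tau a))).
  apply: le_Rintegral => //.
  - exact: (integrable_norm (iS N)).
  move=> a; rewrite /= in_itv/= andbT => a0.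
  have h1 := norm_profile' q0 tau0 a0; have h2 := sinsum_bounded N (phase_ge0 q0 a0).
  by rewrite normrM mulrC; exact: (le_trans (ler_pM _ _ h2 h1)).
by rewrite RintegralZl//; lra.
Qed.

Let cvg_saw a : 0 <= a -> sinsum N (phase q a) @[N --> \oo] --> saw (phase q a).
Proof. by move=> a0; exact: (is_cvg_sinsum (phase_ge0 q0 a0)). Qed.

Let DCT : mu.-integrable D (fun a => (k' a * saw (phase q a))%:E) /\
  (\int[mu]_(a in D) (k' a * sinsum N (phase q a)) @[N --> \oo] -->
   \int[mu]_(a in D) (k' a * saw (phase q a))).
Proof.
apply: (@Rdominated_cvg R D _ _ (fun a => 4 * majorant q tau a)) => //.
- move=> N; apply: measurable_funTS; apply: continuous_measurable_fun.
  by move=> a; apply: continuousM; [exact: continuous_profile'|exact: cS].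
- move=> a; rewrite /= in_itv/= andbT => a0.
  by apply: cvgM; [exact: cvg_cst|exact: cvg_saw].
- move=> N a; rewrite /= in_itv/= andbT => a0.
  have h1 := norm_profile' q0 tau0 a0; have h2 := sinsum_bounded N (phase_ge0 q0 a0).
  by rewrite normrM mulrC; exact: (le_trans (ler_pM _ _ h2 h1)).
Qed.

Let W a : R := k' a * saw (phase q a) - 1 / 2 * gauss a.

Let iW : mu.-integrable D (fun a => (W a)%:E).
Proof.
have [h _] := DCT; apply: integrable_EFinB => //.
exact: integrable_EFinZ.
Qed.

(* Between consecutive [nu n] the sawtooth is affine in the phase, which makes
   the integral a trapezoidal rule for [k]. *)
Let W_step n : \int[mu]_(a in `]nu n, nu n.+1[) W a =
  - (pi / 2) * (k (nu n) + k (nu n.+1)).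
Proof.
pose V a := k' a * ((pi + 2 * pi * n%:R - phase q a) / 2) - 1 / 2 * gauss a.
pose F a := k a * ((pi + 2 * pi * n%:R - phase q a) / 2).
have cV : continuous V.
  move=> a; have dp := der_phase q0 a; rewrite /V; apply: cvgB.
    apply: cvgM; first exact: continuous_profile'.
    have : {for a, continuous (fun a => (pi + 2 * pi * n%:R - phase q a) / 2)}.
      by apply: has_der_continuous; der.
    exact.
  by apply: cvgM; [exact: cvg_cst|exact: cgauss].
have dF (a : R) : is_derive a 1 F (V a).
  have d1 := der_profile q0 tau a; have d2 := der_phase q0 a.
  apply: der_eq; first by apply: derM; [exact: d1|der].
  have : slowness q a != 0 by rewrite gt_eqF// slowness_gt0.
  rewrite /V /k' (_ : k a = gauss a * slowness q a)//.
  by move: (slowness q a) => r r0; field.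
have iV : mu.-integrable `[nu n, nu n.+1] (fun a => (V a)%:E).
  by apply: continuous_compact_integrable; [exact: segment_compact|exact: continuous_subspaceT].
transitivity (\int[mu]_(a in `]nu n, nu n.+1[) V a).
  apply: eq_Rintegral => a; rewrite inE/= in_itv/= => /andP[h1 h2].
  rewrite /W /V; congr (_ * _ - _); apply: cvg_lim => //; apply: cvg_sinsum.
    by rewrite -phase_nu; exact: phase_homo.
  by rewrite -phase_nu; exact: phase_homo.
rewrite Rintegral_itv_bndo_bndc; last first.
  by apply: integrableS iV => //; apply: subset_itv; rewrite bnd_simp.
rewrite Rintegral_itv_obnd_cbnd; last first.
  by apply: integrableS iV => //; apply: subset_itv; rewrite bnd_simp.
rewrite (Rintegral_derive _ dF cV); last by rewrite ltW// nu_lt.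
by rewrite /F !phase_nu -natr1; field.
Qed.

(** Each inner node collects half of its weight from either side; the two end nodes keep a single
    half. *)
Let W_sum M : \int[mu]_(a in `[0, nu M]) W a =
  - (pi / 2) * k 0 - pi * (\sum_(1 <= n < M.+1) k (nu n)) + pi / 2 * k (nu M).
Proof.
elim: M => [|M ih].
  by rewrite nu0 set_itv1 Rintegral_set1 big_geq// mulr0; ring.
have iM1 : mu.-integrable `[0, nu M.+1] (fun a => (W a)%:E).
  by apply: integrableS iW => //; apply: subset_itvl; rewrite bnd_simp.
have := @Rintegral_itvB R W (BLeft 0) (BRight (nu M.+1)) (nu M) iM1.
rewrite !bnd_simp => /(_ (nu_ge0 M) (ltW (nu_lt M))) h.
have h2 : \int[mu]_(a in `]nu M, nu M.+1]) W a = - (pi / 2) * (k (nu M) + k (nu M.+1)).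
  rewrite -Rintegral_itv_bndo_bndc ?W_step//.
  by apply: integrableS iW => //; apply: subset_itv; rewrite ?bnd_simp ?nu_ge0.
have -> : \int[mu]_(a in `[0, nu M.+1]) W a =
    \int[mu]_(a in `[0, nu M]) W a + \int[mu]_(a in `]nu M, nu M.+1]) W a.
  by rewrite -h addrC subrK.
by rewrite ih h2 [in RHS]big_nat_recr//=; field.
Qed.

(** The integral of [k' saw] is reached in two ways: as minus the limit of the oscillatory sums,
    and, after half the Gaussian is subtracted, as a limit of trapezoidal sums. The convergence of
    the sum over the nodes is part of the outcome. *)
Lemma poisson_scale : exists S : R,
  (\sum_(1 <= n < M.+1) k (nu n) @[M --> \oo] --> S) /\
  (\sum_(1 <= m < N.+1) osc m @[N --> \oo] -->
   pi / 2 * k 0 + pi * S - 1 / 2 * (Num.sqrt pi / (2 * Num.sqrt tau))).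
Proof.
have [iSaw cSaw] := DCT; have pi0 := @pi_gt0 R.
set I1 := \int[mu]_(a in D) (k' a * saw (phase q a)) in cSaw.
set I0 := Num.sqrt pi / (2 * Num.sqrt tau).
have EW : \int[mu]_(a in D) W a = I1 - 1 / 2 * I0.
  rewrite RintegralB//; last exact: integrable_EFinZ.
  by rewrite RintegralZl// Rintegral_gauss.
have bD : \bigcup_n `[0, nu n]%classic = D.
  apply/seteqP; split=> [x [n _] /=|x /=]; rewrite !in_itv/= ?andbT; first by move=> /andP[].
  move=> x0; have /cvgryPge/(_ x) [n _ h] := cvg_nu.
  by exists n => //=; rewrite in_itv/= x0 h//=.
have h : \int[mu]_(a in `[0, nu n]) W a @[n --> \oo] --> I1 - 1 / 2 * I0.
  rewrite -EW -[in X in _ --> X]bD; apply: cvg_Rintegral_exhaust.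
  - by apply: (@nondecreasing_itv R (fun=> 0) nu) => //; exact: nu_homo.
  - by move=> n; exact: measurable_itv.
  - by rewrite bD.
have hk : k (nu n) @[n --> \oo] --> 0.
  apply: (@squeeze_cvgr _ _ _ R (fun=> 0) (fun n => expR (- tau * nu n ^+ 2))
    (fun n => k (nu n)) _ _ (@cvg_cst _ _ _ _ _) (cvg_gauss_profile tau0 cvg_nu)).
  near=> n; rewrite /k /profile mulr_ge0 ?expR_ge0 ?(ltW (slowness_gt0 q0 _))//=.
  by rewrite -[leRHS]mulr1 ler_wpM2l ?expR_ge0// slowness_le1.
(* The witness solves [W_sum] in the limit for the sum over the nodes; [pi / 2 * 0] is the limit of
   the last boundary term [pi / 2 * k (nu M)]. *)
exists (pi^-1 * (pi / 2 * 0 - (I1 - 1 / 2 * I0) - pi / 2 * k 0)); split.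
  have E M : \sum_(1 <= n < M.+1) k (nu n) =
      pi^-1 * (pi / 2 * k (nu M) - \int[mu]_(a in `[0, nu M]) W a - pi / 2 * k 0).
    rewrite W_sum; set S := \sum_(1 <= n < M.+1) _.
    rewrite (_ : _ - _ - _ = pi * S); last by field.
    by rewrite mulKf// gt_eqF.
  under eq_fun do rewrite E.
  apply: cvgM; first exact: cvg_cst.
  apply: cvgB; last exact: cvg_cst.
  by apply: cvgB => //; apply: cvgM; [exact: cvg_cst|].
under eq_fun do rewrite osc_sum.
have -> : pi / 2 * k 0 + pi * (pi^-1 * (pi / 2 * 0 - (I1 - 1 / 2 * I0) - pi / 2 * k 0)) -
   1 / 2 * I0 = - I1.
  by rewrite mulVKf ?gt_eqF//; field.
exact: cvgN.
Unshelve. all: by end_near. Qed.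
End one_scale.
End poisson.

Section ge0_integrals.
Variable R : realType.
Notation mu := (@lebesgue_measure R).
Variables A B : R -> R.
Hypotheses (cA : continuous A) (cB : continuous B).
Hypotheses (A0 : forall t, 0 <= A t) (B0 : forall t, 0 <= B t).

Lemma ge0_integral_EFinZ (k : R) : 0 <= k ->
  (\int[mu]_t (k * A t)%:E = k%:E * \int[mu]_t (A t)%:E)%E.
Proof.
move=> k0; under eq_integral do rewrite EFinM.
rewrite ge0_integralZl//.
- by apply/measurable_EFinP; exact: continuous_measurable_fun.
- by move=> t _; rewrite lee_fin.
Qed.

(** The common value of the two integrals may a priori be infinite, which is treated as a separate
    case. *)
Lemma ge0_integral_halves (c : R) :
  (\int[mu]_t (A t)%:E = \int[mu]_t (B t)%:E)%E ->
  (\int[mu]_t (1 / 2 * (A t + B t))%:E = c%:E)%E -> (\int[mu]_t (A t)%:E = c%:E)%E.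
Proof.
move=> AB <-.
have mA : measurable_fun setT (fun t => (A t)%:E).
  by apply/measurable_EFinP; exact: continuous_measurable_fun.
have mB : measurable_fun setT (fun t => (B t)%:E).
  by apply/measurable_EFinP; exact: continuous_measurable_fun.
under [RHS]eq_integral do rewrite EFinM EFinD.
rewrite ge0_integralZl//; last 2 first.
- exact: emeasurable_funD.
- by move=> t _; rewrite adde_ge0 ?lee_fin.
rewrite ge0_integralD//; try by move=> t _; rewrite lee_fin.
rewrite -AB; set I := (\int[mu]_t (A t)%:E)%E.
have I0 : (0 <= I)%E by apply: integral_ge0 => t _; rewrite lee_fin.
move: I0; case: I => [r| |]// _.
  by rewrite -EFinD -EFinM; congr EFin; field.
by rewrite addye// mulry gtr0_sg ?mul1e// divr_gt0.
Qed.
End ge0_integrals.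

(** * The exponential as a mixture of Gaussians *)

Section subordination.
Variable R : realType.
Notation mu := (@lebesgue_measure R).
Variables x y : R.
Hypotheses (x0 : 0 < x) (y0 : 0 < y).

(** The Cauchy-Schlomilch substitution: [x^2 exp t / 4 + y^2 exp (- t) = (w t)^2 + x y]. The
    functions [A] and [B] come from the two summands of [w'], so their average is [w'] times the
    Gaussian at [w]. *)
Let w (t : R) : R := x / 2 * expR (t / 2) - y * expR (- (t / 2)).
Let w' (t : R) : R := 1 / 2 * (x / 2 * expR (t / 2) + y * expR (- (t / 2))).
Let A (t : R) : R := y * expR (- (t / 2)) * gauss_fun (w t).
Let B (t : R) : R := x / 2 * expR (t / 2) * gauss_fun (w t).

Let dw (t : R) : is_derive t 1 w (w' t).
Proof.
apply: der_eq; first by rewrite /w; der.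
by rewrite /w'; field.
Qed.

Let w'_gt0 t : 0 < w' t.
Proof. by rewrite !mulr_gt0// addr_gt0 ?mulr_gt0 ?expR_gt0// ?invr_gt0. Qed.

Let cw : continuous w.
Proof. by move=> t; exact: has_der_continuous (dw t). Qed.

Let cw' : continuous w'.
Proof. by move=> t; apply: has_der_continuous; rewrite /w'; der. Qed.

Let range_w : range w = setT.
Proof.
apply/seteqP; split=> // c _.
(* Solving [w t = c] for [u = exp (t / 2)] gives [x u^2 - 2 c u - 2 y = 0], whose positive root is
   [(c + d) / x]. *)
pose d := Num.sqrt (c ^+ 2 + 2 * x * y).
have xy0 : 0 < 2 * x * y by rewrite !mulr_gt0.
have d2 : d ^+ 2 = c ^+ 2 + 2 * x * y by rewrite sqr_sqrtr// addr_ge0 ?sqr_ge0// ltW.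
have cd : `|c| < d by rewrite -sqrtr_sqr ltr_sqrt ?ltrDl// ltr_wpDl ?sqr_ge0.
have u0 : 0 < (c + d) / x by rewrite divr_gt0//; move: cd; rewrite ltr_norml; lra.
exists (2 * ln ((c + d) / x)) => //.
rewrite /w [2 * _ / 2]mulrAC divff// mul1r expRN lnK//.
have cd0 : c + d != 0 by move: cd; rewrite ltr_norml => /andP[h _]; rewrite gt_eqF//; lra.
rewrite invf_div; apply: (mulfI cd0); apply: (mulIf (_ : (2 : R) != 0)) => //.
transitivity ((c + d) ^+ 2 - 2 * x * y).
  by field; rewrite cd0 gt_eqF.
by rewrite sqrrD d2; ring.
Qed.

Let cA : continuous A.
Proof.
move=> t; apply: cvgM; first by have : {for t, continuous (fun t : R => y * expR (- (t / 2)))};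
  [by apply: has_der_continuous; der|exact].
exact: (continuous_comp (@cw t) (@continuous_gauss_fun R (w t))).
Qed.

Let cB : continuous B.
Proof.
move=> t; apply: cvgM; first by have : {for t, continuous (fun t : R => x / 2 * expR (t / 2))};
  [by apply: has_der_continuous; der|exact].
exact: (continuous_comp (@cw t) (@continuous_gauss_fun R (w t))).
Qed.

Let A0 t : 0 <= A t.
Proof. by rewrite !mulr_ge0 ?expR_ge0 ?gauss_fun_ge0// ltW. Qed.

Let B0 t : 0 <= B t.
Proof. by rewrite !mulr_ge0 ?expR_ge0 ?gauss_fun_ge0// ltW. Qed.

(* The involution [t |-> 2 ln (2 y / x) - t] maps [w] to [- w] and exchanges
   the two halves of [w']. *)
Let AB : (\int[mu]_t (A t)%:E = \int[mu]_t (B t)%:E)%E.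
Proof.
pose c := 2 * ln (2 * y / x).
have dF (t : R) : is_derive t 1 (fun t : R => t - c) 1.
  by apply: (der_eq (derD (derI t) (derC (- c) t))); rewrite addr0.
have rT : range (fun t : R => t - c) = setT.
  by apply/seteqP; split=> // z _; exists (z + c) => //; rewrite addrK.
have cAN : continuous (fun t => A (- t)).
  move=> t; have h : {for t, continuous (fun t : R => - t)} by exact: opp_continuous.
  exact: (continuous_comp h (@cA (- t))).
rewrite (integral_oppT cA).
have := @ge0_integral_subst R _ _ dF (fun t => @cvg_cst _ _ _ _ _)
  (fun=> ltr01) (fun t => A (- t)) (fun t => @cAN _) (fun t => A0 _).
rewrite rT => ->.
apply: eq_integral => t _; rewrite mulr1; congr EFin.
have q0 : 0 < 2 * y / x by rewrite divr_gt0// mulr_gt0.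
have e1 : y * expR (- (- (t - c) / 2)) = x / 2 * expR (t / 2).
  have -> : - (- (t - c) / 2) = t / 2 - ln (2 * y / x) by rewrite /c; field.
  by rewrite expRD expRN lnK//; field; rewrite !gt_eqF.
have e2 : x / 2 * expR (- (t - c) / 2) = y * expR (- (t / 2)).
  have -> : - (t - c) / 2 = - (t / 2) + ln (2 * y / x) by rewrite /c; field.
  by rewrite expRD lnK//; field; rewrite gt_eqF.
by rewrite /A /B /w e1 e2 /gauss_fun -opprB sqrrN.
Qed.

Lemma gauss_subordination :
  (\int[mu]_t (expR (- (t / 2)) * expR (- (x ^+ 2 / 4) * expR t) *
     expR (- y ^+ 2 * expR (- t)))%:E = (Num.sqrt pi / y * expR (- x * y))%:E)%E.
Proof.
have E : (\int[mu]_t (A t)%:E = (Num.sqrt pi)%:E)%E.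
  apply: (ge0_integral_halves cA cB A0 B0 AB).
  have := ge0_integral_subst dw cw' w'_gt0 (fun t => @continuous_gauss_fun R (w t))
    (fun t => gauss_fun_ge0 (w t)).
  rewrite range_w integralT_gauss => ->.
  by apply: eq_integral => t _; rewrite /A /B /w'; congr EFin; ring.
have -> : (\int[mu]_t (expR (- (t / 2)) * expR (- (x ^+ 2 / 4) * expR t) *
     expR (- y ^+ 2 * expR (- t)))%:E = \int[mu]_t (y^-1 * expR (- x * y) * A t)%:E)%E.
  apply: eq_integral => t _; congr EFin.
  rewrite /A /gauss_fun.
  have -> : - w t ^+ 2 = - (x ^+ 2 / 4) * expR t + - y ^+ 2 * expR (- t) + x * y.
    have e1 : expR t = expR (t / 2) ^+ 2 by rewrite expr2 -expRD -splitr.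
    have e2 : expR (- t) = expR (- (t / 2)) ^+ 2 by rewrite expr2 -expRD -opprD -splitr.
    have e3 : expR (t / 2) * expR (- (t / 2)) = 1 by rewrite -expRD subrr expR0.
    rewrite /w e1 e2; transitivity (- (x ^+ 2 / 4) * expR (t / 2) ^+ 2 +
      - y ^+ 2 * expR (- (t / 2)) ^+ 2 + x * y * (expR (t / 2) * expR (- (t / 2)))).
      by field.
    by rewrite e3 mulr1.
  rewrite [expR (_ + x * y)]expRD [expR (_ + _ * expR (- t))]expRD mulNr expRN.
  have e : expR (- x * y) * expR (x * y) = 1 by rewrite -expRD mulNr addNr expR0.
  by rewrite -[LHS]mulr1 -e mulNr; field; rewrite !gt_eqF ?expR_gt0.
rewrite (ge0_integral_EFinZ cA A0); last first.
  by rewrite mulr_ge0 ?expR_ge0// invr_ge0 ltW.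
by rewrite E -EFinM; congr EFin; ring.
Qed.
End subordination.

(** * The mixing weight and its Gamma integral *)

Section bessel_transform.
Variables (R : realType) (s : R[i]) (x : R).
Hypotheses (hs : 1 / 2 < complex.Re s) (x0 : 0 < x).
Notation mu := (@lebesgue_measure R).
Notation sigma := (complex.Re s).

Let sigma0 : 0 < sigma. Proof. by move: hs; lra. Qed.
Let x2 : 0 < x ^+ 2 / 4. Proof. by rewrite divr_gt0// exprn_gt0. Qed.

(** The density [exp (- x^2 exp t / 4) exp ((s - 1/2) t)]: the [exp (- t / 2)] of the subordination
    formula has been merged with the [exp (s t)] of a Gamma integral. [romega] is its modulus. *)
Definition omega (t : R) : R[i] := gamma_kernel (s - 1 / 2) (x ^+ 2 / 4) t.
Definition romega (t : R) : R := expR (- (x ^+ 2 / 4) * expR t) * expR ((sigma - 1 / 2) * t).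

Lemma norm_omega t : `|complex.Re (omega t)| <= romega t /\ `|complex.Im (omega t)| <= romega t.
Proof. by have := norm_gamma_kernel (s - 1 / 2) (x ^+ 2 / 4) t; rewrite Re_sub_half. Qed.

Lemma integrable_romega : mu.-integrable setT (fun t => (romega t)%:E).
Proof. by apply: integrable_gamma_kernel => //; rewrite subr_gt0. Qed.

Lemma Rintegral_gamma_scale (a b : R) : 0 < a -> 0 < b ->
  \int[mu]_t (expR (- b * expR t) * expR (a * t)) = expR (- a * ln b) * rgamma a.
Proof.
move=> a0 b0; transitivity (complex.Re (cintegral setT (gamma_kernel a%:C b))).
  by apply: eq_Rintegral => t _; rewrite Re_gamma_kernel/= mul0r cos0 mulr1.
rewrite cGamma_scale// cGamma_real (_ : - a%:C = (- a)%:C :> R[i]); last by rewrite rmorphN.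
by rewrite cpow_real -rmorphM.
Qed.

Lemma cintegrable_omega : cintegrable setT omega.
Proof. by apply: cintegrable_gamma_kernel; rewrite ?Re_sub_half ?subr_gt0. Qed.

Lemma cintegrable_weighted_omega (a : R) :
  cintegrable setT (fun t => (expR (- a ^+ 2 * expR (- t)))%:C * omega t).
Proof.
have io' := cintegrable_omega; apply: (le_cintegrable (g := romega)) => //.
- apply: cmeasurableM; last exact: cintegrable_cmeasurable.
  have ce : continuous (fun t : R => expR (- a ^+ 2 * expR (- t))).
    by move=> t; apply: has_der_continuous; der.
  by apply: cmeasurable_real; exact: continuous_measurable_fun.
- move=> t _; rewrite Re_realc normrM -[leRHS]mul1r ler_pM ?(norm_omega t).1//.
  rewrite ger0_norm ?expR_ge0// -[leRHS]expR0 ler_expR mulNr oppr_le0.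
  by rewrite mulr_ge0 ?sqr_ge0 ?expR_ge0.
- move=> t _; rewrite Im_realc normrM -[leRHS]mul1r ler_pM ?(norm_omega t).2//.
  rewrite ger0_norm ?expR_ge0// -[leRHS]expR0 ler_expR mulNr oppr_le0.
  by rewrite mulr_ge0 ?sqr_ge0 ?expR_ge0.
- exact: integrable_romega.
Qed.

Section fixed_a.
Variable a : R.

Let wgt (t : R) : R := expR (- (t / 2)) * expR (- (x ^+ 2 / 4) * expR t) * expR (- a ^+ 2 * expR (- t)).
Let f2 (z : R * R) : R[i] := (wgt z.1 * expR (- expR (- z.1) * expR z.2))%:C * cexp (s * z.2%:C).
Let g2 (z : R * R) : R := wgt z.1 * expR (- expR (- z.1) * expR z.2) * expR (sigma * z.2).

Let cwgt : continuous wgt.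
Proof. by move=> t; apply: has_der_continuous; rewrite /wgt; der. Qed.

Let m1 : measurable_fun setT (fun z : R * R => wgt z.1 * expR (- expR (- z.1) * expR z.2)).
Proof.
apply: measurable_funM.
  by apply: (measurableT_comp (continuous_measurable_fun cwgt)); exact: measurable_fst.
apply: (measurableT_comp (@measurable_expR R)); apply: measurable_funM.
  have c1 : continuous (fun t : R => - expR (- t)).
    by move=> t; apply: has_der_continuous; der.
  by apply: (measurableT_comp (continuous_measurable_fun c1)); exact: measurable_fst.
by apply: (measurableT_comp (@measurable_expR R)); exact: measurable_snd.
Qed.

Lemma wgtE t : wgt t * expR (sigma * t) = romega t * expR (- a ^+ 2 * expR (- t)).
Proof.
rewrite /wgt /romega mulrBl expRD (_ : - (1 / 2 * t) = - (t / 2)); last by field.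
by ring.
Qed.

Let inner_real t : (\int[mu]_v (g2 (t, v))%:E)%E =
  (rgamma sigma * (romega t * expR (- a ^+ 2 * expR (- t))))%:E.
Proof.
have ig := integrable_gamma_kernel sigma0 (expR_gt0 (- t)).
have E v : g2 (t, v) = wgt t * (expR (- expR (- t) * expR v) * expR (sigma * v)).
  by rewrite /g2/= mulrA.
under eq_integral do rewrite E EFinM.
rewrite integralZl// -(fineK (integrable_fin_num _ ig))// -EFinM; congr EFin.
rewrite -[fine _]/(Rintegral _ _ _) Rintegral_gamma_scale ?expR_gt0// expRK.
by rewrite mulNr mulrN opprK mulrA wgtE mulrC.
Qed.

Let fub := @cfubini R f2 g2.

(** Integrating in [v] first gives a Gamma integral with parameter [exp (- t)], that is [exp (s t)]
    times [cGamma s]. The absolute values give the same computation with the real part of [s], which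
    justifies the exchange. *)
Lemma bessel_fubini :
  cintegrable setT (fun v => cintegral setT (fun t =>
    (expR (- (t / 2)) * expR (- (x ^+ 2 / 4) * expR t) * expR (- a ^+ 2 * expR (- t)) *
     expR (- expR (- t) * expR v))%:C * cexp (s * v%:C))) /\
  cintegral setT (fun v => cintegral setT (fun t =>
    (expR (- (t / 2)) * expR (- (x ^+ 2 / 4) * expR t) * expR (- a ^+ 2 * expR (- t)) *
     expR (- expR (- t) * expR v))%:C * cexp (s * v%:C))) =
  cGamma s * cintegral setT (fun t => (expR (- a ^+ 2 * expR (- t)))%:C * omega t).
Proof.
have io : mu.-integrable setT (fun t =>
    (rgamma sigma * (romega t * expR (- a ^+ 2 * expR (- t))))%:E).
  apply: integrable_EFinZ => //; apply: le_integrable integrable_romega => //.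
    apply/measurable_EFinP; apply: continuous_measurable_fun => t.
    by apply: has_der_continuous; rewrite /romega; der.
  move=> t _ /=; rewrite lee_fin normrM -[leRHS]mulr1 ler_wpM2l//.
  rewrite ger0_norm ?expR_ge0// -[leRHS]expR0 ler_expR mulNr oppr_le0.
  by rewrite mulr_ge0 ?sqr_ge0 ?expR_ge0.
have wgt0 t : 0 <= wgt t by rewrite !mulr_ge0 ?expR_ge0.
change (cintegrable setT (fun v => cintegral setT (fun t => f2 (t, v))) /\
  cintegral setT (fun v => cintegral setT (fun t => f2 (t, v))) =
  cGamma s * cintegral setT (fun t => (expR (- a ^+ 2 * expR (- t)))%:C * omega t)).
have [| | | | |_ i2 <-] := fub.
- apply: cmeasurableM; first exact: cmeasurable_real.
  by apply: cmeasurable_cexp; exact: measurable_snd.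
- apply: measurable_funM => //; apply: (measurableT_comp (@measurable_expR R)).
  by apply: measurable_funM; [exact: measurable_cst|exact: measurable_snd].
- move=> z; rewrite (le_trans (norm_Re_cexp _ _))//.
  by rewrite Re_mulc/= mulr0 subr0 ger0_norm// mulr_ge0 ?expR_ge0.
- move=> z; rewrite (le_trans (norm_Im_cexp _ _))//.
  by rewrite Re_mulc/= mulr0 subr0 ger0_norm// mulr_ge0 ?expR_ge0.
- under eq_integral do rewrite inner_real.
  exact: integrable_lty io.
split=> //; rewrite -cintegralZ//; last exact: cintegrable_weighted_omega.
apply: eq_cintegral => t _.
transitivity (cintegral setT (fun v => (wgt t)%:C * gamma_kernel s (expR (- t)) v)).
  by apply: eq_cintegral => v _; rewrite /f2 /gamma_kernel/= rmorphM mulrA.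
rewrite cintegralZ//; last by apply: cintegrable_gamma_kernel; rewrite ?expR_gt0.
rewrite cGamma_scale ?expR_gt0// cpow_expR /omega /gamma_kernel /wgt.
rewrite -[s](subrK (1 / 2)) [in cexp _](subrK (1 / 2)).
(* The surplus [exp (t / 2)] cancels the factor [exp (- (t / 2))] in the weight. *)
have -> : cexp (- s * (- t)%:C) = cexp ((s - 1 / 2) * t%:C) * (expR (t / 2))%:C.
  rewrite -cexp_real -cexpD; congr cexp; rewrite halfC raddfN/= mulrNN mulrBl.
  by rewrite -[X in _ - X]rmorphM/= [1 / 2 * t]mulrC mul1r subrK.
rewrite subrK !rmorphM/=.
have e : (expR (- (t / 2)))%:C * (expR (t / 2))%:C = 1 :> R[i].
  by rewrite -rmorphM/= -expRD addNr expR0.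
set X1 := (expR (- (t / 2)))%:C in e *; set X2 := (expR (t / 2))%:C in e *.
by rewrite -[RHS]mul1r -e; ring.
Qed.
End fixed_a.
End bessel_transform.

(** * A parametrisation of bounded intervals by the line *)

Section logistic.
Variable R : realType.
Notation mu := (@lebesgue_measure R).

Definition logistic (t : R) : R := (1 + expR (- t))^-1.
Definition logistic' (t : R) : R := expR (- t) / (1 + expR (- t)) ^+ 2.

Let den0 (t : R) : 0 < 1 + expR (- t).
Proof. by rewrite addr_gt0 ?expR_gt0. Qed.

Lemma der_logistic t : has_der logistic t (logistic' t).
Proof.
apply: der_eq; first by apply: derV; [rewrite gt_eqF ?den0|der].
by rewrite /logistic'; field; rewrite gt_eqF ?den0.
Qed.

Lemma logistic'_gt0 t : 0 < logistic' t.
Proof. by rewrite divr_gt0 ?expR_gt0// exprn_gt0 ?den0. Qed.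

Lemma continuous_logistic' : continuous logistic'.
Proof.
move=> t; apply: has_der_continuous; rewrite /logistic'.
by apply: derM; [der|apply: derV; [rewrite expf_neq0// gt_eqF ?den0|der]].
Qed.

Lemma logistic_gt0 t : 0 < logistic t.
Proof. by rewrite invr_gt0 den0. Qed.

Lemma logistic_lt1 t : logistic t < 1.
Proof. by rewrite invf_lt1 ?den0// ltrDl expR_gt0. Qed.

Lemma range_logistic (y : R) : 0 < y -> range (fun t => y * logistic t) = `]0, y[%classic.
Proof.
move=> y0; apply/seteqP; split=> [_ [t _ <-]|a] /=; rewrite in_itv/=.
  by rewrite mulr_gt0 ?logistic_gt0//= -[ltRHS]mulr1 ltr_pM2l// logistic_lt1.
move=> /andP[a0 ay]; have q0 : 0 < (y - a) / a by rewrite divr_gt0// subr_gt0.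
exists (- ln ((y - a) / a)) => //; rewrite /logistic opprK lnK//.
rewrite (_ : 1 + (y - a) / a = y / a); last by field; rewrite gt_eqF.
by rewrite invf_div mulrC divfK// gt_eqF.
Qed.

Lemma der_scaled_logistic (y : R) t : has_der (fun t => y * logistic t) t (y * logistic' t).
Proof.
by apply: (der_eq (derM (derC y t) (der_logistic t))); rewrite mul0r add0r.
Qed.

(** The derivative of the logistic function [L] is [L (1 - L)]. As [1 - L <= 1 - L^2 <= 1] and
    [r >= - 1/2], the integrand is at most [L (1 - L)^(1/2)], which decays like [exp (- |t| / 2)] on
    both sides. With [r = Re s - 1] the condition is what [1/2 < Re s] provides. *)
Lemma integrable_beta (r : R) : - (1 / 2) <= r ->
  mu.-integrable setT (fun t => (expR (r * ln (1 - logistic t ^+ 2)) * logistic' t)%:E).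
Proof.
move=> hr; apply: (@integrable_expN_bound R _ 1 (1 / 2)) => //.
  move=> t; apply: cvgM; last exact: continuous_logistic'.
  have u0 : 0 < 1 - logistic t ^+ 2.
    by rewrite subr_gt0 expr_lt1 ?logistic_lt1// ltW// logistic_gt0.
  have dl := der_logistic t.
  have c1 : {for t, continuous (fun t => 1 - logistic t ^+ 2)}.
    by apply: has_der_continuous; der.
  have c2 := continuous_comp c1 (continuous_ln u0).
  have c3 : {for t, continuous (fun t => r * ln (1 - logistic t ^+ 2))}.
    by apply: continuousM => //; exact: cvg_cst.
  exact: (continuous_comp c3 (@continuous_expR R _)).
move=> t; have L0 := logistic_gt0 t; have L1 := logistic_lt1 t; rewrite mul1r.
have u0 : 0 < 1 - logistic t ^+ 2 by rewrite subr_gt0 expr_lt1// ltW.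
have v0 : 0 < 1 - logistic t by rewrite subr_gt0.
rewrite ger0_norm; last by rewrite mulr_ge0 ?expR_ge0// ltW// logistic'_gt0.
have lu : ln (1 - logistic t ^+ 2) <= 0.
  by rewrite ln_le0// gerBl exprn_ge0 ?ltW.
have uv : ln (1 - logistic t) <= ln (1 - logistic t ^+ 2).
  by rewrite ler_ln ?posrE// lerB// expr2 ler_piMr ?ltW.
have b1 : r * ln (1 - logistic t ^+ 2) <= - (1 / 2) * ln (1 - logistic t).
  apply: (@le_trans _ _ (- (1 / 2) * ln (1 - logistic t ^+ 2))); first exact: ler_wnM2r.
  by rewrite !mulNr lerN2 ler_wpM2l// divr_ge0.
have L'E : logistic' t = logistic t * expR (ln (1 - logistic t)).
  by rewrite lnK// /logistic /logistic'; field; rewrite gt_eqF ?den0.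
apply: (@le_trans _ _ (expR (1 / 2 * ln (1 - logistic t)) * logistic t)).
  rewrite L'E mulrCA [leRHS]mulrC ler_wpM2l ?(ltW L0)// -expRD ler_expR.
  by move: b1; lra.
have [t0|t0] := leP 0 t.
  rewrite -[leRHS]mulr1 ler_pM ?expR_ge0 ?(ltW L0) ?(ltW L1)// ler_expR.
  have : ln (1 - logistic t) <= - t; last by rewrite ger0_norm//; lra.
  rewrite -[leRHS]expRK ler_ln ?posrE ?expR_gt0//.
  rewrite (_ : 1 - logistic t = expR (- t) * logistic t); last first.
    by rewrite /logistic; field; rewrite gt_eqF ?den0.
  by rewrite -[leRHS]mulr1 ler_wpM2l ?expR_ge0// ltW.
rewrite ltr0_norm// -[leRHS]mul1r ler_pM ?expR_ge0 ?(ltW L0)//.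
  rewrite -[leRHS]expR0 ler_expR.
  have : ln (1 - logistic t) <= 0 by rewrite ln_le0// gerBl ltW.
  by lra.
apply: (@le_trans _ _ (expR t)); last by rewrite ler_expR; lra.
rewrite /logistic -[leRHS]invrK -expRN lef_pV2 ?posrE ?den0 ?expR_gt0//.
by rewrite lerDr.
Qed.
End logistic.

(** * Laplace transform of a power of [y^2 - a^2] *)

Section laplace.
Variables (R : realType) (s : R[i]) (x : R).
Hypotheses (hs : 1 / 2 < complex.Re s) (x0 : 0 < x).
Notation mu := (@lebesgue_measure R).
Notation sigma := (complex.Re s).

Lemma cintegral_Zreal (D : set R) (r : R -> R) (c : R[i]) : measurable D ->
  mu.-integrable D (fun t => (r t)%:E) ->
  cintegral D (fun t => (r t)%:C * c) = (\int[mu]_(t in D) r t)%:C * c.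
Proof.
move=> mD ir; have ic : cintegrable D (fun t => (r t)%:C).
  by split => //=; exact: integrable0.
rewrite mulrC -[(\int[mu]_(t in D) r t)%:C](_ : cintegral D (fun t => (r t)%:C) = _).
  by rewrite -cintegralZ//; apply: eq_cintegral => t _; rewrite mulrC.
by rewrite /cintegral/= /Rintegral integral0.
Qed.

(** The 2 comes from the Jacobian of [y = sqrt (a^2 + exp v)], the [sqrt pi] from the subordination
    formula. *)
Definition kappa : R[i] := cGamma s * ((2 * Num.sqrt pi)^-1)%:C.

(** Under [y = sqrt (a^2 + exp v)] the measure becomes [exp v / (2 y) dv], and this [1 / y] is the
    one in [gauss_subordination]. The Gaussian in [y] then splits into a Gaussian in [a] and a Gamma
    kernel in [v]. *)
Lemma bessel_laplace (a : R) : 0 < a ->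
  cintegrable `]a, +oo[ (fun y => (expR (- x * y))%:C * cpow (y ^+ 2 - a ^+ 2) (s - 1)) /\
  cintegral `]a, +oo[ (fun y => (expR (- x * y))%:C * cpow (y ^+ 2 - a ^+ 2) (s - 1)) =
  kappa * cintegral setT (fun t => (expR (- a ^+ 2 * expR (- t)))%:C * omega s x t).
Proof.
move=> a0; pose F v : R := Num.sqrt (a ^+ 2 + expR v).
pose g v : R := (2 * F v)^-1 * expR v.
have X0 v : 0 < a ^+ 2 + expR v by rewrite addr_gt0 ?exprn_gt0 ?expR_gt0.
have F0 v : 0 < F v by rewrite sqrtr_gt0.
have F2 v : F v ^+ 2 = a ^+ 2 + expR v by rewrite sqr_sqrtr// ltW.
have dF (v : R) : is_derive v 1 F (g v).
  have h : has_der (fun v => a ^+ 2 + expR v) v (expR v).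
    by apply: (der_eq (derD (derC (a ^+ 2) v) (der_expR (derI v)))); rewrite add0r mulr1.
  have h2 : has_der (fun v => Num.sqrt (a ^+ 2 + expR v)) v
      ((2 * Num.sqrt (a ^+ 2 + expR v))^-1 * expR v).
    exact: (@is_derive1_comp R _ (fun v => a ^+ 2 + expR v) v _ _ (is_derive1_sqrt (X0 v)) h).
  exact: h2.
have cF : continuous F by move=> v; exact: is_derive_continuous (dF v).
have cg : continuous g.
  move=> v; apply: cvgM; last exact: continuous_expR.
  apply: cvgV; first by rewrite gt_eqF ?mulr_gt0.
  by apply: cvgM; [exact: cvg_cst|exact: cF].
have g0 v : 0 < g v by rewrite mulr_gt0 ?expR_gt0// invr_gt0 mulr_gt0.
have rF : range F = `]a, +oo[%classic.
  apply/seteqP; split=> [_ [v _ <-]|y] /=; rewrite in_itv/= andbT.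
    by rewrite -[ltLHS](gtr0_norm a0) -sqrtr_sqr ltr_sqrt// ltrDl expR_gt0.
  move=> ay; have y0 : 0 < y by exact: lt_trans ay.
  have ya : 0 < y ^+ 2 - a ^+ 2 by rewrite subr_gt0 ltr_sqr ?nnegrE ?ltW.
  exists (ln (y ^+ 2 - a ^+ 2)) => //.
  by rewrite /F lnK// addrC subrK sqrtr_sqr gtr0_norm.
have cG v : ccontinuous_at
    (fun y => (expR (- x * y))%:C * cpow (y ^+ 2 - a ^+ 2) (s - 1)) (F v).
  apply: ccontinuousM.
    by apply: ccontinuous_real; apply: has_der_continuous; der.
  apply: ccontinuous_cexp.
  have c1 : {for F v, continuous (fun y : R => y ^+ 2 - a ^+ 2)}.
    by apply: has_der_continuous; der.
  apply: (continuous_comp c1); apply: continuous_ln.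
  by rewrite F2 addrC addKr expR_gt0.
have [i2 e2] := bessel_fubini hs x0 a.
have st0 : 0 < Num.sqrt pi :> R by rewrite sqrtr_gt0 pi_gt0.
suff E v : (g v)%:C * ((expR (- x * F v))%:C * cpow (F v ^+ 2 - a ^+ 2) (s - 1)) =
    ((2 * Num.sqrt pi)^-1)%:C * cintegral setT (fun t =>
    (expR (- (t / 2)) * expR (- (x ^+ 2 / 4) * expR t) * expR (- a ^+ 2 * expR (- t)) *
     expR (- expR (- t) * expR v))%:C * cexp (s * v%:C)).
  rewrite -rF (cintegrable_subst dF)// (cintegral_subst dF)//; split.
    have := cintegrableZ ((2 * Num.sqrt pi)^-1)%:C measurableT i2.
    by apply: eq_cintegrable => // v _; rewrite E.
  rewrite /kappa mulrAC -e2 mulrC -cintegralZ//.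
  by apply: eq_cintegral => v _; rewrite E.
have sub := gauss_subordination x0 (F0 v).
have isub : mu.-integrable setT (fun t => (expR (- (t / 2)) *
    expR (- (x ^+ 2 / 4) * expR t) * expR (- F v ^+ 2 * expR (- t)))%:E).
  have c : continuous (fun t : R => expR (- (t / 2)) *
    expR (- (x ^+ 2 / 4) * expR t) * expR (- F v ^+ 2 * expR (- t))).
    by move=> t; apply: has_der_continuous; der.
  apply/integrableP; split; first by apply/measurable_EFinP; exact: continuous_measurable_fun.
  under eq_integral do rewrite gee0_abs ?lee_fin ?mulr_ge0 ?expR_ge0//.
  by rewrite sub ltry.
have rsub : \int[mu]_t (expR (- (t / 2)) *
    expR (- (x ^+ 2 / 4) * expR t) * expR (- F v ^+ 2 * expR (- t))) =
    Num.sqrt pi / F v * expR (- x * F v) by rewrite /Rintegral sub.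
rewrite [in RHS](_ : cintegral _ _ = (\int[mu]_t (expR (- (t / 2)) *
    expR (- (x ^+ 2 / 4) * expR t) * expR (- F v ^+ 2 * expR (- t))))%:C *
    cexp (s * v%:C)).
  rewrite rsub mulrA -rmorphM/= F2 addrAC subrr add0r cpow_expR.
  rewrite (_ : cexp (s * v%:C) = (expR v)%:C * cexp ((s - 1) * v%:C)); last first.
    by rewrite -cexp_real -cexpD mulrBl mul1r addrC subrK.
  rewrite !mulrA -!rmorphM/=; congr (_%:C * _).
  by rewrite /g; field; rewrite !gt_eqF.
rewrite -(cintegral_Zreal (cexp (s * v%:C)) measurableT isub).
apply: eq_cintegral => t _; congr (_%:C * _).
have -> : - F v ^+ 2 * expR (- t) = - a ^+ 2 * expR (- t) + - expR (- t) * expR v.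
  by rewrite F2; ring.
by rewrite [in RHS]expRD; ring.
Qed.
End laplace.

(** * The double integral as an integral against the weight *)

Section transform.
Variables (R : realType) (s : R[i]) (x : R) (c : R -> R).
Hypotheses (hs : 1 / 2 < complex.Re s) (x0 : 0 < x).
Hypotheses (cc : continuous c) (c1 : forall a, `|c a| <= 1).
Notation mu := (@lebesgue_measure R).
Notation sigma := (complex.Re s).
Notation P := (`]0, +oo[%classic : set R).

(** The cosine depends on [y] and [u] only through [y u], so it is replaced by an arbitrary
    continuous function [c] bounded by 1. *)
Definition transform_integrand (y u : R) : R[i] :=
  cpow y (2 * s - 1) * (expR (- x * y))%:C * cpow (1 - u ^+ 2) (s - 1) * (c (y * u))%:C.

Let Re_2s1 : complex.Re (2 * s - 1) = 2 * sigma - 1.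
Proof. by case: s => a b /=; ring. Qed.

Let Re_s1 : complex.Re (s - 1) = sigma - 1.
Proof. by case: s. Qed.

Let beta (t : R) : R := expR ((sigma - 1) * ln (1 - logistic t ^+ 2)) * logistic' t.

Let ibeta : mu.-integrable setT (fun t => (beta t)%:E).
Proof. by apply: integrable_beta; move: hs; lra. Qed.

Let onesub (t : R) : 0 < 1 - logistic t ^+ 2.
Proof. by rewrite subr_gt0 expr_lt1 ?logistic_lt1// ltW// logistic_gt0. Qed.

Let integrandE y u : transform_integrand y u = (expR (- x * y) * c (y * u))%:C *
  cexp ((2 * s - 1) * (ln y)%:C + (s - 1) * (ln (1 - u ^+ 2))%:C).
Proof. by rewrite /transform_integrand cexpD rmorphM/= -!/(cpow _ _); ring. Qed.

Let ccont_cst (z : R[i]) (u : R) : ccontinuous_at (fun=> z) u.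
Proof. by split; exact: cvg_cst. Qed.

Let ccont_cpow (f : R -> R) (u : R) (z : R[i]) : {for u, continuous f} -> 0 < f u ->
  ccontinuous_at (fun u => cpow (f u) z) u.
Proof.
move=> cf f0; apply: ccontinuous_cexp.
exact: (continuous_comp cf (continuous_ln f0)).
Qed.

Let range1 : range (fun t : R => 1 * logistic t) = `]0, 1[%classic.
Proof. exact: (range_logistic (@ltr01 R)). Qed.

Let cont_scaled (y : R) : continuous (fun t => y * logistic' t).
Proof. by move=> t; apply: cvgM; [exact: cvg_cst|exact: continuous_logistic']. Qed.

Let gt0_scaled (y : R) : 0 < y -> forall t, 0 < y * logistic' t.
Proof. by move=> y0 t; rewrite mulr_gt0 ?logistic'_gt0. Qed.

Let cont_integrand (y t : R) : 0 < y ->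
  ccontinuous_at (transform_integrand y) (1 * logistic t).
Proof.
move=> y0; apply: ccontinuousM; first apply: ccontinuousM.
- exact: ccont_cst.
- apply: ccont_cpow; last by rewrite mul1r onesub.
  by apply: has_der_continuous; der.
- apply: ccontinuous_real.
  have h : {for 1 * logistic t, continuous (fun u : R => y * u)}.
    by apply: has_der_continuous; der.
  exact: (continuous_comp h (@cc _)).
Qed.

Lemma transform_integrable_inner (y : R) : 0 < y ->
  cintegrable `]0, 1[ (transform_integrand y).
Proof.
move=> y0; rewrite -range1.
apply/(cintegrable_subst (der_scaled_logistic 1) (@cont_scaled 1)
  (gt0_scaled (@ltr01 R)) (fun t => @cont_integrand y t y0)).
pose K := expR (- x * y) * expR ((2 * sigma - 1) * ln y).
have bnd t : `|1 * logistic' t * (expR (- x * y) * c (y * (1 * logistic t)))| *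
    expR (complex.Re ((2 * s - 1) * (ln y)%:C + (s - 1) * (ln (1 - (1 * logistic t) ^+ 2))%:C))
    <= K * beta t.
  rewrite !mul1r Re_addc !Re_mulc/= !mulr0 !subr0 Re_2s1 Re_s1 expRD /K /beta.
  have := logistic'_gt0 t; move: (logistic' t) => L L0.
  set A := expR (- x * y); set B := expR (_ * ln y); set C := expR _.
  have -> : A * B * (C * L) = L * (A * 1) * (B * C) by ring.
  rewrite ler_wpM2r ?mulr_ge0 ?expR_ge0// !normrM (gtr0_norm L0) ler_wpM2l ?(ltW L0)//.
  by rewrite (ger0_norm (expR_ge0 _)) ler_wpM2l ?expR_ge0.
have fE t : (1 * logistic' t)%:C * transform_integrand y (1 * logistic t) =
    (1 * logistic' t * (expR (- x * y) * c (y * (1 * logistic t))))%:C *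
    cexp ((2 * s - 1) * (ln y)%:C + (s - 1) * (ln (1 - (1 * logistic t) ^+ 2))%:C).
  by rewrite integrandE [in RHS]rmorphM mulrA.
apply: (@le_cintegrable R setT _ (fun t => K * beta t)) => //.
- apply: cmeasurableM; apply: ccontinuous_cmeasurable => t.
    by apply: ccontinuous_real; exact: cont_scaled.
  have h := @cont_integrand y t y0; have d := der_scaled_logistic 1 t.
  have cl : {for t, continuous (fun t => 1 * logistic t)} by exact: has_der_continuous d.
  by split; [exact: (continuous_comp cl h.1)|exact: (continuous_comp cl h.2)].
- by move=> t _; rewrite fE (le_trans (norm_Re_cexp _ _)).
- by move=> t _; rewrite fE (le_trans (norm_Im_cexp _ _)).
- exact: integrable_EFinZ.
Qed.

Let scaled_sqr (y t : R) : y ^+ 2 - (y * logistic t) ^+ 2 = y * y * (1 - logistic t ^+ 2).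
Proof. by ring. Qed.

Let cpow1 (y : R) : 0 < y -> cpow y 1 = y%:C.
Proof. by move=> y0; rewrite -[1]/(1%:C) cpow_real mul1r lnK. Qed.

(** With [a = y u] one has [y^(2 s - 1) (1 - u^2)^(s - 1) du = (y^2 - a^2)^(s - 1) da]. Both sides
    are pulled back to the line by the logistic map and compared there. *)
Lemma transform_inner (y : R) : 0 < y ->
  cintegral `]0, 1[ (transform_integrand y) =
  cintegral `]0, y[ (fun a => (c a * expR (- x * y))%:C * cpow (y ^+ 2 - a ^+ 2) (s - 1)).
Proof.
move=> y0; rewrite -range1 -(range_logistic y0).
rewrite (cintegral_subst (der_scaled_logistic 1))//; last 2 first.
- exact: gt0_scaled.
- by move=> t; exact: cont_integrand.
rewrite (cintegral_subst (der_scaled_logistic y))//; last 2 first.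
- exact: gt0_scaled.
- move=> t; apply: ccontinuousM.
    apply: ccontinuous_real; apply: cvgM; [exact: cc|exact: cvg_cst].
  apply: ccont_cpow; first by apply: has_der_continuous; der.
  by rewrite scaled_sqr !mulr_gt0.
apply: eq_cintegral => t _; rewrite !mul1r scaled_sqr !cpowM ?mulr_gt0//.
rewrite /transform_integrand.
have -> : cpow y (2 * s - 1) = cpow y (s - 1) * cpow y (s - 1) * y%:C.
  by rewrite -(cpow1 y0) -!cpowD; congr cpow; ring.
by rewrite !rmorphM/=; ring.
Qed.

(** The region [0 < a < y] as a product of half-line indicators, a form whose joint measurability in
    [(y, a)] is immediate. *)
Let ind_pair (y a : R) : \1_(`]0, y[%classic : set R) a = \1_P a * \1_P (y - a) :> R.
Proof.
rewrite !indicE !mem_setE !in_itv/= !andbT subr_gt0.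
by case: (0 < a); rewrite ?mul1r ?mul0r.
Qed.

(** Outside [0 < a < y] the base of the power may be nonpositive, where [ln] has only a default
    value; the indicators remove that region. *)
Let hh (z : R * R) : R[i] := (\1_P z.2 * \1_P (z.1 - z.2) * (c z.2 * expR (- x * z.1)))%:C *
  cpow (z.1 ^+ 2 - z.2 ^+ 2) (s - 1).
Let gg (z : R * R) : R := \1_P z.2 * \1_P (z.1 - z.2) * expR (- x * z.1) *
  expR ((sigma - 1) * ln (z.1 ^+ 2 - z.2 ^+ 2)).

Let mP : measurable P. Proof. exact: measurable_itv. Qed.

Let mi : measurable_fun setT (\1_P : R -> R).
Proof. exact: measurable_indic. Qed.

Let m_ind : measurable_fun setT (fun z : R * R => \1_P z.2 * \1_P (z.1 - z.2) : R).
Proof.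
apply: measurable_funM.
  by apply: (measurableT_comp mi); exact: measurable_snd.
apply: (measurableT_comp mi).
by apply: measurable_funB; [exact: measurable_fst|exact: measurable_snd].
Qed.

Let m_exp : measurable_fun setT (fun z : R * R => expR (- x * z.1)).
Proof.
apply: (measurableT_comp (@measurable_expR R)).
by apply: measurable_funM; [exact: measurable_cst|exact: measurable_fst].
Qed.

Let m_ln : measurable_fun setT (fun z : R * R => ln (z.1 ^+ 2 - z.2 ^+ 2)).
Proof.
apply: (measurableT_comp (@measurable_ln R)); apply: measurable_funB.
  by apply: measurable_funX; exact: measurable_fst.
by apply: measurable_funX; exact: measurable_snd.
Qed.

Let mhh : cmeasurable setT hh.
Proof.
apply: cmeasurableM; last exact: cmeasurable_cexp.
apply: cmeasurable_real; apply: measurable_funM => //; apply: measurable_funM => //.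
apply: (measurableT_comp (continuous_measurable_fun cc)); exact: measurable_snd.
Qed.

Let mgg : measurable_fun setT gg.
Proof.
apply: measurable_funM; first exact: measurable_funM.
apply: (measurableT_comp (@measurable_expR R)).
by apply: measurable_funM => //; exact: measurable_cst.
Qed.

Let ind_ge0 (A : set R) (r : R) : 0 <= \1_A r :> R.
Proof. by rewrite indicE. Qed.

Let hh_le z : `|complex.Re (hh z)| <= gg z /\ `|complex.Im (hh z)| <= gg z.
Proof.
have E : complex.Re ((s - 1) * (ln (z.1 ^+ 2 - z.2 ^+ 2))%:C) =
    (sigma - 1) * ln (z.1 ^+ 2 - z.2 ^+ 2) by rewrite Re_mulc/= mulr0 subr0 Re_s1.
have B : `|\1_P z.2 * \1_P (z.1 - z.2) * (c z.2 * expR (- x * z.1))| <=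
    \1_P z.2 * \1_P (z.1 - z.2) * expR (- x * z.1) :> R.
  rewrite !normrM (ger0_norm (expR_ge0 _)) !(ger0_norm (ind_ge0 _ _)).
  rewrite ler_wpM2l ?mulr_ge0//.
  by rewrite -[leRHS]mul1r ler_wpM2r ?expR_ge0.
split; [apply: (le_trans (norm_Re_cexp _ _))|apply: (le_trans (norm_Im_cexp _ _))];
  by rewrite E /gg ler_wpM2r ?expR_ge0.
Qed.

Let C0 : R := \int[mu]_t beta t.
Let G (y : R) : R := expR (- x * y) * expR ((2 * sigma - 1) * ln y).

(** Scaling [a = y u] separates a Beta integral [C0] from a function of [y] alone, which is a Gamma
    integrand with exponent twice the real part of [s]. *)
Let gg_inner (y : R) : (\int[mu]_a (gg (y, a))%:E)%E = (C0 * (\1_P y * G y))%:E.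
Proof.
have [y0|y0] := leP y 0.
  have -> : \1_P y = 0 :> R by rewrite indicE mem_setE in_itv/= andbT ltNge y0.
  rewrite mul0r mulr0; apply: integral0_eq => a _; rewrite /gg/=.
  rewrite -ind_pair indicE mem_setE in_itv/=.
  suff -> : (0 < a < y) = false by rewrite !mul0r.
  by apply/negbTE/negP => /andP[/lt_trans h /h]; rewrite ltNge y0.
have -> : \1_P y = 1 :> R by rewrite indicE mem_setE in_itv/= y0.
pose H a : R := expR (- x * y) * expR ((sigma - 1) * ln (y ^+ 2 - a ^+ 2)).
transitivity (\int[mu]_(a in `]0%R, y[) (H a)%:E)%E.
  rewrite [RHS]integral_mkcond; apply: eq_integral => a _.
  rewrite patchE /gg/= -ind_pair indicE -mulrA -/(H a).
  by case: ifP; rewrite ?mul1r ?mul0r.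
rewrite -(range_logistic y0) (integral_subst (der_scaled_logistic y)) //; last 2 first.
- exact: gt0_scaled.
- move=> t; apply: cvgM; first exact: cvg_cst.
  have u0 : 0 < y ^+ 2 - (y * logistic t) ^+ 2 by rewrite scaled_sqr !mulr_gt0.
  have k1 : {for y * logistic t, continuous (fun a : R => y ^+ 2 - a ^+ 2)}.
    by apply: has_der_continuous; der.
  have k2 := continuous_comp k1 (continuous_ln u0).
  have k3 : {for y * logistic t, continuous (fun a : R => (sigma - 1) * ln (y ^+ 2 - a ^+ 2))}.
    by apply: continuousM => //; exact: cvg_cst.
  exact: (continuous_comp k3 (@continuous_expR R _)).
have E t : H (y * logistic t) * (y * logistic' t) = G y * beta t.
  rewrite /H /G /beta scaled_sqr !lnM ?posrE ?mulr_gt0// !mulrDr !expRD.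
  have -> : (2 * sigma - 1) * ln y = (sigma - 1) * ln y + (sigma - 1) * ln y + ln y by ring.
  by rewrite !expRD lnK//; ring.
under eq_integral do rewrite E EFinM.
rewrite integralZl// -(fineK (integrable_fin_num _ ibeta))// -EFinM; congr EFin.
by rewrite mul1r mulrC.
Qed.

Let iG : mu.-integrable setT (fun y => (\1_P y * G y)%:E).
Proof.
apply/(integrable_EFin_indic mu mP); rewrite -range_expR.
apply/(integrable_subst (@is_derive_expR R) (@continuous_expR R) (@expR_gt0 R)).
  move=> t; apply: cvgM.
    by have : {for expR t, continuous (fun y : R => expR (- x * y))};
      [by apply: has_der_continuous; der|exact].
  have k3 : {for expR t, continuous (fun a : R => (2 * sigma - 1) * ln a)}.
    by apply: continuousM; [exact: cvg_cst|exact: (continuous_ln (expR_gt0 t))].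
  exact: (continuous_comp k3 (@continuous_expR R _)).
have sg : 0 < 2 * sigma by move: hs; lra.
have := integrable_gamma_kernel sg x0; apply: eq_integrable => // t _ /=.
rewrite /G expRK; congr EFin.
by rewrite -[RHS]mulrA -[in RHS]expRD; congr (_ * expR _); ring.
Qed.

Let fubini_ya := cfubini mhh mgg (fun z => (hh_le z).1) (fun z => (hh_le z).2).

Let gg_fin : (\int[mu]_y \int[mu]_a (gg (y, a))%:E < +oo)%E.
Proof.
under eq_integral do rewrite gg_inner.
have h : mu.-integrable setT (fun y => (C0 * (\1_P y * G y))%:E).
  exact: integrable_EFinZ.
exact: integrable_lty h.
Qed.

Let outerE (y : R) : (\1_P y)%:C * cintegral `]0, 1[ (transform_integrand y) =
  cintegral setT (fun a => hh (y, a)).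
Proof.
have [y0|y0] := leP y 0.
  have -> : \1_P y = 0 :> R by rewrite indicE mem_setE in_itv/= andbT ltNge y0.
  rewrite mul0r -(@cintegral0 R setT); apply: eq_cintegral => a _; rewrite /hh/=.
  rewrite -ind_pair indicE mem_setE in_itv/=.
  suff -> : (0 < a < y) = false by rewrite !mul0r.
  by apply/negbTE/negP => /andP[/lt_trans h /h]; rewrite ltNge y0.
have -> : \1_P y = 1 :> R by rewrite indicE mem_setE in_itv/= y0.
rewrite mul1r transform_inner// cintegral_mkcond; apply: eq_cintegral => a _.
by rewrite ind_pair mulrA -rmorphM.
Qed.

Lemma transform_integrable_outer :
  cintegrable `]0, +oo[ (fun y => cintegral `]0, 1[ (transform_integrand y)).
Proof.
apply/(cintegrable_mkcond _ mP); have [h _ _] := fubini_ya gg_fin.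
by apply: eq_cintegrable h => // y _; rewrite outerE.
Qed.

Definition transform_weight (t : R) : R :=
  \int[mu]_(a in `]0, +oo[) (c a * expR (- expR (- t) * a ^+ 2)).

Let f3 (z : R * R) : R[i] := (\1_P z.2 * (c z.2 * expR (- expR (- z.1) * z.2 ^+ 2)))%:C * omega s x z.1.
Let g3 (z : R * R) : R := \1_P z.2 * expR (- expR (- z.1) * z.2 ^+ 2) * romega s x z.1.

Let icw t : mu.-integrable P (fun a => (c a * expR (- expR (- t) * a ^+ 2))%:E).
Proof.
have ig := integrable_gauss (expR_gt0 (- t)).
apply: (@integrableS _ _ _ _ setT) => //.
apply: le_integrable ig => //.
  apply/measurable_EFinP; apply: continuous_measurable_fun => a.
  apply: cvgM; first exact: cc.
  by have : {for a, continuous (fun a : R => expR (- expR (- t) * a ^+ 2))};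
    [by apply: has_der_continuous; der|exact].
move=> a _ /=; rewrite lee_fin normrM -[leRHS]mul1r ler_wpM2r//.
Qed.

(** Two exchanges: in the [(y, a)] plane, so that the [y]-integral becomes the Laplace transform
    above, and in the [(t, a)] plane, to bring the Gaussian integral over [a] inside. The majorant
    of the second integrates in [a] to [sqrt pi / 2 * exp (t / 2)] times [romega], again a Gamma
    kernel. *)
Lemma transformE :
  cintegrable setT (fun t => (transform_weight t)%:C * omega s x t) /\
  cintegral `]0, +oo[ (fun y => cintegral `]0, 1[ (transform_integrand y)) =
  kappa s * cintegral setT (fun t => (transform_weight t)%:C * omega s x t).
Proof.
have m_e : measurable_fun setT (fun z : R * R => expR (- expR (- z.1) * z.2 ^+ 2)).
  apply: (measurableT_comp (@measurable_expR R)); apply: measurable_funM.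
    have k1 : continuous (fun t : R => - expR (- t)).
      by move=> t; apply: has_der_continuous; der.
    by apply: (measurableT_comp (continuous_measurable_fun k1)); exact: measurable_fst.
  by apply: measurable_funX; exact: measurable_snd.
have m_i : measurable_fun setT (fun z : R * R => \1_P z.2 : R).
  by apply: (measurableT_comp mi); exact: measurable_snd.
have mo : cmeasurable setT (fun z : R * R => omega s x z.1).
  have [v1 v2] := ccontinuous_cmeasurable (@ccontinuous_gamma_kernel R (s - 1 / 2) (x ^+ 2 / 4)).
  by split; [apply: (measurableT_comp v1)|apply: (measurableT_comp v2)]; exact: measurable_fst.
have mf3 : cmeasurable setT f3.
  apply: cmeasurableM => //; apply: cmeasurable_real.
  apply: measurable_funM => //; apply: measurable_funM => //.
  by apply: (measurableT_comp (continuous_measurable_fun cc)); exact: measurable_snd.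
have mg3 : measurable_fun setT g3.
  apply: measurable_funM; first exact: measurable_funM.
  have k1 : continuous (romega s x).
    by move=> t; apply: has_der_continuous; rewrite /romega; der.
  by apply: (measurableT_comp (continuous_measurable_fun k1)); exact: measurable_fst.
have B z : `|\1_P z.2 * (c z.2 * expR (- expR (- z.1) * z.2 ^+ 2))| <=
    \1_P z.2 * expR (- expR (- z.1) * z.2 ^+ 2) :> R.
  rewrite !normrM (ger0_norm (expR_ge0 _)) (ger0_norm (ind_ge0 _ _)).
  by rewrite ler_wpM2l// -[leRHS]mul1r ler_wpM2r ?expR_ge0.
have r3 z : `|complex.Re (f3 z)| <= g3 z.
  by rewrite Re_realc normrM ler_pM//; case: (norm_omega s x z.1).
have i3 z : `|complex.Im (f3 z)| <= g3 z.
  by rewrite Im_realc normrM ler_pM//; case: (norm_omega s x z.1).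
have g3in t : (\int[mu]_a (g3 (t, a))%:E)%E =
    (Num.sqrt pi / 2 * (expR (- (x ^+ 2 / 4) * expR t) * expR (sigma * t)))%:E.
  have iP : mu.-integrable P (fun a => (expR (- expR (- t) * a ^+ 2))%:E).
    by apply: integrableS (integrable_gauss (expR_gt0 (- t))).
  have iT : mu.-integrable setT (fun a => (\1_P a * expR (- expR (- t) * a ^+ 2))%:E).
    by apply/(integrable_EFin_indic mu mP).
  have E a : g3 (t, a) = romega s x t * (\1_P a * expR (- expR (- t) * a ^+ 2)).
    by rewrite /g3/= mulrC.
  under eq_integral do rewrite E EFinM.
  rewrite integralZl// -(fineK (integrable_fin_num _ iT))// -EFinM; congr EFin.
  rewrite -[fine _]/(Rintegral _ _ _).
  have -> : \int[mu]_a (\1_P a * expR (- expR (- t) * a ^+ 2)) =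
      \int[mu]_(a in `[0, +oo[) expR (- expR (- t) * a ^+ 2).
    rewrite -Rintegral_itv_obnd_cbnd// [RHS]Rintegral_mkcond; apply: eq_Rintegral => a _.
    by rewrite patchE indicE; case: ifP => _; rewrite ?mul1r ?mul0r.
  rewrite Rintegral_gauss ?expR_gt0// /romega.
  have -> : Num.sqrt (expR (- t)) = expR (- (t / 2)).
    rewrite -[RHS](ger0_norm (expR_ge0 _)) -sqrtr_sqr expr2 -expRD.
    by congr (Num.sqrt (expR _)); field.
  rewrite mulrBl expRD (_ : - (1 / 2 * t) = - (t / 2)); last by field.
  by field; rewrite gt_eqF ?expR_gt0.
have fin3 : (\int[mu]_t \int[mu]_a (g3 (t, a))%:E < +oo)%E.
  under eq_integral do rewrite g3in.
  have h : mu.-integrable setT (fun t =>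
      (Num.sqrt pi / 2 * (expR (- (x ^+ 2 / 4) * expR t) * expR (sigma * t)))%:E).
    apply: integrable_EFinZ => //; apply: integrable_gamma_kernel.
      by move: hs; lra.
    by rewrite divr_gt0 ?exprn_gt0.
  exact: integrable_lty h.
have [j1 j2 j3] := cfubini mf3 mg3 r3 i3 fin3.
have W t : cintegral setT (fun a => f3 (t, a)) = (transform_weight t)%:C * omega s x t.
  rewrite /transform_weight -(cintegral_Zreal (omega s x t) mP (icw t)) [RHS]cintegral_mkcond.
  by apply: eq_cintegral => a _; rewrite /f3/= [in LHS]rmorphM mulrA.
split; first by apply: eq_cintegrable j1 => // t _; rewrite W.
rewrite cintegral_mkcond.
rewrite (eq_cintegral (g := fun y => cintegral setT (fun a => hh (y, a)))); last first.
  by move=> y _; rewrite outerE.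
have [_ _ ->] := fubini_ya gg_fin.
have WT : cintegral setT (fun t => (transform_weight t)%:C * omega s x t) =
    cintegral setT (fun t => cintegral setT (fun a => f3 (t, a))).
  by apply: eq_cintegral => t _; rewrite W.
rewrite WT j3 -(cintegralZ _ measurableT j2).
apply: eq_cintegral => a _.
have [a0|a0] := leP a 0.
  have z0 : \1_P a = 0 :> R by rewrite indicE mem_setE in_itv/= andbT ltNge a0.
  have -> : cintegral setT (fun t => f3 (t, a)) = 0.
    by rewrite -(@cintegral0 R setT); apply: eq_cintegral => t _; rewrite /f3/= z0 !mul0r.
  rewrite mulr0 -(@cintegral0 R setT).
  by apply: eq_cintegral => t _; rewrite /hh/= z0 !mul0r.
have z1 : \1_P a = 1 :> R by rewrite indicE mem_setE in_itv/= a0.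
have io : cintegrable setT (fun t => (expR (- a ^+ 2 * expR (- t)))%:C * omega s x t).
  exact: cintegrable_weighted_omega.
transitivity ((c a)%:C * cintegral `]a, +oo[ (fun y => (expR (- x * y))%:C *
    cpow (y ^+ 2 - a ^+ 2) (s - 1))).
  rewrite -(cintegralZ _ (measurable_itv _) (bessel_laplace hs x0 a0).1) [RHS]cintegral_mkcond.
  apply: eq_cintegral => y _; rewrite /hh/= z1 mul1r.
  have -> : \1_P (y - a) = \1_(`]a, +oo[%classic : set R) y :> R.
    by rewrite !indicE !mem_setE !in_itv/= !andbT subr_gt0.
  by rewrite !rmorphM/=; ring.
rewrite (bessel_laplace hs x0 a0).2 mulrCA; congr (_ * _).
rewrite -(cintegralZ _ measurableT io).
apply: eq_cintegral => t _; rewrite /f3/= z1 mul1r rmorphM/= -mulrA; congr (_ * (_%:C * _)).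
by rewrite mulNr mulNr mulrC.
Qed.
End transform.

(** * The roots of the tangent equation as phase levels *)

Section roots.
Variables (R : realType) (p : R).
Hypothesis p0 : 0 < p.
Notation q := (2 * pi * p).

Let pi0 : 0 < pi :> R. Proof. exact: pi_gt0. Qed.
Let q0 : 0 < q. Proof. by rewrite !mulr_gt0. Qed.

Lemma sin_eq0_natpi (z : R) : 0 <= z -> sin z = 0 -> exists k : nat, z = k%:R * pi.
Proof.
move=> z0 sz; pose k := Num.truncn (z / pi); exists k.
have /andP[k1 k2] : k%:R <= z / pi < k.+1%:R by apply: truncn_itv; rewrite divr_ge0// ltW.
rewrite ler_pdivlMr// in k1; rewrite ltr_pdivrMr// -natr1 mulrDl mul1r in k2.
apply/eqP; rewrite -subr_eq0 eq_le subr_ge0 k1 andbT leNgt; apply/negP => r0.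
have : 0 < sin (z - k%:R * pi) by apply: sin_gt0_pi; rewrite r0/=; lra.
by rewrite sinB sz sin_natpi mulr0 mul0r subrr ltxx.
Qed.

Lemma phaseE (y : R) : phase q (2 * pi * y) = 2 * (pi * y + atan (y / p)).
Proof.
rewrite /phase (_ : 2 * pi * y / q = y / p); first by ring.
by rewrite -mulf_div divff ?mul1r// gt_eqF// mulr_gt0.
Qed.

(** With [th = atan (y / p)] the tangent equation says [sin (pi y + th) = 0], so [pi y + th] is a
    multiple of [pi], positive because both terms are. *)
Lemma root_phase (y : R) : 0 < y -> tan (pi * y) = - y / p <->
  exists k : nat, (1 <= k)%N /\ phase q (2 * pi * y) = 2 * pi * k%:R.
Proof.
move=> y0; set th := atan (y / p).
have cth : 0 < cos th by apply: cos_gt0_pihalf; rewrite atan_gtNpi2 atan_ltpi2.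
have tth : tan th = y / p by rewrite atanK.
have th0 : 0 < th by rewrite -(@atan0 R) lt_atan// divr_gt0.
split=> [ty|[k [k1]]].
  (* At a pole the inverse of 0 is 0, so the tangent would be 0, whereas [- y / p] is not. *)
  have cy : cos (pi * y) != 0.
    apply/eqP => c0; move: ty; rewrite /tan c0 invr0 mulr0 => /eqP.
    by rewrite eq_sym mulNr oppr_eq0 gt_eqF// divr_gt0.
  have z0 : 0 <= pi * y + th by rewrite addr_ge0 ?mulr_ge0 ?ltW.
  have sz : sin (pi * y + th) = 0.
    have sy : sin (pi * y) = - y / p * cos (pi * y) by rewrite -ty /tan divfK.
    have st : sin th = y / p * cos th by rewrite -tth /tan divfK// gt_eqF.
    by rewrite sinD sy st; ring.
  have [k kE] := sin_eq0_natpi z0 sz.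
  exists k; split; last by rewrite phaseE -/th kE; ring.
  rewrite lt0n; apply/eqP => k0; move: kE; rewrite k0 mul0r => /eqP.
  by rewrite gt_eqF// addr_gt0 ?mulr_gt0.
rewrite phaseE -/th => h.
have hy : pi * y = k%:R * pi - th by lra.
have ck : cos (k%:R * pi) != 0 :> R.
  apply/eqP => c0; have := cos2Dsin2 (k%:R * pi : R).
  by rewrite c0 sin_natpi expr0n/= addr0 => /eqP; rewrite eq_sym oner_eq0.
rewrite mulNr -tth hy /tan sinB cosB !sin_natpi !mul0r addr0 sub0r.
by field; rewrite ck gt_eqF.
Qed.

Lemma ex_phase (k : nat) : (1 <= k)%N ->
  exists y : R, 0 < y /\ phase q (2 * pi * y) = 2 * pi * k%:R.
Proof.
move=> k1; have k0 : 0 < 2 * pi * k%:R :> R by rewrite !mulr_gt0// ltr0n.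
have [||b bI bE] := @IVT R (phase q) 0 (2 * pi * k%:R) (2 * pi * k%:R) (ltW k0).
- by apply: continuous_subspaceT; exact: continuous_phase.
(* [atan] is nonnegative on the half-line, so [phase] at [2 pi k] is at least [2 pi k], which closes
   the bracket. *)
- rewrite phase0 ge_min (ltW k0)/= le_max; apply/orP; right.
  by rewrite lerDl mulr_ge0// -(@atan0 R) le_atan// divr_ge0 ?ltW.
have b0 : 0 < b.
  move: bI; rewrite in_itv/= le_eqVlt => /andP[/predU1P[b0|//] _].
  by move: bE; rewrite -b0 phase0 => h; rewrite -h ltxx in k0.
exists (b / (2 * pi)); split; first by rewrite divr_gt0// mulr_gt0.
by rewrite [2 * pi * (b / _)]mulrC divfK// gt_eqF// mulr_gt0.
Qed.

(** Each [lam n] has a phase level [k n]. Monotonicity of [phase] makes [k] strictly increasing, and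
    existence of a root at every level makes it surjective on the positive integers; such a map is
    the identity. *)
Lemma roots_enumeration (lam : nat -> R) : increasing_positive_roots p lam ->
  forall n, (1 <= n)%N -> 0 < lam n /\ phase q (2 * pi * lam n) = 2 * pi * n%:R.
Proof.
move=> [incr rootsP].
have lam_gt0 n : (1 <= n)%N -> 0 < lam n.
  by move=> n1; have [_ /(_ (ex_intro _ n (conj n1 erefl)))[]] := rootsP (lam n).
have /choice[k kP] : forall n, exists k : nat, (1 <= n)%N ->
    (1 <= k)%N /\ phase q (2 * pi * lam n) = 2 * pi * k%:R.
  move=> n; have [n0|n1] := leqP n 0; first by exists 0; rewrite leqn0 in n0; rewrite (eqP n0).
  have [_ /(_ (ex_intro _ n (conj n1 erefl)))[y0 /(root_phase y0)[k h]]] := rootsP (lam n).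
  by exists k.
have pi2 : 0 < 2 * pi :> R by rewrite mulr_gt0.
have kmono m n : (1 <= m)%N -> (1 <= n)%N -> (k m < k n)%N = (m < n)%N.
  have H m' n' : (1 <= m')%N -> (m' < n')%N -> (k m' < k n')%N.
    move=> m1 mn; have n1 : (1 <= n')%N by exact: leq_trans mn.
    have : phase q (2 * pi * lam m') < phase q (2 * pi * lam n').
      by apply: phase_homo => //; rewrite ltr_pM2l// incr.
    by rewrite (kP _ m1).2 (kP _ n1).2 ltr_pM2l// ltr_nat.
  move=> m1 n1; apply/idP/idP; last exact: H.
  rewrite !ltnNge; apply: contra; rewrite leq_eqVlt => /predU1P[->//|nm].
  by rewrite ltnW// H.
have kS j : (1 <= j)%N -> exists2 m, (1 <= m)%N & k m = j.
  move=> j1; have [y [y0 yE]] := ex_phase j1.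
  have ty : tan (pi * y) = - y / p by apply/(root_phase y0); exists j.
  have [/(_ (conj y0 ty)) [m [m1 mE]] _] := rootsP y.
  exists m => //; move: yE; rewrite mE (kP _ m1).2 => /(mulfI (lt0r_neq0 pi2))/eqP.
  by rewrite eqr_nat => /eqP.
suff kE n : (1 <= n)%N -> k n = n.
  by move=> n n1; split; [exact: lam_gt0|rewrite (kP _ n1).2 kE].
(* Let [k m = n]. If [m < n], induction gives [k m = m], a contradiction. If [m > n], then
   [k n < n], so induction gives [k (k n) = k n], against strict monotonicity. *)
elim/ltn_ind: n => n ih n1.
have [m m1 km] := kS n n1.
have [mn|nm|mn] := ltngtP m n; last by rewrite mn in km.
  by move: (ih m mn m1); rewrite km => e; rewrite e ltnn in mn.
have : (k n < n)%N by rewrite -{2}km kmono.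
move=> kn; have kn1 : (1 <= k n)%N := (kP _ n1).1.
have := ih _ kn kn1 => kk.
have : (k (k n) < k n)%N by rewrite kmono.
by rewrite kk ltnn.
Qed.
End roots.

(** * Integrals of even functions *)

Section even.
Variable R : realType.
Notation mu := (@lebesgue_measure R).
Notation P := (`]0, +oo[%classic : set R).

Lemma Rintegral_even (h : R -> R) : continuous h -> (forall t, h (- t) = h t) ->
  mu.-integrable setT (fun t => (h t)%:E) ->
  \int[mu]_t h t = 2 * \int[mu]_(t in P) h t.
Proof.
move=> ch eh ih.
have H (g : R -> R) : continuous g -> (forall t, 0 <= g t) -> (forall t, g (- t) = g t) ->
    mu.-integrable setT (fun t => (g t)%:E) ->
    \int[mu]_t g t = 2 * \int[mu]_(t in P) g t.
  move=> cg g0 eg ig; rewrite /Rintegral ge0_symfun_integralT//; last by move=> t /=; rewrite eg.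
  rewrite -set_itvcy fineM//; last first.
    by apply: integrable_fin_num => //; exact: integrableS ig.
  congr (2 * _); rewrite -[LHS]/(Rintegral mu `[0, +oo[ g) -Rintegral_itv_obnd_cbnd//.
  exact: integrableS ig.
pose hp t := Num.max (h t) 0; pose hm t := Num.max (- h t) 0.
have chp : continuous hp by move=> t; apply: continuous_max; [exact: ch|exact: cvg_cst].
have chm : continuous hm.
  have cN : continuous (fun t => - h t) by move=> t; apply: continuousN; exact: ch.
  by move=> t; apply: (@continuous_max _ _ (fun t => - h t) (fun=> 0)); [exact: cN|exact: cvg_cst].
have bnd g : continuous g -> (forall t, `|g t| <= `|h t|) -> mu.-integrable setT (fun t => (g t)%:E).
  move=> cg gh; apply: le_integrable ih => //.
    by apply/measurable_EFinP; exact: continuous_measurable_fun.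
  by move=> t _ /=; rewrite lee_fin.
have ihp : mu.-integrable setT (fun t => (hp t)%:E).
  apply: bnd => // t; rewrite /hp.
  by have [_|_] := leP (h t) 0; rewrite ?normr0.
have ihm : mu.-integrable setT (fun t => (hm t)%:E).
  apply: bnd => // t; rewrite /hm.
  by have [_|_] := leP (- h t) 0; rewrite ?normr0 ?normrN.
have hE t : h t = hp t - hm t.
  rewrite /hp /hm; case: (leP (h t) 0) => h0; case: leP => h1; lra.
have sP (g : R -> R) : mu.-integrable setT (fun t => (g t)%:E) ->
  mu.-integrable P (fun t => (g t)%:E) by exact: integrableS.
rewrite (_ : h = fun t => hp t - hm t); last exact/funext.
rewrite !RintegralB//; [|exact: sP|exact: sP].
rewrite H// => [|t|t]; last 2 first.
- by rewrite /hp le_max lexx orbT.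
- by rewrite /hp eh.
rewrite H// => [|t|t]; last 2 first.
- by rewrite /hm le_max lexx orbT.
- by rewrite /hm eh.
by rewrite mulrBr.
Qed.

Lemma cintegral_even (h : R -> R[i]) : (forall t, ccontinuous_at h t) ->
  (forall t, h (- t) = h t) -> cintegrable setT h ->
  cintegral setT h = 2 * cintegral P h.
Proof.
move=> ch eh [h1 h2]; rewrite (_ : 2 = (2 : R)%:C); last by rewrite rmorph_nat.
apply/eqP; rewrite eq_complex Re_realc Im_realc/=.
apply/andP; split; apply/eqP; apply: Rintegral_even => // t; rewrite ?eh//.
- by case: (ch t).
- by case: (ch t).
Qed.
End even.

(** * The weighted Gaussian as a Bessel function *)

Section bessel.
Variables (R : realType) (s : R[i]) (x : R).
Hypotheses (hs : 1 / 2 < complex.Re s) (x0 : 0 < x).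
Notation mu := (@lebesgue_measure R).

(** Shifting [t] by [ln (2 a / x)] balances the exponents [x^2 exp t / 4] and [a^2 exp (- t)] into
    [a x cosh t] and releases the power of [2 a / x]. The remaining weight is even, so only the even
    part [cosh] of the exponential contributes, and folding the line onto the half-line gives the
    factor 2. *)
Lemma weighted_omega_besselK (a : R) : 0 < a ->
  cintegral setT (fun t => (expR (- a ^+ 2 * expR (- t)))%:C * omega s x t) =
  2 * cpow (2 * a / x) (s - 1 / 2) * besselK (s - 1 / 2) (a * x).
Proof.
move=> a0; set nu := s - 1 / 2; set z := a * x.
have q0 : 0 < 2 * a / x by rewrite divr_gt0// mulr_gt0.
pose E (t : R) : R := expR (- z * ((expR t + expR (- t)) / 2)).
have cE (r : R[i]) t : ccontinuous_at (fun t => (E t)%:C * cexp (r * t%:C)) t.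
  apply: ccontinuousM; last by apply: ccontinuous_cexp; exact: cvg_id.
  by apply: ccontinuous_real; apply: has_der_continuous; rewrite /E; der.
have cO t : ccontinuous_at (fun t => (expR (- a ^+ 2 * expR (- t)))%:C * omega s x t) t.
  apply: ccontinuousM; last exact: ccontinuous_gamma_kernel.
  by apply: ccontinuous_real; apply: has_der_continuous; der.
have sh t : (expR (- a ^+ 2 * expR (- (t + ln (2 * a / x)))))%:C *
    omega s x (t + ln (2 * a / x)) =
    cpow (2 * a / x) nu * ((E t)%:C * cexp (nu * t%:C)).
  rewrite /omega /gamma_kernel -/nu opprD raddfD/= mulrDr cexpD -/(cpow _ _).
  rewrite !expRD expRN (expRN (ln _)) lnK//.
  rewrite mulrA -rmorphM/= -expRD.
  rewrite (_ : _ + _ = - z * ((expR t + (expR t)^-1) / 2)); last first.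
    by rewrite /z; field; rewrite !gt_eqF ?expR_gt0.
  by rewrite -expRN -/(E t); ring.
have z2 : 0 < z / 2 by rewrite divr_gt0// mulr_gt0.
have nu0 : 0 < complex.Re nu by rewrite /nu Re_sub_half subr_gt0.
have [C hC] := gamma_kernel_bound nu0 z2.
have E_le t : E t <= expR (- (z / 2) * expR t).
  rewrite /E ler_expR (_ : - z * _ = - (z / 2) * expR t - (z / 2) * expR (- t)).
    by rewrite lerBlDr lerDl mulr_ge0 ?expR_ge0// ltW.
  by field.
have E_opp t : E (- t) = E t by rewrite /E opprK addrC.
have bnd r t : r = nu \/ r = - nu -> `|E t| * expR (complex.Re (r * t%:C)) <=
    C * expR (- Num.min (complex.Re nu) 1 * `|t|).
  rewrite ger0_norm ?expR_ge0// mulrC [_ * t%:C]mulrC Re_realc.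
  move=> [->|->].
    by apply: le_trans (hC t); rewrite [leRHS]mulrC [t * _]mulrC ler_wpM2l ?expR_ge0.
  rewrite raddfN/= mulrN -mulNr -[`|t|]normrN; apply: le_trans (hC (- t)).
  by rewrite [leRHS]mulrC [- t * _]mulrC -E_opp ler_wpM2l ?expR_ge0.
have ibnd : mu.-integrable setT (EFin \o
    (fun t => C * expR (- Num.min (complex.Re nu) 1 * `|t|))).
  by apply: integrable_EFinZ => //; apply: integrable_expN_norm; rewrite lt_min nu0 ltr01.
have iE r : r = nu \/ r = - nu -> cintegrable setT (fun t => (E t)%:C * cexp (r * t%:C)).
  move=> hr; apply: (le_cintegrable _ _ _ _ ibnd) => // [|t _|t _].
  - exact: (ccontinuous_cmeasurable (cE r)).
  - by apply: le_trans (norm_Re_cexp _ _) _; exact: bnd.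
  - by apply: le_trans (norm_Im_cexp _ _) _; exact: bnd.
have i1 := iE nu (or_introl erefl); have i2 := iE (- nu) (or_intror erefl).
rewrite (cintegral_shift (ln (2 * a / x)) cO).
rewrite (eq_cintegral (fun t _ => sh t)) (cintegralZ _ measurableT i1).
rewrite [RHS]mulrAC [RHS]mulrC; congr (_ * _).
pose h t := (E t)%:C * ccosh (nu * t%:C).
have hE t : h t = 1 / 2 * ((E t)%:C * cexp (nu * t%:C) + (E t)%:C * cexp (- nu * t%:C)).
  by rewrite /h /ccosh mulNr; ring.
have ih : cintegrable setT h.
  apply: eq_cintegrable (cintegrableZ (1 / 2) measurableT (cintegrableD measurableT i1 i2)) => //.
have f_opp : cintegral setT (fun t => (E t)%:C * cexp (- nu * t%:C)) =
    cintegral setT (fun t => (E t)%:C * cexp (nu * t%:C)).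
  rewrite (cintegral_oppT (cE (- nu))); apply: eq_cintegral => t _.
  by rewrite E_opp rmorphN/= mulrNN.
transitivity (cintegral setT h).
  rewrite (eq_cintegral (fun t _ => hE t)) (cintegralZ _ measurableT (cintegrableD measurableT i1 i2)).
  by rewrite (cintegralD measurableT i1 i2) f_opp; field.
have ch t : ccontinuous_at h t.
  rewrite (_ : h = fun t => (1 / 2 : R)%:C *
    ((E t)%:C * cexp (nu * t%:C) + (E t)%:C * cexp (- nu * t%:C))).
    apply: ccontinuousM; first by apply: ccontinuous_real; exact: cvg_cst.
    exact: ccontinuousD.
  by apply/funext => u; rewrite hE halfC.
have eh t : h (- t) = h t.
  by rewrite !hE E_opp rmorphN/= !mulrN !mulNr opprK addrC.
exact: cintegral_even ch eh ih.
Qed.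
End bessel.

(** * Complex series by parts and termwise integration *)

Section series.
Variable R : realType.
Implicit Types (a : nat -> R[i]) (l : R[i]).

Lemma normc_le_parts (z : R[i]) : `|z| <= (`|complex.Re z| + `|complex.Im z|)%:C.
Proof.
rewrite normc_def lecR -[leRHS]ger0_norm ?addr_ge0// -sqrtr_sqr ler_wsqrtr//.
rewrite -(real_normK (num_real (complex.Re z))) -(real_normK (num_real (complex.Im z))).
by have := normr_ge0 (complex.Re z); have := normr_ge0 (complex.Im z); nra.
Qed.

Lemma is_cseries_parts a l :
  \sum_(1 <= n < N.+1) complex.Re (a n) @[N --> \oo] --> complex.Re l ->
  \sum_(1 <= n < N.+1) complex.Im (a n) @[N --> \oo] --> complex.Im l ->
  is_cseries a l.
Proof.
move=> h1 h2; rewrite /is_cseries; apply/cvgrPdist_lt => -[e e'].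
(* Positivity in [R[i]] forces the tolerance to be real. *)
rewrite ltcE/= => /andP[/eqP -> e0]; rewrite -[(e +i* 0)%C]/(e%:C).
have e2 : 0 < e / 2 by rewrite divr_gt0.
near=> N; apply: le_lt_trans (normc_le_parts _) _; rewrite ltcR.
rewrite (splitr e) !raddfB/= Re_sum Im_sum ltrD//; near: N.
  by move/cvgrPdist_lt : h1; exact.
by move/cvgrPdist_lt : h2; exact.
Unshelve. all: end_near. Qed.

Lemma is_cseriesZ (k : R[i]) a l :
  \sum_(1 <= n < N.+1) complex.Re (a n) @[N --> \oo] --> complex.Re l ->
  \sum_(1 <= n < N.+1) complex.Im (a n) @[N --> \oo] --> complex.Im l ->
  is_cseries (fun n => k * a n) (k * l).
Proof.
move=> h1 h2; apply: is_cseries_parts.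
  under eq_fun do under eq_bigr do rewrite Re_mulc.
  under eq_fun do rewrite sumrB -!mulr_sumr.
  by rewrite Re_mulc; apply: cvgB; apply: cvgMl_tmp.
under eq_fun do under eq_bigr do rewrite Im_mulc.
under eq_fun do rewrite big_split/= -!mulr_sumr.
by rewrite Im_mulc; apply: cvgD; apply: cvgMl_tmp.
Qed.
End series.

Section weighted_series.
Variables (R : realType) (s : R[i]) (x : R).
Hypotheses (hs : 1 / 2 < complex.Re s) (x0 : 0 < x).
Notation mu := (@lebesgue_measure R).

(** Termwise integration from a bound on the partial sums alone, which is all that the oscillatory
    series offers. *)
Lemma cvg_weighted_omega (f : nat -> R -> R) (F g : R -> R) :
  (forall m, cintegrable setT (fun t => (f m t)%:C * omega s x t)) ->
  (forall t, \sum_(1 <= m < N.+1) f m t @[N --> \oo] --> F t) ->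
  (forall N t, `|\sum_(1 <= m < N.+1) f m t| <= g t) ->
  mu.-integrable setT (fun t => (g t * romega s x t)%:E) ->
  let I m := cintegral setT (fun t => (f m t)%:C * omega s x t) in
  let J := cintegral setT (fun t => (F t)%:C * omega s x t) in
  [/\ cintegrable setT (fun t => (F t)%:C * omega s x t),
    \sum_(1 <= m < N.+1) complex.Re (I m) @[N --> \oo] --> complex.Re J &
    \sum_(1 <= m < N.+1) complex.Im (I m) @[N --> \oo] --> complex.Im J].
Proof.
move=> fi fF fg gi I J.
pose f_ N t := (\sum_(1 <= m < N.+1) f m t)%:C * omega s x t.
have f_E N t : f_ N t = \sum_(1 <= m < N.+1) (f m t)%:C * omega s x t.
  by rewrite /f_ rmorph_sum/= mulr_suml.
have f_I N : cintegral setT (f_ N) = \sum_(1 <= m < N.+1) I m.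
  by rewrite -(cintegral_sum _ measurableT fi); apply: eq_cintegral => t _.
have g0 t : 0 <= g t by exact: le_trans (fg 0 t).
have [no1 no2] := (fun t => (norm_omega s x t).1, fun t => (norm_omega s x t).2).
have [] := @cdominated_cvg R setT f_ (fun t => (F t)%:C * omega s x t)
  (fun t => g t * romega s x t) measurableT.
- move=> N; apply: cintegrable_cmeasurable.
  by apply: eq_cintegrable (cintegrable_sum _ measurableT fi) => // t _; exact: f_E.
- move=> t _; under eq_fun do rewrite Re_realc.
  by rewrite Re_realc; apply: cvgMr_tmp; exact: fF.
- move=> t _; under eq_fun do rewrite Im_realc.
  by rewrite Im_realc; apply: cvgMr_tmp; exact: fF.
- by move=> N t _; rewrite Re_realc normrM ler_pM.
- by move=> N t _; rewrite Im_realc normrM ler_pM.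
- by [].
move=> i c1 c2; split=> //.
  by under eq_fun do rewrite -Re_sum -f_I.
by under eq_fun do rewrite -Im_sum -f_I.
Qed.
End weighted_series.

(** * Assembling both sides of the identity *)

Section assembly.
Variables (R : realType) (p : R) (lam : nat -> R) (s : R[i]) (x : R).
Hypotheses (p0 : 0 < p) (hlam : increasing_positive_roots p lam).
Hypotheses (hs : 1 / 2 < complex.Re s) (x0 : 0 < x).
Notation mu := (@lebesgue_measure R).
Notation q := (2 * pi * p).
Notation sigma := (complex.Re s).
Notation P := (`]0, +oo[%classic : set R).

Let pi0 : 0 < pi :> R. Proof. exact: pi_gt0. Qed.
Let q0 : 0 < q. Proof. by rewrite !mulr_gt0. Qed.
(** Index 0 receives the endpoint of the half-line, where the phase is 0, in place of the irrelevant
    [lam 0]. *)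
Let nu (n : nat) : R := if n is 0 then 0 else 2 * pi * lam n.
Let nu0 : nu 0 = 0. Proof. by []. Qed.
Let phase_nu n : phase q (nu n) = 2 * pi * n%:R.
Proof.
by case: n => [|n]; rewrite /nu ?phase0 ?mulr0//; case: (roots_enumeration p0 hlam (ltn0Sn n)).
Qed.

Let c (m : nat) (a : R) : R := cos (m%:R * phase q a).
Let cc m : continuous (c m).
Proof.
move=> a; apply: continuous_comp; last exact: continuous_cos.
by apply: continuousM; [exact: cvg_cst|exact: continuous_phase].
Qed.
Let c1 m a : `|c m a| <= 1. Proof. exact: cos_max. Qed.

Lemma integrandE m y : integrand p s x m y = transform_integrand s x (c m) y.
Proof.
apply/funext => u; rewrite /integrand /transform_integrand /c /phase.
by congr (_ * (cos _)%:C); ring.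
Qed.

Lemma transform_weightE m t : transform_weight (c m) t = osc q (expR (- t)) m.
Proof.
rewrite /transform_weight /osc Rintegral_itv_obnd_cbnd//.
apply: le_integrable (integrableS _ _ _ (integrable_gauss (expR_gt0 (- t)))) => //.
  apply/measurable_EFinP; apply: measurable_funTS; apply: measurable_funM.
    exact: continuous_measurable_fun (@cc m).
  have k1 : continuous (fun a : R => expR (- expR (- t) * a ^+ 2)).
    by move=> a; apply: has_der_continuous; der.
  exact: continuous_measurable_fun.
move=> a _ /=; rewrite lee_fin normrM -[leRHS]mul1r ler_wpM2r//.
Qed.

Lemma cintegral_integrandE m :
  cintegrable setT (fun t => (osc q (expR (- t)) m)%:C * omega s x t) /\
  cintegral P (fun y => cintegral `]0, 1[ (integrand p s x m y)) =
  kappa s * cintegral setT (fun t => (osc q (expR (- t)) m)%:C * omega s x t).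
Proof.
have [h1 h2] := transformE hs x0 (@cc m) (@c1 m).
have E t : (transform_weight (c m) t)%:C * omega s x t =
    (osc q (expR (- t)) m)%:C * omega s x t by rewrite transform_weightE.
split; first by apply: eq_cintegrable h1 => // t _; rewrite E.
rewrite -(eq_cintegral (fun t _ => E t)) -h2.
by apply: eq_cintegral => y _; rewrite integrandE.
Qed.

Lemma integrable_integrand m :
  (forall y, 0 < y -> cintegrable `]0, 1[ (integrand p s x m y)) /\
  cintegrable P (fun y => cintegral `]0, 1[ (integrand p s x m y)).
Proof.
split=> [y y0|].
  by rewrite integrandE; exact: transform_integrable_inner hs (@cc m) (@c1 m) y y0.
apply: eq_cintegrable (transform_integrable_outer hs x0 (@cc m) (@c1 m)) => // y _.
by rewrite integrandE.
Qed.

Lemma slowness_root l : slowness q (2 * pi * l) = (p ^+ 2 + l ^+ 2) / (p * (p + 1 / pi) + l ^+ 2).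
Proof.
have pn : pi != 0 :> R by rewrite gt_eqF.
rewrite /slowness.
have -> : q ^+ 2 + (2 * pi * l) ^+ 2 = (2 * pi) ^+ 2 * (p ^+ 2 + l ^+ 2) by ring.
have -> : q ^+ 2 + 2 * q + (2 * pi * l) ^+ 2 = (2 * pi) ^+ 2 * (p * (p + 1 / pi) + l ^+ 2).
  by move: pn; generalize (pi : R) => w wn; field.
by rewrite -mulf_div divff ?mul1r// expf_neq0// mulf_neq0.
Qed.

Lemma slowness0 : slowness q 0 = (1 + 1 / (pi * p))^-1.
Proof.
have -> : slowness q 0 = slowness q (2 * pi * 0) by rewrite mulr0.
rewrite slowness_root expr0n/= !addr0 expr2 -mulf_div divff ?gt_eqF// mul1r -invf_div.
have pn : p != 0 by rewrite gt_eqF.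
have wn : pi != 0 :> R by rewrite gt_eqF.
congr (_^-1); move: wn; generalize (pi : R) => w wn.
by field; rewrite pn wn.
Qed.

Let z := s - 1 / 2.
Let bessel_term (n : nat) : R[i] :=
  ((p ^+ 2 + lam n ^+ 2) / (p * (p + 1 / pi) + lam n ^+ 2))%:C *
  cpow (lam n) z * besselK z (2 * pi * lam n * x).

Let iprofile a : cintegrable setT (fun t => (profile q (expR (- t)) a)%:C * omega s x t).
Proof.
apply: eq_cintegrable (cintegrableZ (slowness q a)%:C measurableT
  (cintegrable_weighted_omega hs x0 a)) => // t _.
by rewrite /profile mulrA -rmorphM/= [slowness _ _ * _]mulrC mulNr mulNr [expR (- t) * _]mulrC.
Qed.

Lemma cintegral_profile n : (1 <= n)%N ->
  cintegral setT (fun t => (profile q (expR (- t)) (nu n))%:C * omega s x t) =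
  2 * cpow (4 * pi / x) z * bessel_term n.
Proof.
move=> n1; have [l0 _] := roots_enumeration p0 hlam n1.
have nE : nu n = 2 * pi * lam n by case: n n1 {l0}.
have v0 : 0 < nu n by rewrite nE !mulr_gt0.
have E t : (profile q (expR (- t)) (nu n))%:C * omega s x t =
    (slowness q (nu n))%:C * ((expR (- nu n ^+ 2 * expR (- t)))%:C * omega s x t).
  by rewrite /profile mulrA -rmorphM/= [slowness _ _ * _]mulrC mulNr mulNr [expR (- t) * _]mulrC.
rewrite (eq_cintegral (fun t _ => E t)).
rewrite (cintegralZ _ measurableT (cintegrable_weighted_omega hs x0 (nu n))).
rewrite (weighted_omega_besselK hs x0 v0) nE slowness_root /bessel_term -/z.
have -> : 2 * (2 * pi * lam n) / x = (4 * pi / x) * lam n by field; rewrite gt_eqF.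
by rewrite cpowM ?divr_gt0 ?mulr_gt0//; ring.
Qed.

(** The bound on the node sums uses no information on the spacing of the roots. The terms are
    nonnegative, so partial sums are at most [S t]; the Poisson limit is at most 8 and its boundary
    term is nonnegative, so [pi * S t], and hence [S t], is at most
    [8 + sqrt pi / 4 * exp (t / 2)]. *)
Lemma exists_scale_sum : exists S : R -> R, forall t,
  [/\ \sum_(1 <= n < M.+1) profile q (expR (- t)) (nu n) @[M --> \oo] --> S t,
   \sum_(1 <= m < N.+1) osc q (expR (- t)) m @[N --> \oo] -->
     pi / 2 * slowness q 0 + pi * S t - Num.sqrt pi / 4 * expR (t / 2) &
   forall M, `|\sum_(1 <= n < M.+1) profile q (expR (- t)) (nu n)| <=
     8 + Num.sqrt pi / 4 * expR (t / 2)].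
Proof.
have /choice[S hS] := fun t : R => poisson_scale q0 nu0 phase_nu (expR_gt0 (- t)).
exists S => t; have [h1 h2] := hS t.
have sqE : Num.sqrt (expR (- t)) = expR (- (t / 2)).
  rewrite -[RHS](ger0_norm (expR_ge0 _)) -sqrtr_sqr expr2 -expRD.
  by congr (Num.sqrt (expR _)); field.
have LE : pi / 2 * profile q (expR (- t)) 0 + pi * S t
    - 1 / 2 * (Num.sqrt pi / (2 * Num.sqrt (expR (- t)))) =
    pi / 2 * slowness q 0 + pi * S t - Num.sqrt pi / 4 * expR (t / 2).
  rewrite sqE (expRN (t / 2)) /profile expr0n/= mulr0 expR0 mul1r; congr (_ - _).
  by field; rewrite gt_eqF ?expR_gt0.
rewrite LE in h2.
pose k n := profile q (expR (- t)) (nu n).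
have k0 n : 0 <= k n by rewrite /k /profile mulr_ge0 ?expR_ge0// ltW// slowness_gt0.
have ndk : nondecreasing_seq (fun M => \sum_(1 <= n < M.+1) k n).
  by apply/nondecreasing_seqP => M; rewrite [leRHS]big_nat_recr//= lerDl.
have leS M : \sum_(1 <= n < M.+1) k n <= S t.
  have := nondecreasing_cvgn_le ndk (cvgP _ h1) M.
  by rewrite (cvg_lim _ h1).
have S0 : 0 <= S t by apply: le_trans (leS 0); rewrite big_geq.
have L8 : pi / 2 * slowness q 0 + pi * S t - Num.sqrt pi / 4 * expR (t / 2) <= 8.
  apply: cvgr_to_le h2 _; apply: nearW => N.
  exact: le_trans (ler_norm _) (norm_osc_sum q0 (expR_gt0 (- t)) N).
split=> // M; rewrite ger0_norm; last by apply: sumr_ge0 => n _; exact: k0.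
apply: le_trans (leS M) _.
have pS : S t <= pi * S t by rewrite ler_peMl// (le_trans _ (@pi_ge2 R))// ler1n.
have : 0 <= pi / 2 * slowness q 0.
  exact: mulr_ge0 (divr_ge0 (ltW pi0) (ler0n _ _)) (ltW (slowness_gt0 q0 0)).
by lra.
Qed.

Let bessel_const := 2 * cpow (4 * pi / x) z.
Let bessel_const_neq0 : bessel_const != 0.
Proof. by rewrite mulf_neq0 ?cpow_neq0// pnatr_eq0. Qed.

Let Iz := cpow (x ^+ 2 / 4) (- z) * cGamma z.
Let I1 := cpow (x ^+ 2 / 4) (- s) * cGamma s.

(** [J] is the integral of [S] against [omega]. Integrating the two limits of [exists_scale_sum]
    expresses both series through it, so their relation becomes pure algebra. *)
Lemma series_limits : exists J : R[i],
  is_cseries (fun m => cintegral P (fun y => cintegral `]0, 1[ (integrand p s x m y)))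
    (kappa s * ((pi / 2 * slowness q 0)%:C * Iz + pi%:C * J - (Num.sqrt pi / 4)%:C * I1)) /\
  is_cseries bessel_term (bessel_const^-1 * J).
Proof.
have [S hS] := exists_scale_sum.
have x2 : 0 < x ^+ 2 / 4 by rewrite divr_gt0// exprn_gt0.
have s0 : 0 < sigma by move: hs; lra.
have iromega := integrable_romega hs x0.
(* The growth [exp (t / 2)] only raises the exponent of the weight from [Re s - 1/2] to [Re s],
   which keeps the majorant integrable and turns the last Poisson term into a Gamma integral at
   [s]. *)
have shift t : expR (t / 2) * romega s x t = expR (- (x ^+ 2 / 4) * expR t) * expR (sigma * t).
  rewrite /romega mulrCA; congr (_ * _); rewrite -expRD; congr expR.
  by field.
have shiftC t : (expR (t / 2))%:C * omega s x t = gamma_kernel s (x ^+ 2 / 4) t.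
  rewrite /omega /gamma_kernel mulrCA; congr (_ * _); rewrite -cexp_real -cexpD; congr cexp.
  rewrite mulrBl halfC -rmorphM/= [1 / 2 * t](_ : _ = t / 2); first by rewrite addrC subrK.
  by rewrite mulrC mulrA mulr1.
have ig : mu.-integrable setT
    (fun t => ((8 + Num.sqrt pi / 4 * expR (t / 2)) * romega s x t)%:E).
  rewrite (_ : (fun t => _) = (fun t => (8 * romega s x t + Num.sqrt pi / 4 *
      (expR (- (x ^+ 2 / 4) * expR t) * expR (sigma * t)))%:E)).
    apply: integrable_EFinD => //; first exact: integrable_EFinZ.
    by apply: integrable_EFinZ => //; exact: integrable_gamma_kernel.
  by apply/funext => t; rewrite -shift; congr EFin; ring.
have [iS cS1 cS2] := cvg_weighted_omega (fun n => iprofile (nu n))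
  (fun t => let: And3 h _ _ := hS t in h) (fun M t => let: And3 _ _ h := hS t in h M) ig.
pose J := cintegral setT (fun t => (S t)%:C * omega s x t).
exists J; split; last first.
  have := @is_cseriesZ R bessel_const^-1 (fun n => cintegral setT (fun t =>
    (profile q (expR (- t)) (nu n))%:C * omega s x t)) J cS1 cS2.
  rewrite /is_cseries; apply: cvg_trans; apply: near_eq_cvg; apply: nearW => N.
  apply: eq_big_nat => n /andP[n1 _]; rewrite (cintegral_profile n1) -/bessel_const.
  by rewrite mulKf.
have i8 : mu.-integrable setT (fun t => (8 * romega s x t)%:E) by exact: integrable_EFinZ.
pose L t := pi / 2 * slowness q 0 + pi * S t - Num.sqrt pi / 4 * expR (t / 2).
have hL t : \sum_(1 <= m < N.+1) osc q (expR (- t)) m @[N --> \oo] --> L t by case: (hS t).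
have [iL cL1 cL2] := cvg_weighted_omega (g := fun=> 8) (fun m => (cintegral_integrandE m).1) hL
  (fun N t => norm_osc_sum q0 (expR_gt0 (- t)) N) i8.
have := @is_cseriesZ R (kappa s) (fun m => cintegral setT (fun t =>
  (osc q (expR (- t)) m)%:C * omega s x t)) (cintegral setT (fun t => (L t)%:C * omega s x t)) cL1 cL2.
have io := cintegrable_omega hs x0.
have ik := cintegrable_gamma_kernel s0 x2.
have -> : cintegral setT (fun t => (L t)%:C * omega s x t) =
    (pi / 2 * slowness q 0)%:C * Iz + pi%:C * J - (Num.sqrt pi / 4)%:C * I1.
  have E t : (L t)%:C * omega s x t = (pi / 2 * slowness q 0)%:C * omega s x t +
      pi%:C * ((S t)%:C * omega s x t) +
      - (Num.sqrt pi / 4)%:C * gamma_kernel s (x ^+ 2 / 4) t.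
    by rewrite -shiftC /L rmorphB rmorphD !(rmorphM _ pi) (rmorphM _ _ (expR _))/=; ring.
  have j1 := cintegrableZ (pi / 2 * slowness q 0)%:C measurableT io.
  have j2 := cintegrableZ pi%:C measurableT iS.
  have j3 := cintegrableZ (- (Num.sqrt pi / 4)%:C) measurableT ik.
  rewrite (eq_cintegral (fun t _ => E t)).
  rewrite (cintegralD measurableT (cintegrableD measurableT j1 j2) j3).
  rewrite (cintegralD measurableT j1 j2) (cintegralZ _ measurableT io).
  rewrite (cintegralZ _ measurableT iS) (cintegralZ _ measurableT ik) mulNr.
  have z0 : 0 < complex.Re z by rewrite Re_sub_half subr_gt0.
  have -> : cintegral setT (omega s x) = Iz by exact: cGamma_scale z0 x2.
  by rewrite (cGamma_scale s0 x2).
rewrite /is_cseries; apply: cvg_trans; apply: near_eq_cvg; apply: nearW => N.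
by apply: eq_bigr => m _; rewrite (cintegral_integrandE m).2.
Qed.
End assembly.

(** The final comparison as a rational identity. [X], [P], [T] stand for the powers of [x], [pi] and
    2 with exponent [s - 1/2], [r] for [sqrt pi], [G] and [Gz] for Gamma at [s] and [s - 1/2], and
    [k] for [slowness] at 0. *)
Lemma completed_series_identity (F : numFieldType) (X P T r x G Gz J k : F) :
  X != 0 -> P != 0 -> T != 0 -> r != 0 -> x != 0 -> G != 0 ->
  (T * T)^-1 * X * (P * r)^-1 / G * (G * (2 * r)^-1 *
    (r ^+ 2 / 2 * k * ((T / X) ^+ 2 * Gz) + r ^+ 2 * J - r / 4 * ((T / X) ^+ 2 * (2 / x) * G))) =
  (2 * (T ^+ 2 * P / X))^-1 * J + (P * X)^-1 / 4 * (Gz * k) - (P * r)^-1 * (X * x)^-1 * G / 4.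
Proof.
move=> X0 P0 T0 r0 x0 G0; field.
by rewrite X0 P0 T0 r0 x0 G0.
Qed.

Theorem theorem3p3 (R : realType) (p : R) (lam : nat -> R) (s : R[i]) (x : R)
    (hp : 0 < p) (hlam : increasing_positive_roots p lam)
    (hs : 1 / 2 < complex.Re s) (hx : 0 < x) :
  (forall m : nat, (1 <= m)%N ->
     (forall y : R, 0 < y -> cintegrable `]0, 1[ (integrand p s x m y)) /\
     cintegrable `]0, +oo[
       (fun y : R => cintegral `]0, 1[ (integrand p s x m y))) /\
  (exists A B : R[i],
    is_cseries (fun m : nat =>
      cintegral `]0, +oo[
        (fun y : R => cintegral `]0, 1[ (fun u : R => integrand p s x m y u))) A /\
    is_cseries (fun n : nat =>
      ((p ^+ 2 + lam n ^+ 2) / (p * (p + 1 / pi) + lam n ^+ 2))%:C *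
      cpow (lam n) (s - 1 / 2) *
      besselK (s - 1 / 2) (2 * pi * lam n * x)) B /\
    cpow 2 (1 - 2 * s) * cpow x (s - 1 / 2) * cpow pi (- s) / cGamma s * A =
    B + cpow (pi * x) (1 / 2 - s) / 4 *
          (cGamma (s - 1 / 2) / (1 + 1 / (pi * p))%:C)
      - cpow pi (- s) * cpow x (- s - 1 / 2) * cGamma s / 4).
Proof.
split=> [m _|]; first exact: integrable_integrand.
have pi0 : 0 < pi :> R := pi_gt0 R.
have [J [hA hB]] := series_limits hp hlam hs hx.
do 2 eexists; split; first exact: hA.
split; first exact: hB.
rewrite slowness0// /kappa; set z := s - 1 / 2.
have sE : s = z + 1 / 2 by rewrite /z subrK.
have two : 0 < 2 :> R by [].
(* Every power in the statement is rewritten through these three, [sqrt pi] and [x], using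
   [s = z + 1/2]. *)
pose X := cpow x z; pose P := cpow pi z; pose T := cpow 2 z.
have h2 : cpow 2 (1 - 2 * s) = (T * T)^-1.
  rewrite -cpowD -cpowN; congr cpow; rewrite sE; by field.
have hpi : cpow pi (- s) = (P * (Num.sqrt pi)%:C)^-1.
  by rewrite cpowN sE cpowD cpow_half.
have x2 : 0 < x ^+ 2 / 4 by rewrite divr_gt0// exprn_gt0.
(* Multiplying by [T * T] clears the quotient and leaves products of positive bases, where [cpowM]
   applies. *)
have hY : cpow (x ^+ 2 / 4) z = (X / T) ^+ 2.
  have : cpow (x ^+ 2 / 4) z * (T * T) = X * X.
    rewrite /T /X -(cpowM z two two) -(cpowM z x2 (mulr_gt0 two two)) -(cpowM z hx hx).
    by have -> : x ^+ 2 / 4 * (2 * 2) = x * x by field.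
  by move=> h; rewrite [RHS]expr2 mulf_div -h mulfK// mulf_neq0// cpow_neq0.
have hz : cpow (x ^+ 2 / 4) (- z) = (T / X) ^+ 2.
  by rewrite cpowN hY -exprVn invf_div.
have hs' : cpow (x ^+ 2 / 4) (- s) = (T / X) ^+ 2 * (2 / x%:C).
  rewrite sE opprD cpowD hz cpowN cpow_half//; congr (_ * _).
  have -> : x ^+ 2 / 4 = (x / 2) ^+ 2 by field.
  by rewrite sqrtr_sqr ger0_norm ?divr_ge0 ?ltW// -fmorphV invf_div rmorphM/= fmorphV rmorph_nat.
have hD : cpow (4 * pi / x) z = T ^+ 2 * P / X.
  rewrite -[LHS](mulfK (cpow_neq0 x z)) -(cpowM z (divr_gt0 (mulr_gt0 _ pi0) hx) hx) ?ltr0n//.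
  rewrite divfK ?gt_eqF//.
  have -> : 4 * pi = 2 * 2 * pi :> R by ring.
  by rewrite (cpowM z (mulr_gt0 two two) pi0) (cpowM z two two).
have hpx : cpow (pi * x) (1 / 2 - s) = (P * X)^-1.
  by rewrite (cpowM _ pi0 hx) (_ : 1 / 2 - s = - z) ?cpowN ?invfM//; rewrite /z opprB.
have hx' : cpow x (- s - 1 / 2) = (X * x%:C)^-1.
  rewrite -(cpow1 hx) -cpowD -cpowN; congr cpow; rewrite /z; by field.
have piE : pi%:C = (Num.sqrt pi)%:C ^+ 2 :> R[i] by rewrite -rmorphXn/= sqr_sqrtr// ltW.
have r0 : (Num.sqrt pi)%:C != 0 :> R[i] by rewrite fmorph_eq0 sqrtr_eq0 -ltNge.
have xn : x%:C != 0 :> R[i] by rewrite fmorph_eq0 gt_eqF.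
(* The factor [cGamma s] in [kappa] meets its inverse on the left side; cancelling them needs
   this. *)
have G0 : cGamma s != 0 by apply: cGamma_neq0; move: hs; lra.
have := completed_series_identity (cGamma z) J (1 + 1 / (pi * p))%:C^-1 (cpow_neq0 x z) (cpow_neq0 pi z)
  (cpow_neq0 2 z) r0 xn G0.
rewrite h2 hpi hz hs' hD hpx hx' -/X -/P -/T -piE => <-; congr (_ * (_ * _)).
  by rewrite fmorphV rmorphM/= rmorph_nat.
rewrite !rmorphM/= !fmorphV !rmorph_nat; congr (_ + _ - _).
Qed.
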